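(* The pseudo-resolvent family $(R^\ast_\lambda)_{\lambda>0}$ has the contraction property, i.e. $\langle\lambda R^\ast_\lambda g,\lambda R^\ast_\lambda g\rangle\le\langle g,g\rangle$ for all $g\in H$ and $\lambda>0$, and is Markovian, i.e. for all $\lambda>0$ and $g\in H$, $0\le g\le1$ $\pi$-a.e. implies $0\le\lambda R^\ast_\lambda g\le1$ $\pi$-a.e.
   Context: Setting. $(M,g)$ is a compact oriented $d$-dimensional Riemannian manifold without boundary, $U\in C^1(M)$ is such that $\pi(dx)=e^{-U(x)}\mathrm{vol}(dx)$ is a probability measure, $\langle f,h\rangle=\int_M fh\,d\pi$, and $v\cdot w$ denotes the Riemannian inner product of tangent vectors. $A$ is the Friedrichs extension in $L^2(M,\pi)$ of $f\mapsto\Delta f-\nabla U\cdot\nabla f$ on $C^\infty(M)$ ($\Delta$ has spectrum in $(-\infty,0]$). It is assumed that $A$ has discrete spectrum $0=\lambda_0>-\lambda_1\ge-\lambda_2\ge\dots$ with $\lambda_n\to\infty$ and a complete orthonormal basis of eigenvectors $\phi_0,\phi_1,\dots$ of $L^2(M,\pi)$, with $\phi_0$ spanning the constants. $H=L^2(M,\pi)$, $H^m=\{\varphi=\sum_{k\ge0}a_k\phi_k\in L^2(M,\pi):\ \sum_{k\ge0}|a_k|^2\lambda_k^m<\infty\}$, and $\langle f,h\rangle_{H^1}=\int_M\nabla f\cdot\nabla h\,d\pi$ on $H^1$. $b$ is a $C^1$ vector field on $M$ with $\mathrm{div}(e^{-U}b)=0$ and $H^1\subset\mathrm{Dom}(b\cdot\nabla)$.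 $B:H^1\to H$ is the continuous extension of $f\mapsto b\cdot\nabla f$ from smooth functions; it is antisymmetric. $R^\ast_\lambda g:=-P_{1,\lambda}(A-\lambda)^{-1}g$ for $g\in H$, $\lambda>0$, where $P_{1,\lambda}$ is the orthogonal projection of $H^1$ onto $\mathrm{Ker}(B)\cap H^1=\{\varphi\in H^1:B\varphi=0\}$ with respect to $\langle\psi,\varphi\rangle_{1,\lambda}=\langle\psi,\varphi\rangle_{H^1}+\lambda\langle\psi,\varphi\rangle$. ($R^\ast_\lambda g$ is the limit in $H^1$, as $|c|\to\infty$, of $-(A+cB-\lambda)^{-1}g$.) *)

(* Defs.v *)
From mathcomp Require Import all_boot all_order all_algebra.
From mathcomp Require Import all_classical all_reals all_analysis.
From mathcomp Require Import measurable_realfun.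
Set Implicit Arguments.
Unset Strict Implicit.
Unset Printing Implicit Defensive.
Import Order.TTheory GRing.Theory Num.Theory.
Import numFieldNormedType.Exports.
Local Open Scope classical_set_scope.
Local Open Scope ring_scope.

(* F is of class C^k on the open set O of R^d.  Taking the directional
   derivatives v by v is enough, R^d being finite-dimensional. *)
Fixpoint class_on (R : realType) (d : nat) (V : normedModType R) (k : nat)
    (O : set 'rV[R]_d) (F : 'rV[R]_d -> V) : Prop :=
  match k with
  | 0 => forall x, O x -> {for x, continuous F}
  | j.+1 => (forall x, O x -> differentiable F x) /\
            (forall v, class_on j O (fun x => 'D_v F x))
  end.

(* Oriented d-dimensional Riemannian manifold, given by an oriented smooth
   atlas.  [coord c] and [point_of c] matter only on [dom c] and on
   [coord c @` dom c].  [gram c x] is the matrix of the metric at x in the frame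
   of the chart c; components of tangent vectors are row vectors, so that the
   change of chart is u |-> u *m 'J (coord c' \o point_of c) (coord c x). *)
Record riemannian (R : realType) (d : nat) (M : ptopologicalType) := Riemannian {
  chart : Type;
  dom : chart -> set M;
  coord : chart -> M -> 'rV[R]_d;
  point_of : chart -> 'rV[R]_d -> M;
  gram : chart -> M -> 'M[R]_d;
  dom_open : forall c, open (dom c);
  dom_cover : forall x, exists c, dom c x;
  patch_open : forall c, open (coord c @` dom c);
  coordK : forall c x, dom c x -> point_of c (coord c x) = x;
  coord_continuous : forall c x, dom c x -> {for x, continuous (coord c)};
  point_of_continuous : forall c y, (coord c @` dom c) y ->
    {for y, continuous (point_of c)};
  transition_smooth : forall c c' k,
    class_on k (coord c @` (dom c `&` dom c')) (coord c' \o point_of c);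
  transition_oriented : forall c c' x, dom c x -> dom c' x ->
    0 < \det ('J (coord c' \o point_of c) (coord c x));
  gram_sym : forall c x, dom c x -> (gram c x)^T = gram c x;
  gram_pos : forall c x (u : 'rV[R]_d), dom c x -> u != 0 ->
    0 < (u *m gram c x *m u^T) 0 0;
  gram_smooth : forall c k,
    class_on k (coord c @` dom c) (fun y => gram c (point_of c y));
  gram_transition : forall c c' x, dom c x -> dom c' x ->
    let J := 'J (coord c' \o point_of c) (coord c x) in
    gram c x = J *m gram c' x *m J^T }.

Notation borel T := (g_sigma_algebraType (@open T)).

Section Manifold.
Variables (R : realType) (d : nat) (M : ptopologicalType).
Variable g : riemannian R d M.
Implicit Types (f h w U : M -> R) (c : chart g).

Definition patch c : set 'rV[R]_d := coord c @` dom c.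

Definition class_C k f := forall c, class_on k (patch c) (f \o point_of c).

Definition smooth f := forall k, class_C k f.

(* A vector field is the family of its components in all charts. *)
Definition field := chart g -> M -> 'rV[R]_d.

Definition is_vector_field (X : field) := forall c c' x, dom c x -> dom c' x ->
  X c' x = X c x *m 'J (coord c' \o point_of c) (coord c x).

Definition field_C k (X : field) :=
  is_vector_field X /\ forall c, class_on k (patch c) (X c \o point_of c).

Definition scale_field f (X : field) : field := fun c x => f x *: X c x.

Definition partial c (i : 'I_d) f : M -> R :=
  fun x => 'D_(delta_mx 0 i) (f \o point_of c) (coord c x).

Definition grad f : field :=
  fun c x => (\row_i partial c i f x) *m invmx (gram c x).

Definition chart_at (x : M) : chart g := projT1 (cid (dom_cover g x)).

(* Pointwise Riemannian inner product; by [gram_transition] any chart around x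
   gives the same value. *)
Definition vdot (X Y : field) : M -> R := fun x =>
  let c := chart_at x in (X c x *m gram c x *m (Y c x)^T) 0 0.

Definition dens c : M -> R := fun x => Num.sqrt (\det (gram c x)).

(* w = div X: the coordinate expression (1/sqrt G) d_i (sqrt G X^i), in every
   chart. *)
Definition is_div (X : field) w := forall c x, dom c x ->
  w x = (dens c x)^-1 * \sum_i partial c i (fun z => dens c z * X c z 0 i) x.

Definition is_laplacian f w := is_div (grad f) w.

Definition is_lebesgue (leb : {measure set (borel 'rV[R]_d) -> \bar R}) :=
  forall a b : 'rV[R]_d, (forall i, a 0 i <= b 0 i) ->
  leb [set y : 'rV[R]_d | forall i, a 0 i < y 0 i <= b 0 i] =
  (\prod_i (b 0 i - a 0 i))%:E.

Definition is_volume (vol : {measure set (borel M) -> \bar R}) :=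
  exists2 leb : {measure set (borel 'rV[R]_d) -> \bar R}, is_lebesgue leb &
  forall c (F : borel M -> \bar R), measurable_fun setT F ->
  (forall x, 0 <= F x)%E ->
  (\int[vol]_(x in (dom c : set (borel M))) F x =
   \int[leb]_(y in (patch c : set (borel 'rV[R]_d)))
     (F (point_of c y) * (dens c (point_of c y))%:E))%E.

End Manifold.
Arguments grad {R d M} g f.
Arguments smooth {R d M} g f.
Arguments is_laplacian {R d M} g f w.

Section L2.
Variables (R : realType) (M : ptopologicalType).
Variable pi : probability (borel M) R.
Implicit Types (f h u v : M -> R).

Definition L2 u := (u : borel M -> R) \in Lfun pi 2%:E.

Definition dotL2 u v : R := (\int[pi]_x (u x * v x))%R.

Definition cvgL2 (f : nat -> M -> R) u :=
  [/\ forall n, L2 (f n), L2 u &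
      (fun n => dotL2 (f n \- u) (f n \- u)) @ \oo --> (0 : R)].

(* D(n,m) -> 0 as n, m -> oo *)
Definition vanishing (D : nat -> nat -> R) := forall e : R, 0 < e ->
  exists N, forall n m, (N <= n)%N -> (N <= m)%N -> `|D n m| <= e.

(* Operators of L^2 are given by their graphs: [S f w] reads "f is in the
   domain of S and S f = w". *)
Definition operator := (M -> R) -> (M -> R) -> Prop.
Implicit Type S : operator.

(* f_n -> u for the closure of the form q(f, h) = - <S f, h>, where w_n = S f_n *)
Definition form_cvg S (f w : nat -> M -> R) u :=
  [/\ forall n, S (f n) (w n), cvgL2 f u &
      vanishing (fun n m => dotL2 (w n \- w m) (f n \- f m))].

(* Friedrichs extension of a symmetric nonpositive operator S: with q~ the
   closure of q, u is in the domain and is mapped to v iff u is in the form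
   domain and q~(u, y) = - <v, y> for all y in the form domain. *)
Definition friedrichs S : operator := fun u v =>
  [/\ L2 u, L2 v, exists f w : nat -> M -> R, form_cvg S f w u &
      forall (f w h z : nat -> M -> R) y, form_cvg S f w u -> form_cvg S h z y ->
        (fun n => dotL2 (w n) (h n)) @ \oo --> dotL2 v y].

Definition partial_sum (phi : nat -> M -> R) (a : nat -> R) (n : nat) : M -> R :=
  fun x => \sum_(0 <= k < n) a k * phi k x.

Definition discrete_spectrum (A : operator) (lambda : nat -> R)
    (phi : nat -> M -> R) :=
  [/\ [/\ lambda 0%N = 0, 0 < lambda 1%N,
          forall n, lambda n <= lambda n.+1 &
          lambda @ \oo --> +oo],
      forall k, A (phi k) (fun x => - lambda k * phi k x),
      forall j k, dotL2 (phi j) (phi k) = (j == k)%:R,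
      forall u, L2 u ->
        cvgL2 (partial_sum phi (fun k => dotL2 u (phi k))) u &
      exists a : R, {ae pi, forall x, phi 0%N x = a}].

Definition sobolev (lambda : nat -> R) (phi : nat -> M -> R) (m : nat) u :=
  exists2 a : nat -> R, cvgL2 (partial_sum phi a) u &
    (\sum_(k <oo) (a k ^+ 2 * lambda k ^+ m)%:E < +oo)%E.

End L2.

Section Diffusion.
Variables (R : realType) (d : nat) (M : ptopologicalType).
Variables (g : riemannian R d M) (U : M -> R) (pi : probability (borel M) R).
Variables (lambda : nat -> R) (phi : nat -> M -> R).
Variables (b : field g) (B : (M -> R) -> M -> R).
Implicit Types (f h u v w : M -> R) (l : R).

(* f |-> Laplacian f - grad U . grad f on smooth functions *)
Definition pre_generator : operator R M := fun f w =>
  smooth g f /\ exists2 Lf, is_laplacian g f Lf &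
    w = Lf \- vdot (grad g U) (grad g f).

Definition generator : operator R M := friedrichs pi pre_generator.

Definition H1 := sobolev pi lambda phi 1.

Definition energy f h : R := (\int[pi]_x vdot (grad g f) (grad g h) x)%R.

(* smooth f_n -> u in H^1 *)
Definition cvgH1 (f : nat -> M -> R) u :=
  [/\ forall n, smooth g (f n), cvgL2 pi f u &
      vanishing (fun n m => energy (f n \- f m) (f n \- f m))].

(* The integral of grad u . grad v against pi, where the gradient of an element
   of H^1 is the limit of gradients of smooth functions. *)
Definition dotH1 u v : R :=
  xget 0 [set r | exists f h : nat -> M -> R, [/\ cvgH1 f u, cvgH1 h v &
                               (fun n => energy (f n) (h n)) @ \oo --> r]].

Definition dot1 l u v : R := dotH1 u v + l * dotL2 pi u v.

(* domain of the L^2-closure of f |-> b . grad f *)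
Definition dom_transport u := exists (f : nat -> M -> R) w,
  [/\ forall n, smooth g (f n), cvgL2 pi f u &
      cvgL2 pi (fun n => vdot b (grad g (f n))) w].

(* B : H^1 -> L^2 is the continuous extension of f |-> b . grad f *)
Definition extends_transport := forall u, H1 u -> L2 pi (B u) /\
  forall f : nat -> M -> R, cvgH1 f u -> cvgL2 pi (fun n => vdot b (grad g (f n))) (B u).

Definition kerB : set (M -> R) :=
  [set u | H1 u /\ {ae pi, forall x, B u x = 0}].

(* p = P_{1,l} w *)
Definition is_proj l w p :=
  kerB p /\ forall v, kerB v -> dot1 l (w \- p) v = 0.

(* w = (A - l)^-1 v *)
Definition is_resolvent l v w := generator w (v \+ l \*o w).

(* R*_l v = - P_{1,l} (A - l)^-1 v, unique up to pi-null sets.  For l > 0 and v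
   in L^2 the resolvent and the projection exist, so that the default value of
   [xget] is irrelevant. *)
Definition Rstar l v : M -> R :=
  xget (fun=> 0) [set u | exists w p,
    [/\ is_resolvent l v w, is_proj l w p & u = \- p]].

End Diffusion.

(* Main.v *)
Require Import Defs.
From mathcomp Require Import all_boot all_order all_algebra.
From mathcomp Require Import all_classical all_reals all_analysis.
From mathcomp Require Import measurable_realfun ring lra.
Set Implicit Arguments.
Unset Strict Implicit.
Unset Printing Implicit Defensive.
Import Order.TTheory GRing.Theory Num.Theory.
Import numFieldNormedType.Exports.
Local Open Scope classical_set_scope.
Local Open Scope ring_scope.

(* Let w = (A - l)^-1 f and let p be the projection of w onto Ker B, so that R*_l f = - p.
   Testing the resolvent equation against Ker B gives
     <p, v>_{H^1} + l <p, v> = - <f, v>   for all v in Ker B.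
   The test function v = p yields the contraction property.  If eta is smooth and
   nondecreasing, with eta' bounded and Lipschitz, then eta o p is in H^1 again,
   B (eta o p) = eta'(p) B p = 0 and <p, eta o p>_{H^1} >= 0, whence <l p + f, eta o p> <= 0.
   With eta = sigmoid (m s) and eta = sigmoid (m (s + 1 / l)) - 1, m -> oo, this forces p <= 0 and
   l p >= - 1 almost everywhere when 0 <= f <= 1.

   The space H^1, given by Fourier coefficients, is identified with the domain of the closure of
   the energy form on the domain of the Friedrichs extension.  That the form is closable, and
   that it is the form of the operator, is Green's formula, obtained by integrating by
   parts in the charts with a C^1 partition of unity. *)

(** * Functions of class C^k on an open subset of R^d *)

(** The operator's domain shapes the proof. A Laplacian is one function that satisfies the
    divergence formula in all charts at once, so a smooth function is not known a priori to lie in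
    the domain of [pre_generator], and the form domain is reached by functions that do. Composition
    with [eta] must preserve that domain. It does when [eta] is smooth, because the Laplacian of
    [eta o f] is explicit; hence a smooth approximation takes the place of the usual truncation at 0
    and 1. The logistic function suits since its derivative is a polynomial in itself and its tail
    makes the limit m -> oo an explicit estimate.

    In the energy norm, the convergence of [eta o f_n] meets products of [eta' (f_n)] with gradients
    that converge only in L^2. No subsequence is extracted: the gradient of [f_n] is compared with
    that of one fixed smooth function, bounded by compactness, and the Lipschitz bound on [eta']
    does the rest.

    The constants of the second test function are part of [eta], so a single statement about
    [eta o p] gives both bounds. *)

Section Local.
Variables (R : realType) (U V : normedModType R).
Implicit Types (F G : U -> V).

(** Locality of differentiability reduces to this case: functions equal near [x] differ by one that
    vanishes there. The zero map is then the differential, with a remainder that is eventually 0. *)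
Lemma near0_differentiable F x : (\forall y \near x, F y = 0) -> differentiable F x.
Proof.
move=> F0; have Fx : F x = 0 by apply: nbhs_singleton F0.
have c0 : continuous (\0 : U -> V) by move=> y; exact: cvg_cst.
have e : F \o shift x = cst (F x) + \0 +o_ (0 : U) id.
  apply/eqaddoP => eps e0.
  have : (h + x) @[h --> (0 : U)] --> x.
    by rewrite -[X in _ --> X]add0r; apply: cvgD; [exact: cvg_id|exact: cvg_cst].
  move=> /(_ _ F0) h0; near=> h.
  rewrite /= !fctE /= Fx addr0 subr0 (_ : F (h + x) = 0) ?normr0 ?mulr_ge0 ?(ltW e0)//.
  by near: h.
apply/diff_locallyP; rewrite (diff_unique c0 e); split => //.
Unshelve. all: by end_near. Qed.

Lemma near_differentiable F G x :
  (\forall y \near x, F y = G y) -> differentiable F x -> differentiable G x.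
Proof.
move=> FG dF; rewrite (_ : G = F + (G - F)); last by apply/funext => y; rewrite !fctE addrC subrK.
apply: differentiableD => //; apply: near0_differentiable.
by apply: filterS FG => y FGy; rewrite !fctE FGy subrr.
Qed.

End Local.

(** Openness of [O] makes the derivatives at its points depend on the values in [O] alone. This
    transfers regularity from an explicit formula to the function that it represents on [O]. *)
Lemma class_on_ext (R : realType) (d : nat) (V : normedModType R) k
    (O : set 'rV[R]_d) (F G : 'rV[R]_d -> V) :
  open O -> (forall x, O x -> F x = G x) -> class_on k O F -> class_on k O G.
Proof.
move=> oO; have nr H K x : O x -> (forall x, O x -> H x = K x :> V) -> \forall y \near x, H y = K y.
  by move=> Ox HK; apply: filterS (open_nbhs_nbhs (conj oO Ox)) => y /HK.
elim: k F G => [|k IH] F G FG /=.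
  move=> cF x Ox; have Fx := cF x Ox.
  rewrite /prop_for /continuous_at -(FG x Ox).
  exact: cvg_trans (near_eq_cvg (nr _ _ _ Ox FG)) Fx.
move=> [dF cF]; split; first by move=> x Ox; exact: near_differentiable (nr _ _ _ Ox FG) (dF x Ox).
by move=> v; apply: IH (cF v) => x Ox; apply/near_eq_derive/nr.
Qed.

Lemma class_on_cts (R : realType) (d : nat) (V : normedModType R) k
    (O : set 'rV[R]_d) (F : 'rV[R]_d -> V) x :
  class_on k O F -> O x -> {for x, continuous F}.
Proof. by case: k => [|k] /=; [exact|move=> [dF _] Ox; apply/differentiable_continuous/dF]. Qed.

Lemma class_onS (R : realType) (d : nat) (V : normedModType R) k
    (O : set 'rV[R]_d) (F : 'rV[R]_d -> V) :
  class_on k.+1 O F -> class_on k O F.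
Proof.
elim: k F => [|k IH] F; first by move=> [dF _] x Ox; apply/differentiable_continuous/dF.
by move=> [dF cF]; split=> // v; apply/IH/cF.
Qed.

Lemma class_on_cst (R : realType) (d : nat) (V : normedModType R) k
    (O : set 'rV[R]_d) (a : V) : class_on k O (fun=> a).
Proof.
elim: k a => [|k IH] a /=; first by move=> x _; exact: cst_continuous.
split=> [x _|v]; first exact: differentiable_cst.
by rewrite (_ : 'D_v _ = fun=> 0)//; apply/funext => x; rewrite derive_cst.
Qed.

Lemma derive_comp1 (R : realType) (V : normedModType R) (phi : R -> R) (F : V -> R) x v :
  differentiable F x -> differentiable phi (F x) ->
  'D_v (phi \o F) x = phi^`()%classic (F x) * 'D_v F x.
Proof.
move=> dF dphi; rewrite [LHS]deriveE; last exact: differentiable_comp.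
rewrite diff_comp//= derive1E'// deriveE// -[in LHS](mulr1 ('d F x v)).
by rewrite -[in LHS]/('d F x v *: (1 : R)) linearZ/= mulrC.
Qed.

Section ClassOnAlg.
Variables (R : realType) (d : nat) (O : set 'rV[R]_d).
Hypothesis oO : open O.
Implicit Types (F G : 'rV[R]_d -> R) (v : 'rV[R]_d).

Lemma class_onD k F G : class_on k O F -> class_on k O G ->
  class_on k O (fun x => F x + G x).
Proof.
elim: k F G => [|k IH] F G /=; first by move=> cF cG x Ox; apply: continuousD; [exact: cF|exact: cG].
move=> [dF cF] [dG cG]; split=> [x Ox|v]; first by apply: differentiableD; [exact: dF|exact: dG].
apply: class_on_ext (IH _ _ (cF v) (cG v)) => // x Ox.
by rewrite deriveD//; apply: diff_derivable; [exact: dF|exact: dG].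
Qed.

Lemma class_onM k F G : class_on k O F -> class_on k O G ->
  class_on k O (fun x => F x * G x).
Proof.
elim: k F G => [|k IH] F G; first by move=> cF cG x Ox; apply: continuousM; [exact: cF|exact: cG].
move=> F1 G1; have [dF cF] := F1; have [dG cG] := G1.
split=> [x Ox|v]; first by apply: differentiableM; [exact: dF|exact: dG].
apply: class_on_ext (class_onD (IH _ _ (class_onS F1) (cG v)) (IH _ _ (class_onS G1) (cF v))) => // x Ox.
by rewrite (deriveM (f := F) (g := G))//; apply: diff_derivable; [exact: dF|exact: dG].
Qed.

Lemma class_onZ k a F : class_on k O F -> class_on k O (fun x => a * F x).
Proof. by apply: class_onM; exact: class_on_cst. Qed.

Lemma class_onN k F : class_on k O F -> class_on k O (fun x => - F x).
Proof.
move=> /(class_onZ (-1)); apply: class_on_ext => // x _; exact: mulN1r.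
Qed.

Lemma class_onB k F G : class_on k O F -> class_on k O G ->
  class_on k O (fun x => F x - G x).
Proof. by move=> cF /class_onN; exact: class_onD. Qed.

Lemma class_on_sum k (I : Type) (r : seq I) (P : pred I) (F : I -> 'rV[R]_d -> R) :
  (forall i, P i -> class_on k O (F i)) -> class_on k O (fun x => \sum_(i <- r | P i) F i x).
Proof.
move=> cF; elim: r => [|i r IH].
  by apply: class_on_ext (class_on_cst k O (0:R)) => // x _; rewrite big_nil.
have [Pi|Pi] := boolP (P i).
  by apply: class_on_ext (class_onD (cF i Pi) IH) => // x _; rewrite big_cons Pi.
by apply: class_on_ext IH => // x _; rewrite big_cons (negPf Pi).
Qed.

Lemma class_on_prod k (I : Type) (r : seq I) (P : pred I) (F : I -> 'rV[R]_d -> R) :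
  (forall i, P i -> class_on k O (F i)) -> class_on k O (fun x => \prod_(i <- r | P i) F i x).
Proof.
move=> cF; elim: r => [|i r IH].
  by apply: class_on_ext (class_on_cst k O (1:R)) => // x _; rewrite big_nil.
have [Pi|Pi] := boolP (P i).
  by apply: class_on_ext (class_onM (cF i Pi) IH) => // x _; rewrite big_cons Pi.
by apply: class_on_ext IH => // x _; rewrite big_cons (negPf Pi).
Qed.

(** Class 1 is enough for its uses: the weight, the inverse metric and the bump functions enter
    Green's formula under one derivative only. *)
Lemma class_on_comp1 (phi : R -> R) F :
  (forall x, O x -> differentiable phi (F x)) ->
  (forall x, O x -> {for F x, continuous phi^`()%classic}) ->
  class_on 1 O F -> class_on 1 O (phi \o F).
Proof.
move=> dphi cphi [dF cF]; split=> [x Ox|v].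
  by apply: differentiable_comp; [exact: dF|exact: dphi].
have c0 : class_on 0 O (fun x => phi^`()%classic (F x)).
  move=> x Ox; apply: (@continuous_comp _ _ _ F (phi^`()%classic)).
    exact/differentiable_continuous/dF.
  exact: cphi.
apply: (class_on_ext _ _ (class_onM (k:=0) c0 (cF v))) => // x Ox.
by rewrite derive_comp1//; [exact: dF|exact: dphi].
Qed.

Lemma class_on_inv F : (forall x, O x -> F x != 0) -> class_on 1 O F ->
  class_on 1 O (fun x => (F x)^-1).
Proof.
move=> F0; apply: (@class_on_comp1 GRing.inv) => x Ox; first exact/differentiable_Rinv/F0.
have n0 : \forall y \near F x, - y ^- 2 = (GRing.inv : R -> R)^`()%classic y.
  have : \forall y \near F x, y != 0.
    apply: open_nbhs_nbhs; split; last exact: F0.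
    by apply: open_neq.
  apply: filterS => y y0; rewrite derive1E'; last exact: differentiable_Rinv.
  by rewrite diff_Rinv//= [RHS]mulr1.
rewrite /prop_for /continuous_at -(nbhs_singleton n0).
apply: cvg_trans (near_eq_cvg n0) _; apply: cvgN; apply: cvgV.
  by rewrite sqrf_eq0 F0.
by apply: cvgM; exact: cvg_id.
Qed.

Lemma class_on_coord k m n (F : 'rV[R]_d -> 'M[R]_(m, n)) i j :
  class_on k O F -> class_on k O (fun x => F x i j).
Proof.
elim: k F => [|k IH] F /=.
  move=> cF x Ox; apply: (@continuous_comp _ _ _ F (fun N : 'M[R]_(m,n) => N i j)).
    exact: cF.
  exact: coord_continuous.
move=> [dF cF]; split=> [x Ox|v].
  apply: (@differentiable_comp _ _ _ _ F (fun N : 'M[R]_(m,n) => N i j)); first exact: dF.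
  exact: differentiable_coord.
apply: class_on_ext (IH _ (cF v)) => // x Ox.
by rewrite derive_mx ?mxE//; apply/diff_derivable/dF.
Qed.

End ClassOnAlg.

Lemma diff_row (R : realType) (d : nat) (V : normedModType R) (F : 'rV[R]_d -> V) x v :
  differentiable F x -> 'D_v F x = \sum_i v 0 i *: 'D_(delta_mx 0 i) F x.
Proof.
move=> dF; rewrite deriveE// {1}(row_sum_delta v) linear_sum/=.
by apply: eq_bigr => i _; rewrite linearZ/= deriveE.
Qed.

Lemma derive_comp_row (R : realType) (d : nat) (V : normedModType R)
    (tau : 'rV[R]_d -> 'rV[R]_d) (F : 'rV[R]_d -> V) x v :
  differentiable tau x -> differentiable F (tau x) ->
  'D_v (F \o tau) x = \sum_j (v *m 'J tau x) 0 j *: 'D_(delta_mx 0 j) F (tau x).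
Proof.
move=> dtau dF; rewrite deriveE; last exact: differentiable_comp.
by rewrite diff_comp//= -[X in _ = X]diff_row// deriveE// -deriveEjacobian// deriveE.
Qed.

Lemma class_on_precomp (R : realType) (d : nat) (O O' : set 'rV[R]_d)
    (tau : 'rV[R]_d -> 'rV[R]_d) (F : 'rV[R]_d -> R) :
  open O -> (forall x, O x -> O' (tau x)) -> class_on 1 O tau -> class_on 1 O' F ->
  class_on 1 O (F \o tau).
Proof.
move=> oO OO' tau1 [dF cF]; have [dtau ctau] := tau1.
split=> [x Ox|v]; first by apply: differentiable_comp; [exact: dtau|apply/dF/OO'].
have /(class_on_ext oO) : forall x, O x ->
   \sum_j ('D_v tau x) 0 j * 'D_(delta_mx 0 j) F (tau x) = 'D_v (F \o tau) x.
  move=> x Ox; rewrite (derive_comp_row _ (dtau x Ox) (dF _ (OO' _ Ox))).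
  by rewrite deriveEjacobian//; exact: dtau.
apply; apply: class_on_sum => // j _; apply: class_onM => //.
  by apply: class_on_coord => //; exact: ctau.
move=> x Ox; apply: (@continuous_comp _ _ _ tau ('D_(delta_mx 0 j) F)).
  exact/differentiable_continuous/dtau.
exact/cF/OO'.
Qed.

(** * The logistic function *)

Section Sigmoid.
Variable R : realType.
Implicit Types (s t : R).

(** The derivative is [s (1 - s)] in terms of the value [s]: it is bounded, and an induction on the
    class shows that composition preserves smoothness. *)
Definition sigmoid t : R := (1 + expR (- t))^-1.

Lemma sigmoid_gt0 t : 0 < sigmoid t.
Proof. by rewrite invr_gt0 addr_gt0// expR_gt0. Qed.

Lemma sigmoid_lt1 t : sigmoid t < 1.
Proof. by rewrite invf_lt1 ?addr_gt0 ?expR_gt0// ltrDl expR_gt0. Qed.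

Lemma sigmoidN t : sigmoid (- t) = 1 - sigmoid t.
Proof.
rewrite /sigmoid opprK expRN; have := expR_gt0 t; move: (expR t) => e e0.
by field; rewrite !gt_eqF//; lra.
Qed.

Lemma is_derive_sigmoid t : is_derive t 1 sigmoid (sigmoid t * (1 - sigmoid t)).
Proof.
have e0 : 1 + expR (- t) != 0 by rewrite gt_eqF// addr_gt0// expR_gt0.
have d1 : is_derive t 1 (fun s => 1 + expR (- s)) (- expR (- t)).
  by apply: is_derive_eq; rewrite add0r mul1r mulrN1.
have [dV EV] := is_deriveV (f := fun s => 1 + expR (- s)) e0.
apply: DeriveDef; first exact: dV.
rewrite [LHS]EV /sigmoid.
rewrite /GRing.scale/=; move: (expR (- t)) e0 => e e0; field; exact: e0.
Qed.

Lemma sigmoid_lip s t : `|sigmoid s - sigmoid t| <= `|s - t|.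
Proof.
wlog st : s t / s <= t => [H|].
  by have [/H//|/ltW/H] := leP s t; rewrite distrC => /le_trans; apply; rewrite distrC.
have cs : {within `[s, t], continuous (sigmoid : R -> R)}.
  by apply: derivable_within_continuous => x _; have [] := is_derive_sigmoid x.
have [c _] := MVT_segment st (fun x _ => is_derive_sigmoid x) cs.
rewrite distrC => ->.
rewrite normrM (distrC s) ler_piMl//.
have := sigmoid_gt0 c; have := sigmoid_lt1 c => c1 c0.
rewrite ger0_norm; first nra; apply: mulr_ge0; lra.
Qed.

Lemma sigmoid_ge t : 0 <= t -> 2^-1 <= sigmoid t.
Proof.
move=> t0; rewrite lef_pV2 ?posrE ?addr_gt0 ?expR_gt0//.
rewrite -[leRHS]/(1 + 1) lerD2l -[leRHS]expR0 ler_expR; lra.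
Qed.

(** After division by the sigmoid this is [- t <= 1 + exp (- t)]. It controls a test function where
    its argument has the wrong sign. *)
Lemma sigmoid_tail t : t <= 0 -> - t * sigmoid t <= 1.
Proof.
move=> t0; rewrite -ler_pdivlMr ?sigmoid_gt0// div1r invrK.
by have := expR_ge1Dx (- t); lra.
Qed.

End Sigmoid.

Lemma class_on_sigmoid (R : realType) (d k : nat) (O : set 'rV[R]_d) (F : 'rV[R]_d -> R) :
  open O -> class_on k O F -> class_on k O (@sigmoid R \o F).
Proof.
move=> oO; elim: k F => [|k IH] F.
  move=> cF x Ox; apply: continuous_comp; first exact: cF.
  by apply/differentiable_continuous/derivable1_diffP; have [] := is_derive_sigmoid (F x).
move=> F1; have [dF cF] := F1.
have dsg t : differentiable (@sigmoid R) t by apply/derivable1_diffP; have [] := is_derive_sigmoid t.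
split=> [x Ox|v]; first by apply: differentiable_comp => //; exact: dF.
have F0 := class_onS F1.
have c1 : class_on k O (fun x => 1 - (@sigmoid R \o F) x).
  by apply: class_onB => //; [exact: class_on_cst|exact: IH].
apply: class_on_ext (class_onM oO (class_onM oO (IH _ F0) c1) (cF v)) => // x Ox.
rewrite derive_comp1//; last exact: dF.
by rewrite derive1E; have [_ ->] := is_derive_sigmoid (F x).
Qed.

Section Ramp.
Variable R : realType.

(* Composed with a quadratic polynomial, a C^1 bump function: Green's formula differentiates
   the partition of unity only once. *)
Definition sqr_ramp (t : R) : R := (Num.max 0 t) ^+ 2.

Lemma is_derive_sqr_ramp (t : R) : is_derive t 1 sqr_ramp (2 * Num.max 0 t).
Proof.
case: (ltgtP t 0) => [t0|t0|->].
- rewrite mulr0; apply: near_eq_is_derive (is_derive_cst (0 : R) t (1 : R)).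
  have : \forall s \near t, s < 0 by exact: lt_nbhsl.
  by apply: filterS => s /ltW s0; rewrite /sqr_ramp max_l// expr0n.
- have H : is_derive t 1 (fun s : R => s ^+ 2) (2 * t).
    apply: DeriveDef; first exact: exprn_derivable.
    by rewrite exp_derive expr1 /GRing.scale/= mulr1.
  apply: near_eq_is_derive H.
  have : \forall s \near t, 0 < s by exact: lt_nbhsr.
  by apply: filterS => s /ltW s0; rewrite /sqr_ramp max_r.
- rewrite mulr0.
  (* For nonzero [h] the difference quotient at 0 is [Num.max 0 h] itself. *)
  have cv : (fun h : R => h^-1 *: ((sqr_ramp \o shift 0) (h *: (1 : R)) - sqr_ramp 0)) @ 0^' --> (0 : R).
    have cm : (fun h : R => Num.max 0 h) @ 0^' --> (0 : R).
      rewrite -[X in _ --> X](maxxx 0); apply: cvg_within_filter.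
      by apply: continuous_max; [exact: cst_continuous|exact: cvg_id].
    apply: cvg_trans cm; apply: near_eq_cvg; near=> h.
    have h0 : h != 0 by near: h; exact: nbhs_dnbhs_neq.
    rewrite /sqr_ramp /= addr0 maxxx expr0n subr0 /GRing.scale/= mulr1.
    have [hp|hn] := leP 0 h; last by rewrite expr0n mulr0.
    by rewrite expr2 mulrA mulVf// mul1r.
  by apply: DeriveDef; [apply/cvg_ex; exists 0|apply: cvg_lim].
Unshelve. all: by end_near. Qed.

Lemma continuous_sqr_ramp' (t : R) : {for t, continuous (sqr_ramp^`()%classic)}.
Proof.
have -> : sqr_ramp^`()%classic = fun s => 2 * Num.max 0 s.
  by apply/funext => s; rewrite derive1E; have [_ ->] := is_derive_sqr_ramp s.
apply: continuousM; first exact: cst_continuous.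
by apply: continuous_max; [exact: cst_continuous|exact: cvg_id].
Qed.

End Ramp.

Lemma class_on_sqrt (R : realType) (d : nat) (O : set 'rV[R]_d) (F : 'rV[R]_d -> R) :
  open O -> (forall x, O x -> 0 < F x) -> class_on 1 O F ->
  class_on 1 O (fun x => Num.sqrt (F x)).
Proof.
move=> oO F0; apply: (class_on_comp1 oO (phi := Num.sqrt)) => x Ox.
  by apply/derivable1_diffP; have [] := is_derive1_sqrt (F0 x Ox).
have n0 : \forall y \near F x, (2 * Num.sqrt y)^-1 = (Num.sqrt : R -> R)^`()%classic y.
  have : \forall y \near F x, 0 < y by apply: lt_nbhsr; exact: F0.
  by apply: filterS => y y0; rewrite derive1E; have [_ ->] := is_derive1_sqrt y0.
rewrite /prop_for /continuous_at -(nbhs_singleton n0).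
apply: cvg_trans (near_eq_cvg n0) _; apply: cvgV.
  by rewrite mulf_neq0// sqrtr_eq0 -ltNge F0.
by apply: cvgM; [exact: cvg_cst|exact: sqrt_continuous].
Qed.

(** * Determinants and inverses of matrix-valued functions *)

Section ClassOnMx.
Variables (R : realType) (d : nat) (O : set 'rV[R]_d).
Hypothesis oO : open O.

Lemma class_on_det k n (F : 'rV[R]_d -> 'M[R]_n) :
  (forall i j, class_on k O (fun x => F x i j)) -> class_on k O (fun x => \det (F x)).
Proof.
move=> cF; apply: class_on_sum => // s _; apply: (class_onZ oO).
by apply: class_on_prod => // i _.
Qed.

(** Cramer's rule: the entries are cofactors divided by the determinant. *)
Lemma class_on_invmx n (F : 'rV[R]_d -> 'M[R]_n) :
  (forall x, O x -> F x \in unitmx) ->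
  (forall i j, class_on 1 O (fun x => F x i j)) ->
  forall i j, class_on 1 O (fun x => invmx (F x) i j).
Proof.
move=> uF cF i j.
have cd : class_on 1 O (fun x => (\det (F x))^-1).
  apply: class_on_inv => //; last exact: class_on_det.
  by move=> x /uF; rewrite unitmxE unitfE.
have ca : class_on 1 O (fun x => \adj (F x) i j).
  have cc : class_on 1 O (fun x => (-1) ^+ (j + i) * \det (row' j (col' i (F x)))).
    apply: (class_onZ oO).
    apply: class_on_det => k l; apply: class_on_ext (cF (lift j k) (lift i l)) => // x _.
    by rewrite !mxE.
  by apply: class_on_ext cc => // x _; rewrite mxE.
apply: class_on_ext (class_onM oO cd ca) => // x Ox.
by rewrite /invmx uF// [RHS]mxE.
Qed.

End ClassOnMx.

(** * Lebesgue measure and integration by parts *)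

Section Borel.

Lemma borel_open (T : ptopologicalType) (O : set T) :
  open O -> measurable (O : set (borel T)).
Proof. by move=> oO; exact: sub_sigma_algebra. Qed.

Lemma borel_continuous (T T' : ptopologicalType) (phi : T -> T') :
  continuous phi -> measurable_fun [set: borel T] (phi : borel T -> borel T').
Proof.
move=> cphi; apply: (@measurability _ _ (borel T) (borel T') setT phi (@open T') erefl).
move=> _ [W oW <-]; rewrite setTI; apply: borel_open.
by move/continuousP : cphi; apply.
Qed.

Lemma borel_continuousR (R : realType) (T : ptopologicalType) (f : T -> R) :
  continuous f -> measurable_fun [set: borel T] (f : borel T -> R).
Proof.
move=> cf; apply: (@measurability _ _ _ _ _ _ _ (RGenOpens.measurableE R)).
move=> _ [_ [a [b ->] <-]]; rewrite setTI; apply: borel_open.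
by move/continuousP : cf; apply; exact: interval_open.
Qed.

Lemma borel_continuousE (R : realType) (T : ptopologicalType) (f : T -> R) :
  continuous f -> measurable_fun [set: borel T] (EFin \o (f : borel T -> R)).
Proof. by move=> /borel_continuousR mf; exact/measurable_EFinP. Qed.

End Borel.

Section Translation.
Variables (R : realType) (d : nat).
Variable leb : {measure set (borel 'rV[R]_d) -> \bar R}.
Hypothesis hleb : is_lebesgue leb.
Implicit Types (a b v y : 'rV[R]_d).

Definition obox a b : set 'rV[R]_d := [set y | forall i, a 0 i < y 0 i <= b 0 i].

Lemma obox_measurable a b : measurable (obox a b : set (borel 'rV[R]_d)).
Proof.
have -> : obox a b = \bigcap_(i in [set: 'I_d]) [set y : 'rV[R]_d | a 0 i < y 0 i <= b 0 i].
  by apply/seteqP; split=> y yab i; [move=> _; exact: yab|exact: yab].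
apply: fin_bigcap_measurable => // i _.
have -> : [set y : 'rV[R]_d | a 0 i < y 0 i <= b 0 i] = (fun y : 'rV[R]_d => y 0 i) @^-1` `]a 0 i, b 0 i].
  by apply/seteqP; split=> y /=; rewrite in_itv.
rewrite -[X in measurable X]setTI.
have /borel_continuousR : continuous (fun y : 'rV[R]_d => y 0 i) by exact: coord_continuous.
by apply.
Qed.

Lemma coord_le_norm y i : `|y 0 i| <= `|y|.
Proof.
rewrite [leRHS]/Num.Def.normr/= mx_normrE.
exact: (le_bigmax _ (fun j : 'I_1 * 'I_d => `|y j.1 j.2|) (0, i)).
Qed.

(** An open set is the union of the half-open boxes with rational corners that it contains. The
    union runs over all pairs of rational corners, the unsuitable ones contributing the empty set,
    and is therefore countable. *)
Lemma borel_obox : @measurable _ (borel 'rV[R]_d) = <<s [set A | exists a b, A = obox a b] >>.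
Proof.
apply/seteqP; split; apply: smallest_sub; try exact: smallest_sigma_algebra; last first.
  by move=> _ [a [b ->]]; exact: obox_measurable.
move=> O oO.
pose G := [set A | exists a b : 'rV[R]_d, A = obox a b].
pose q (p : 'rV[rat]_d * 'rV[rat]_d) := obox (map_mx ratr p.1) (map_mx ratr p.2).
have -> : O = \bigcup_p (if pselect (q p `<=` O) then q p else set0).
  apply/seteqP; split => [y Oy|y [p _]]; last by case: pselect => //= qO /qO.
  have /nbhs_ballP[e e0 ye] : nbhs y O by exact: open_nbhs_nbhs.
  have lo i : exists r : rat, ratr r \in `]y 0 i - e, y 0 i[ by apply: rat_in_itvoo; rewrite ltrBlDr ltrDl.
  have hi i : exists r : rat, ratr r \in `]y 0 i, y 0 i + e[ by apply: rat_in_itvoo; rewrite ltrDl.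
  pose p := (\row_i xchoose (lo i), \row_i xchoose (hi i)).
  have plo i : y 0 i - e < map_mx ratr p.1 0 i < y 0 i.
    by have := xchooseP (lo i); rewrite in_itv/= !mxE.
  have phi i : y 0 i < map_mx ratr p.2 0 i < y 0 i + e.
    by have := xchooseP (hi i); rewrite in_itv/= !mxE.
  have pO : q p `<=` O.
    move=> z qz; apply: ye; split=> // i j; rewrite [i]ord1 /ball/= ltr_distl.
    have /andP[z1 z2] := qz j; have /andP[p1 p2] := plo j; have /andP[p3 p4] := phi j.
    apply/andP; split; lra.
  exists p => //; case: pselect => //= _ i.
  by have /andP[p1 p2] := plo i; have /andP[p3 p4] := phi i; rewrite p2 ltW.
apply: (@countable_bigcupT_measurable _ (g_sigma_algebraType G)).
  exact: countableP.
move=> p; case: pselect => h /=; last exact: measurable0.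
by apply: sub_sigma_algebra; exists (map_mx ratr p.1), (map_mx ratr p.2).
Qed.

(** [is_lebesgue] speaks of ordered corners only. Otherwise the box is empty and the product has a
    zero factor. *)
Lemma lebesgue_obox a b :
  leb (obox a b) = (\prod_i (if a 0 i <= b 0 i then b 0 i - a 0 i else 0))%:E.
Proof.
have [ab|/existsNP[i /negP]] := pselect (forall i, a 0 i <= b 0 i).
  by rewrite [LHS]hleb//; congr (_%:E); apply: eq_bigr => i _; rewrite ab.
rewrite -ltNge => ba.
rewrite (_ : obox a b = set0); last first.
  apply/seteqP; split => // y /(_ i) /andP[ay yb].
  by have := lt_le_trans ay yb; rewrite ltNge (ltW ba).
by rewrite measure0 (bigD1 i)//= leNgt ba mul0r.
Qed.

Lemma continuous_translation v : continuous (fun y => y + v).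
Proof. by move=> y; apply: (@continuousD _ _ _ id (cst v)); [exact: cvg_id|exact: cst_continuous]. Qed.

(** Two measures that agree on the boxes are equal: the boxes are stable under intersection,
    generate the Borel sets, and contain an exhausting sequence of cubes of finite measure. *)
Lemma lebesgue_translation v (A : set (borel 'rV[R]_d)) : measurable A ->
  pushforward leb (fun y : borel 'rV[R]_d => (y + v : borel 'rV[R]_d)) A = leb A.
Proof.
have mt := borel_continuous (continuous_translation (v := v)).
pose M := measure_function_pushforward__canonical__measure_function_Measure leb mt.
move=> mA; rewrite -[LHS]/(M A).
apply: (@measure_unique _ R (borel 'rV[R]_d) [set A | exists a b, A = obox a b] (fun n => obox (const_mx (- n%:R)) (const_mx n%:R)) borel_obox _ _ _ M leb _ _ A mA).
- move=> _ _ [a [b ->]] [a' [b' ->]].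
  exists (\row_i Num.max (a 0 i) (a' 0 i)), (\row_i Num.min (b 0 i) (b' 0 i)).
  apply/seteqP; split=> y.
    move=> [h1 h2] i; have /andP[? ?] := h1 i; have /andP[? ?] := h2 i.
    by rewrite !mxE gt_max le_min; apply/andP; split; apply/andP.
  move=> h; split=> i; have := h i; rewrite !mxE gt_max le_min => /andP[/andP[? ?] /andP[? ?]];
    by apply/andP.
- by move=> n; exists (const_mx (- n%:R)), (const_mx n%:R).
- apply/seteqP; split => // y _; exists (Num.bound `|y|) => // i.
  have yi := le_lt_trans (coord_le_norm y i) (archi_boundP (normr_ge0 y)).
  by rewrite !mxE; move: yi; rewrite ltr_norml => /andP[-> /ltW].
- move=> _ [a [b ->]]; rewrite /= /pushforward.
  have -> : (fun y => y + v) @^-1` obox a b = obox (a - v) (b - v).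
    by apply/seteqP; split=> y /= h i; have := h i; rewrite !mxE ltrBlDr lerBrDr.
  rewrite !lebesgue_obox; congr (_%:E); apply: eq_bigr => i _; rewrite !mxE lerD2r.
  by case: ifP => // _; ring.
- move=> n; rewrite /= /pushforward.
  have -> : (fun y => y + v) @^-1` obox (const_mx (- n%:R)) (const_mx n%:R) =
      obox (const_mx (- n%:R) - v) (const_mx n%:R - v).
    by apply/seteqP; split=> y /= h i; have := h i; rewrite !mxE ltrBlDr lerBrDr.
  by rewrite lebesgue_obox ltry.
Qed.

Lemma continuous_cpt_bounded r (G : 'rV[R]_d -> R) : continuous G ->
  (forall y, r <= `|y| -> G y = 0) -> exists2 C : R, 0 <= C & forall y, `|G y| <= C.
Proof.
move=> cG G0; pose K := [set y : 'rV[R]_d | `|y| <= r].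
have cK : compact K.
  apply: bounded_closed_compact.
    by exists r; split; [exact: num_real|move=> x rx y /= /le_trans; apply; exact: ltW].
  by apply: (@preimage_closed _ _ _ [set x : R | x <= r]); [move=> y _; exact: norm_continuous|exact: closed_le].
have /compact_bounded[M [_ MG]] : compact (G @` K).
  by apply: continuous_compact => //; exact: continuous_subspaceT.
exists (Num.max 0 (M + 1)); first by rewrite le_max lexx.
move=> y; have [yr|/ltW yr] := leP `|y| r; last by rewrite G0// normr0 le_max lexx.
by rewrite le_max; apply/orP; right; apply: (MG (M + 1)); [rewrite ltrDl|exists y].
Qed.

Lemma ball_integrable r (C : R) : 0 <= C ->
  leb.-integrable setT (EFin \o (fun y : borel 'rV[R]_d => C * \1_(obox (const_mx (- r)) (const_mx r)) y)).
Proof.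
move=> C0; apply: (@integrableZl _ _ _ leb setT measurableT C (fun y => (\1_(obox (const_mx (- r)) (const_mx r)) y)%:E)).
have mB := @obox_measurable (const_mx (- r)) (const_mx r).
apply/integrableP; split; first exact/measurable_EFinP/measurable_indic.
under eq_integral do rewrite gee0_abs ?lee_fin//.
by rewrite integral_indic// setIT lebesgue_obox ltry.
Qed.

Lemma cpt_integrable r (G : 'rV[R]_d -> R) : continuous G ->
  (forall y, r <= `|y| -> G y = 0) -> leb.-integrable setT (EFin \o (G : borel 'rV[R]_d -> R)).
Proof.
move=> cG G0; have [C C0 GC] := continuous_cpt_bounded cG G0.
apply: le_integrable (@ball_integrable r C C0) => //.
  exact: borel_continuousE.
move=> y _ /=; rewrite lee_fin; have [yr|yr] := ltP `|y| r; last by rewrite G0// normr0.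
rewrite indicE mem_set ?mulr1 ?(ger0_norm C0)// => i.
have := le_lt_trans (coord_le_norm y i) yr; by rewrite ltr_norml !mxE => /andP[-> /ltW ->].
Qed.

Lemma integral_translation r v (F : 'rV[R]_d -> R) : continuous F ->
  (forall y, r <= `|y| -> F y = 0) ->
  (\int[leb]_y (F (y + v)%R)%:E = \int[leb]_y (F y)%:E)%E.
Proof.
move=> cF F0; have mt := borel_continuous (continuous_translation (v := v)).
pose tau (y : borel 'rV[R]_d) : borel 'rV[R]_d := (y + v).
have iFv : leb.-integrable (tau @^-1` setT) ((EFin \o (F : borel 'rV[R]_d -> R)) \o tau).
  rewrite preimage_setT; apply: (@cpt_integrable (r + `|v|) (fun y => F (y + v))).
    by move=> y; apply: continuous_comp; [exact: continuous_translation|exact: cF].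
  move=> y ry; apply: F0; have := lerB_normD y v; move: ry; lra.
have mF : measurable_fun [set: borel 'rV[R]_d] (EFin \o (F : borel 'rV[R]_d -> R)).
  exact: borel_continuousE.
have := integral_pushforward mt mF iFv measurableT; rewrite preimage_setT => <-.
by apply: eq_measure_integral => W mW _; exact: lebesgue_translation.
Qed.

(** Integration by parts from translation invariance, without iterated integrals. The difference
    quotients along [e / (n + 1)] have integral 0 and converge to [dF]; by the mean value theorem
    they are bounded by a constant, and all vanish outside one box, so dominated convergence
    applies. *)
Lemma integral_derive0 r e (F dF : 'rV[R]_d -> R) :
  (forall y, is_derive y e F (dF y)) -> continuous F -> continuous dF ->
  (forall y, r <= `|y| -> F y = 0) -> (\int[leb]_y (dF y)%:E = 0)%E.
Proof.
move=> Fe cF cdF F0.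
have dF0 y : r < `|y| -> dF y = 0.
  move=> ry; have [_ <-] := Fe y; rewrite -(derive_cst (0 : R) y e); apply: near_eq_derive.
  have : \forall z \near y, r < `|z|.
    have H : \forall x \near `|y|, r < x by exact: lt_nbhsr.
    exact: (@norm_continuous _ _ y _ H).
  by apply: filterS => z /ltW /F0.
(* Locality of the derivative gives [dF y = 0] only under the strict inequality, hence the radius
   [r + 1]. *)
have [C C0 dFC] : exists2 C : R, 0 <= C & forall y, `|dF y| <= C.
  by apply: (@continuous_cpt_bounded (r + 1)) => // y ry; apply: dF0; lra.
have mvt y (s : R) : 0 <= s -> `|F (y + s *: e) - F y| <= C * s.
  move=> s0; have ds (x : R) : is_derive x (1 : R) (fun u : R => F (y + u *: e)) (dF (y + x *: e)).
    have [dv <-] := Fe (y + x *: e).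
    have E : (fun h : R => h^-1 *: ((F \o shift (y + x *: e)) (h *: e) - F (y + x *: e))) =
             (fun h : R => h^-1 *: (((fun u : R => F (y + u *: e)) \o shift x) (h *: (1 : R)) - F (y + x *: e))).
      apply/funext => h /=; congr (_ *: (F _ - _)).
      by rewrite -[h%:A]/(h * 1) mulr1 scalerDl addrCA.
    apply: DeriveDef; first by rewrite /derivable -E.
    by rewrite /derive -E.
  have cs : {within `[0, s], continuous (fun u : R => F (y + u *: e))}.
    by apply: derivable_within_continuous => x _; have [] := ds x.
  have [c _] := MVT_segment s0 (fun x _ => ds x) cs.
  rewrite scale0r addr0 subr0 => ->; rewrite normrM (ger0_norm s0).
  by rewrite ler_wpM2r.
pose q n y := n.+1%:R * (F (y + n.+1%:R^-1 *: e) - F y).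
have cq n : continuous (q n).
  move=> y; apply: (@continuousM _ _ (fun=> n.+1%:R) (fun y => F (y + n.+1%:R^-1 *: e) - F y)).
    exact: cst_continuous.
  apply: (@continuousB _ _ _ (fun y => F (y + n.+1%:R^-1 *: e)) F); last exact: cF.
  exact: (@continuous_comp _ _ _ (fun y => y + n.+1%:R^-1 *: e) F _ (@continuous_translation _ _) (cF _)).
have le1 n : `|n.+1%:R^-1 *: e| <= `|e|.
  by rewrite normrZ ger0_norm ?invr_ge0// ler_piMl// invf_le1// ler1n.
have q0 n y : r + `|e| <= `|y| -> q n y = 0.
  move=> ry; have e0 : 0 <= `|e| by [].
  have l1 := le1 n; have l2 := lerB_normD y (n.+1%:R^-1 *: e).
  by rewrite /q (F0 y) ?(F0 (y + _)) ?subrr ?mulr0//; lra.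
have intq n : (\int[leb]_y (q n y)%:E = 0)%E.
  have i1 : leb.-integrable setT (fun y : borel 'rV[R]_d => (F (y + n.+1%:R^-1 *: e))%:E).
    apply: (@cpt_integrable (r + `|e|)).
      by move=> y; apply: continuous_comp; [exact: continuous_translation|exact: cF].
    move=> y ry; apply: F0.
    have := lerB_normD y (n.+1%:R^-1 *: e).
    by have := le1 n; lra.
  have i2 : leb.-integrable setT (fun y : borel 'rV[R]_d => (F y)%:E) by exact: cpt_integrable F0.
  under eq_integral => y _ do rewrite EFinM EFinB.
  rewrite integralZl//; last exact: integrableB.
  rewrite integralB//= (integral_translation _ cF F0) subee ?mule0//.
  exact: integrable_fin_num.
have Bi := @ball_integrable (r + `|e|) C C0.
have cvq : {ae leb, forall y : borel 'rV[R]_d, setT y -> (fun n => (q n y)%:E) @ \oo --> (dF y)%:E}.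
  apply: aeW => y _; apply: cvg_EFin; first exact: nearW.
  have [dv <-] := Fe y; have /cvgr_dnbhsP cv := dv.
  have /cv : (forall n : nat, n.+1%:R^-1 != 0 :> R) /\ n.+1%:R^-1 @[n --> \oo] --> (0 : R).
    by split => [n|]; [rewrite invr_eq0 pnatr_eq0|exact: cvg_harmonic].
  apply: cvg_trans; apply: near_eq_cvg; apply: nearW => n /=.
  by rewrite invrK [_ *: e + y]addrC.
have bq : {ae leb, forall (y : borel 'rV[R]_d) n, setT y ->
    (`|(q n y)%:E| <= (C * \1_(obox (const_mx (- (r + `|e|))) (const_mx (r + `|e|))) y)%:E)%E}.
  apply: aeW => y n _ /=; rewrite lee_fin.
  have [yr|yr] := ltP `|y| (r + `|e|); last first.
    by rewrite q0// normr0 mulr_ge0.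
  rewrite indicE mem_set ?mulr1; last first.
    move=> i; have := le_lt_trans (coord_le_norm y i) yr.
    by rewrite ltr_norml !mxE => /andP[-> /ltW ->].
  rewrite /q normrM ger0_norm//.
  have n0 : 0 <= n.+1%:R^-1 :> R by rewrite invr_ge0.
  by have := mvt y _ n0; rewrite ler_pdivlMr// mulrC.
have [_ _] := @dominated_convergence _ (borel 'rV[R]_d) R leb setT measurableT
  (fun n y => (q n y)%:E) (fun y => (dF y)%:E) _ (fun n => borel_continuousE (cq n))
  (borel_continuousE cdF) cvq Bi bq.
rewrite (_ : [sequence _]_n = cst 0%E); last by apply/funext => n; exact: intq.
by move=> H; rewrite -[LHS](cvg_lim (@ereal_hausdorff R) H) lim_cst.
Qed.

End Translation.

(** [class_on] is a condition at each point, so regularity may be checked piece by piece. This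
    serves for functions extended by zero. *)
Lemma class_on_cover (R : realType) (d : nat) (V : normedModType R) k
    (O : set 'rV[R]_d) (F : 'rV[R]_d -> V) :
  (forall x, O x -> exists2 W, W x & class_on k W F) -> class_on k O F.
Proof.
elim: k F => [|k IH] F OF.
  by move=> x Ox; have [W Wx] := OF x Ox; exact.
split=> [x Ox|v]; first by have [W Wx [dF _]] := OF x Ox; exact: dF.
by apply: IH => x Ox; have [W Wx [_ cF]] := OF x Ox; exists W => //; exact: cF.
Qed.

Lemma posdef_unitmx (R : realFieldType) n (A : 'M[R]_n) :
  (forall u : 'rV_n, u != 0 -> 0 < (u *m A *m u^T) 0 0) -> A \in unitmx.
Proof.
move=> A_pos; rewrite -row_free_unit; apply: inj_row_free => u uA.
apply/eqP; apply: contraT => /A_pos; by rewrite uA mul0mx mxE ltxx.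
Qed.

(** The segment from the identity to [A] consists of positive definite, hence invertible, matrices.
    Along it the determinant is a polynomial in [t] without zeros on [0, 1], equal to 1 at 0. *)
Lemma posdef_det_gt0 (R : rcfType) n (A : 'M[R]_n) :
  (forall u : 'rV_n, u != 0 -> 0 < (u *m A *m u^T) 0 0) -> 0 < \det A.
Proof.
move=> A_pos; pose At (t : R) := t *: A + (1 - t)%:M.
have At_unit t : 0 <= t <= 1 -> At t \in unitmx.
  move=> /andP[t0 t1]; apply: posdef_unitmx => u u0.
  rewrite /At mulmxDr mulmxDl -scalemxAr -scalemxAl mul_mx_scalar -scalemxAl.
  rewrite [X in 0 < X]mxE [X in 0 < X + _]mxE [X in 0 < _ + X]mxE.
  have Au := A_pos u u0.
  have uu : 0 < (u *m u^T) 0 0.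
    rewrite mxE; have [i ui] : exists i, u 0 i != 0.
      apply/existsP; apply: contraNT u0; rewrite negb_exists => /forallP u0.
      by apply/eqP/rowP => i; rewrite mxE; apply/eqP; rewrite -[_ == _]negbK u0.
    rewrite (bigD1 i)//= ltr_pwDl//; first by rewrite mxE -expr2 exprn_even_gt0.
    by apply: sumr_ge0 => j _; rewrite mxE -expr2 sqr_ge0.
  have [->|tn0] := eqVneq t 0; first by rewrite mul0r add0r subr0 mul1r.
  apply: ltr_pwDl; first by rewrite mulr_gt0// lt_def tn0.
  by rewrite mulr_ge0 ?subr_ge0// ltW.
(* [At] as a matrix of polynomials, so that the intermediate value theorem for polynomials applies
   to its determinant. *)
pose P : 'M[{poly R}]_n := 'X *: map_mx polyC A + (1 - 'X)%:M.
have PE t : (\det P).[t] = \det (At t).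
  rewrite -[LHS]/(horner_eval t _) -det_map_mx; congr (\det _); apply/matrixP => i j.
  rewrite [LHS]mxE /P /At !mxE.
  rewrite -[LHS]/(('X * (A i j)%:P + (1 - 'X) *+ (i == j)).[t]).
  by rewrite !hornerE hornerMn !hornerE.
have A1 : At 1 = A by rewrite /At subrr scale1r raddf0 addr0.
have A0 : At 0 = 1%:M by rewrite /At subr0 scale0r add0r.
rewrite ltNge; apply/negP => A_le0.
have [|t t01 /rootP] := @poly_ivt R (- \det P) 0 1 ler01.
  by rewrite !hornerN !PE A0 A1 det1 lerN10 oppr_ge0.
rewrite hornerN PE => /eqP; rewrite oppr_eq0 => dt0.
by have := At_unit t t01; rewrite unitmxE unitfE dt0.
Qed.

(** * Calculus on the manifold *)

Section Geometry.
Variables (R : realType) (d : nat) (M : ptopologicalType).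
Variable g : riemannian R d M.
Implicit Types (f h : M -> R) (c : chart g) (x : M).

Local Notation coord := (@Defs.coord R d M g).
Local Notation patch := (@Defs.patch R d M g).

Lemma patch_coord c x : dom c x -> patch c (coord c x).
Proof. by move=> cx; exists x. Qed.

Lemma point_of_patch c y : patch c y -> dom c (point_of c y).
Proof. by move=> [x cx <-]; rewrite coordK. Qed.

Lemma point_ofK c y : patch c y -> coord c (point_of c y) = y.
Proof. by move=> [x cx <-]; rewrite coordK. Qed.

Lemma near_patch c y (P : set M) : patch c y -> (\forall z \near point_of c y, P z) ->
  \forall u \near y, patch c u /\ P (point_of c u).
Proof.
move=> cy Py; have := point_of_continuous cy Py => Py'.
have : \forall u \near y, patch c u by apply: open_nbhs_nbhs; split => //; exact: patch_open.
by move=> cy'; near=> u; split; [near: u|near: u].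
Unshelve. all: by end_near. Qed.

Lemma open_preimage_patch c (W : set M) : open W -> open (patch c `&` point_of c @^-1` W).
Proof.
move=> oW; rewrite openE => y [cy Wy]; apply: near_patch => //.
exact: open_nbhs_nbhs.
Qed.

Lemma continuous_pull f c x : dom c x ->
  {for coord c x, continuous (f \o point_of c)} -> {for x, continuous f}.
Proof.
move=> cx cf; rewrite /prop_for /continuous_at.
have E : \forall z \near x, (f \o point_of c \o coord c) z = f z.
  have : \forall z \near x, dom c z by apply: open_nbhs_nbhs; split => //; exact: dom_open.
  by apply: filterS => z zc /=; rewrite coordK.
apply: cvg_trans (near_eq_cvg E) _; rewrite -(nbhs_singleton E).
exact: (@continuous_comp _ _ _ (coord c) (f \o point_of c) x (Defs.coord_continuous cx) cf).
Qed.

Lemma class_C_continuous k f : class_C g k f -> continuous f.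
Proof.
move=> fk x; have [c cx] := dom_cover g x.
by apply: (continuous_pull cx); apply: class_on_cts (fk c) _; exact: patch_coord.
Qed.

Lemma class_C_differentiable k f c y : class_C g k.+1 f -> patch c y -> differentiable (f \o point_of c) y.
Proof. by move=> /(_ c)[df _] cy; exact: df. Qed.

Lemma partial_near c i f h x : dom c x -> (\forall z \near x, f z = h z) ->
  partial c i f x = partial c i h x.
Proof.
move=> cx fh; apply: near_eq_derive.
have cx' := patch_coord cx; move: fh; rewrite -{1}(coordK cx) => /(near_patch cx').
by apply: filterS => u [].
Qed.

Lemma partial_patch c i f y : patch c y ->
  partial c i f (point_of c y) = 'D_(delta_mx 0 i) (f \o point_of c) y.
Proof. by move=> cy; rewrite /partial point_ofK. Qed.

Lemma class_on_partial k c i f : class_C g k.+1 f ->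
  class_on k (patch c) (fun y => partial c i f (point_of c y)).
Proof.
move=> /(_ c)[_ cf]; apply: (class_on_ext (@patch_open _ _ _ g c)) (cf (delta_mx 0 i)).
by move=> y cy; rewrite partial_patch.
Qed.

Lemma partial_cst c i (a : R) x : partial c i (fun=> a) x = 0.
Proof. exact: derive_cst. Qed.

Definition drow c f x : 'rV[R]_d := \row_i partial c i f x.

Local Notation trans c c' := (coord c' \o point_of c).

Lemma trans_near c c' x : dom c x -> dom c' x ->
  \forall u \near coord c x, patch c u /\ dom c' (point_of c u).
Proof.
move=> cx cx'; apply: near_patch (patch_coord cx) _; rewrite coordK//.
by apply: open_nbhs_nbhs; split => //; exact: dom_open.
Qed.

Lemma trans_class c c' k : class_on k (coord c @` (dom c `&` dom c')) (trans c c').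
Proof. exact: transition_smooth. Qed.

Lemma trans_differentiable c c' x : dom c x -> dom c' x ->
  differentiable (trans c c') (coord c x).
Proof. by move=> cx cx'; have [dt _] := @trans_class c c' 1; apply: dt; exists x. Qed.

Lemma drow_trans c c' f x : class_C g 1 f -> dom c x -> dom c' x ->
  drow c f x = drow c' f x *m ('J (trans c c') (coord c x))^T.
Proof.
move=> f1 cx cx'; apply/rowP => i; rewrite !mxE.
have E : \forall u \near coord c x, (f \o point_of c) u = ((f \o point_of c') \o trans c c') u.
  by apply: filterS (trans_near cx cx') => u [_ cu] /=; rewrite coordK.
have Ex : trans c c' (coord c x) = coord c' x by rewrite /= coordK.
rewrite /partial (near_eq_derive _ E) derive_comp_row.
- by rewrite Ex; apply: eq_bigr => j _; rewrite -rowE !mxE mulrC.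
- exact: trans_differentiable.
- by rewrite Ex; apply: class_C_differentiable f1 (patch_coord cx').
Qed.

Lemma gram_unit c x : dom c x -> gram c x \in unitmx.
Proof. by move=> cx; apply: posdef_unitmx => u; exact: gram_pos. Qed.

Lemma dens_gt0 c x : dom c x -> 0 < dens c x.
Proof. by move=> cx; rewrite sqrtr_gt0; apply: posdef_det_gt0 => u; exact: gram_pos. Qed.

(** Differentials transform with [J^T]. The claim thus reduces to [J^T K^-1 J = G^-1] for
    [K = J G J^T], obtained by cancelling [J] and then [G] on the left. *)
Lemma grad_vector_field f : class_C g 1 f -> is_vector_field (grad g f).
Proof.
move=> f1 c c' x cx cx'; rewrite /grad -!/(drow _ _ _) (drow_trans f1 cx cx').
rewrite (gram_transition cx cx'); set J := 'J _ _.
(* Invertibility of the Jacobian is read off from the orientation of the atlas. *)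
have uJ : J \in unitmx by rewrite unitmxE unitfE gt_eqF// transition_oriented.
have uJt : J^T \in unitmx by rewrite unitmx_tr.
have ug := gram_unit cx'.
set G := gram c' x; set K := J *m G *m J^T.
have uK : K \in unitmx by rewrite !unitmx_mul uJ uJt ug.
have JK : J *m (G *m (J^T *m invmx K *m J)) = J *m 1%:M.
  by rewrite !mulmxA -/K mulmxV// mul1mx mulmx1.
have GZ := can_inj (mulKmx uJ) JK.
have <- : J^T *m (invmx K *m J) = invmx G.
  by rewrite mulmxA -[LHS](mulKmx ug) GZ mulmx1.
by rewrite !mulmxA.
Qed.

Lemma vdot_chart (X Y : field g) c x : is_vector_field X -> is_vector_field Y -> dom c x ->
  vdot X Y x = (X c x *m gram c x *m (Y c x)^T) 0 0.
Proof.
move=> hX hY cx; rewrite /vdot; set c' := chart_at g x.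
have cx' : dom c' x by rewrite /c' /chart_at; case: cid.
rewrite (hX c c' x cx cx') (hY c c' x cx cx') (gram_transition cx cx').
by rewrite trmx_mul !mulmxA.
Qed.

(** The metric cancels against the inverse metric of the gradient and leaves the derivative of [f]
    along [X]. *)
Lemma vdot_gradr (X : field g) f c x : is_vector_field X -> class_C g 1 f -> dom c x ->
  vdot X (grad g f) x = \sum_i X c x 0 i * partial c i f x.
Proof.
move=> hX f1 cx; rewrite (vdot_chart hX (grad_vector_field f1) cx) /grad trmx_mul trmx_inv.
rewrite gram_sym// !mulmxA mulmxK ?gram_unit// mxE.
by apply: eq_bigr => i _; rewrite !mxE.
Qed.

Lemma vdotC (X Y : field g) : is_vector_field X -> is_vector_field Y -> vdot X Y = vdot Y X.
Proof.
move=> hX hY; apply/funext => x; have [c cx] := dom_cover g x.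
have E (u v : 'rV[R]_d) G : u *m G *m v^T = (v *m G^T *m u^T)^T.
  by rewrite !trmx_mul !trmxK mulmxA.
by rewrite !(vdot_chart _ _ cx)// E mxE gram_sym.
Qed.

Lemma vdot_ge0 (X : field g) x : 0 <= vdot X X x.
Proof.
rewrite /vdot; set c := chart_at g x.
have cx : dom c x by rewrite /c /chart_at; case: cid.
have [->|u0] := eqVneq (X c x) 0; first by rewrite !mul0mx mxE.
exact/ltW/gram_pos.
Qed.

Lemma class_on_gram k c i j : class_on k (patch c) (fun y => gram c (point_of c y) i j).
Proof. by apply: class_on_coord; [exact: patch_open|exact: gram_smooth]. Qed.

Lemma class_on_dens c : class_on 1 (patch c) (dens c \o point_of c).
Proof.
apply: (class_on_sqrt (@patch_open _ _ _ g c)) => [y cy|].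
  by apply: posdef_det_gt0 => u; apply: gram_pos; exact: point_of_patch.
apply: class_on_det; first exact: patch_open.
by move=> i j; exact: class_on_gram.
Qed.

Lemma class_on_grad f c i : class_C g 2 f ->
  class_on 1 (patch c) (fun y => grad g f c (point_of c y) 0 i).
Proof.
move=> f2; have op := @patch_open _ _ _ g c.
have H : class_on 1 (patch c) (fun y => \sum_j partial c j f (point_of c y) * invmx (gram c (point_of c y)) j i).
  apply: class_on_sum => // j _; apply: (class_onM op); first exact: class_on_partial.
  apply: (class_on_invmx op) => [y cy|k l]; last exact: class_on_gram.
  by apply: gram_unit; exact: point_of_patch.
apply: (class_on_ext op _ H) => y _; rewrite mxE; apply: eq_bigr => j _; by rewrite mxE.
Qed.

Lemma vdot_grad_continuous f h : class_C g 2 f -> class_C g 1 h ->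
  continuous (vdot (grad g f) (grad g h)).
Proof.
move=> f2 h1 x; have [c cx] := dom_cover g x; apply: (continuous_pull cx).
have f1 : class_C g 1 f by move=> c'; apply: class_onS; exact: f2.
have op := @patch_open _ _ _ g c.
have H : class_on 0 (patch c) (fun y => \sum_i grad g f c (point_of c y) 0 i * partial c i h (point_of c y)).
  apply: class_on_sum => // j _; apply: (class_onM op); last exact: class_on_partial.
  by apply: class_onS; exact: class_on_grad.
have H' : class_on 0 (patch c) (vdot (grad g f) (grad g h) \o point_of c).
  apply: (class_on_ext op _ H) => y cy /=.
  by rewrite (vdot_gradr (grad_vector_field f1) h1 (point_of_patch cy)).
exact: (H' _ (patch_coord cx)).
Qed.

Lemma class_C_cst k (a : R) : class_C g k (fun=> a).
Proof. by move=> c; exact: class_on_cst. Qed.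

Lemma class_CD k f h : class_C g k f -> class_C g k h -> class_C g k (fun x => f x + h x).
Proof. by move=> fk hk c; exact: (class_onD (@patch_open _ _ _ g c) (fk c) (hk c)). Qed.

Lemma class_CM k f h : class_C g k f -> class_C g k h -> class_C g k (fun x => f x * h x).
Proof. by move=> fk hk c; exact: (class_onM (@patch_open _ _ _ g c) (fk c) (hk c)). Qed.

Lemma class_CN k f : class_C g k f -> class_C g k (fun x => - f x).
Proof. by move=> fk c; exact: (class_onN (@patch_open _ _ _ g c) (fk c)). Qed.

Lemma class_C_sum k (I : Type) (r : seq I) (F : I -> M -> R) :
  (forall i, class_C g k (F i)) -> class_C g k (fun x => \sum_(i <- r) F i x).
Proof. by move=> Fk c; apply: (class_on_sum (@patch_open _ _ _ g c)) => i _; exact: Fk. Qed.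

Lemma class_C_inv f : (forall x, f x != 0) -> class_C g 1 f -> class_C g 1 (fun x => (f x)^-1).
Proof. by move=> f0 f1 c; apply: (class_on_inv (@patch_open _ _ _ g c)); [move=> y _; exact: f0|exact: f1]. Qed.

Hypothesis hM : hausdorff_space M.

(** In a Hausdorff space [K] is closed, so [f] is 0 near each point outside it. Continuity inside
    one chart is then enough. *)
Lemma vanishing_outside_continuous c (K : set M) f : compact K -> K `<=` dom c ->
  (forall x, ~ K x -> f x = 0) ->
  (forall x, dom c x -> {for x, continuous f}) -> continuous f.
Proof.
move=> cK Kc f0 cf x; have [Kx|Kx] := pselect (K x); first exact/cf/Kc.
have E : \forall z \near x, 0 = f z.
  have : \forall z \near x, (~` K) z.
    apply: open_nbhs_nbhs; split => //; apply: closed_openC; exact: compact_closed.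
  by apply: filterS => z /f0.
rewrite /continuous_at f0//; apply: cvg_trans (near_eq_cvg E) _; exact: cvg_cst.
Qed.

Definition bump_at c (K : set M) (T : M -> R) :=
  [/\ class_C g 1 T, forall z, 0 <= T z, compact K, K `<=` dom c & forall z, ~ K z -> T z = 0].

Lemma exists_bump x : exists c K T, bump_at c K T /\ 0 < T x.
Proof.
have [c cx] := dom_cover g x; exists c.
set y0 := coord c x.
have /nbhs_ballP[r0 r0_gt0 Hr0] : nbhs y0 (patch c).
  by apply: open_nbhs_nbhs; split; [exact: patch_open|exact: patch_coord].
(* Half the radius keeps the closed cube [L] inside the open ball contained in the patch. *)
pose r := r0 / 2; have r_gt0 : 0 < r by rewrite divr_gt0.
pose L := [set y : 'rV[R]_d | `|y - y0| <= r].
have Lc : L `<=` patch c.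
  move=> y yr; apply: Hr0; rewrite -ball_normE/= distrC.
  by apply: le_lt_trans yr _; rewrite /r ltr_pdivrMr// mulr2n mulrDr mulr1 ltrDl.
have cL : compact L.
  apply: bounded_closed_compact.
    exists (r + `|y0|); split; first exact: num_real.
    move=> z rz y /= yr; apply: ltW; apply: le_lt_trans rz.
    by have := lerB_normD y (- y0); rewrite normrN; move: yr; rewrite /L/=; lra.
  have -> : L = (fun y : 'rV[R]_d => `|y - y0| : R) @^-1` [set z : R | z <= r] by [].
  apply: preimage_closed; last exact: closed_le.
  move=> y _; apply: (@continuous_comp _ _ _ (fun y : 'rV[R]_d => y - y0) (fun y : 'rV[R]_d => `|y| : R)).
    exact: continuous_translation.
  exact: norm_continuous.
(* A polynomial, positive exactly on the Euclidean ball of radius [r]. That ball lies in [L], the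
   norm of row vectors being the maximum norm. *)
pose q (y : 'rV[R]_d) := r ^+ 2 - \sum_i (y 0 i - y0 0 i) ^+ 2.
pose beta : 'rV[R]_d -> R := @sqr_ramp R \o q.
have q1 : class_on 1 setT q.
  apply: class_onB; [exact: openT|exact: class_on_cst|].
  apply: class_on_sum => [|i _]; first exact: openT.
  have e1 : class_on 1 setT (fun y : 'rV[R]_d => y 0 i - y0 0 i).
    apply: class_onB; [exact: openT| |exact: class_on_cst].
    apply: class_on_coord; first exact: openT.
    split=> [y _|v]; first by have [] := is_diff_id y.
    by rewrite (_ : 'D_v _ = fun=> v); [exact: class_on_cst|apply/funext => y; exact: derive_id].
  exact: (class_onM openT e1 e1).
have b1 : class_on 1 setT beta.
  apply: class_on_comp1 q1; first exact: openT.
    by move=> y _; apply/derivable1_diffP; have [] := is_derive_sqr_ramp (q y).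
  by move=> y _; exact: continuous_sqr_ramp'.
have b0 y : ~ L y -> beta y = 0.
  move=> Ly; rewrite /beta/= /sqr_ramp max_l ?expr0n//.
  rewrite subr_le0 leNgt; apply/negP => yr; apply: Ly.
  rewrite /L/= /Num.Def.normr/= mx_normrE; apply/bigmax_leP; split => [|[i j] _]; first exact: ltW.
  rewrite [i]ord1 !mxE/= -(ger0_norm (ltW r_gt0)) -ler_sqr ?nnegrE// -!normrX !ger0_norm ?sqr_ge0//.
  apply: le_trans (ltW yr); rewrite (bigD1 j)//= lerDl.
  by apply: sumr_ge0 => k _; exact: sqr_ge0.
pose T z := if pselect (dom c z) then beta (coord c z) else 0.
have Tc y : patch c y -> T (point_of c y) = beta y.
  move=> cy; rewrite /T; case: pselect => [zc|/=]; last by have := point_of_patch cy.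
  by rewrite point_ofK.
pose K := point_of c @` L.
have cK : compact K.
  apply: continuous_compact => //; apply: continuous_in_subspaceT => y /set_mem /Lc cy.
  exact: point_of_continuous.
have K0 z : ~ K z -> T z = 0.
  move=> Kz; rewrite /T; case: pselect => //= cz; apply: b0 => Lz.
  by apply: Kz; exists (coord c z) => //; rewrite coordK.
have Kc : K `<=` dom c by move=> _ [y Ly <-]; apply: point_of_patch; exact: Lc.
exists K, T; split; last first.
  rewrite /T; case: pselect => //= _; rewrite -/y0 /beta /= /sqr_ramp /q.
  rewrite big1 ?subr0; last by move=> i _; rewrite subrr expr0n.
  by rewrite max_r ?sqr_ge0// !exprn_gt0.
split => // [c'|z]; last first.
  by rewrite /T; case: pselect => //= _; exact: sqr_ge0.
(* In any other chart, a point over [K] has a neighbourhood where [T] is [beta] composed with the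
   transition map; the remaining points lie over the open complement of [K], where [T] is 0. *)
apply: class_on_cover => y cy.
have [Ky|Ky] := pselect (K (point_of c' y)).
  exists (coord c' @` (dom c' `&` dom c)).
    by exists (point_of c' y); [split; [exact: point_of_patch|exact: Kc]|rewrite point_ofK].
  have oI : open (coord c' @` (dom c' `&` dom c)).
    have -> : coord c' @` (dom c' `&` dom c) = patch c' `&` point_of c' @^-1` dom c.
      apply/seteqP; split => u; first by move=> [z [zc' zc] <-]; split; [exists z|rewrite /= coordK].
      by move=> [uc' uc]; exists (point_of c' u); [split => //; exact: point_of_patch|exact: point_ofK].
    by apply: open_preimage_patch; exact: dom_open.
  have H : class_on 1 (coord c' @` (dom c' `&` dom c)) (beta \o (coord c \o point_of c')).
    by apply: (class_on_precomp oI _ _ b1) => //; exact: transition_smooth.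
  apply: (class_on_ext oI _ H) => u [z [zc' zc] <-] /=.
  by rewrite coordK// /T; case: pselect.
exists (patch c' `&` point_of c' @^-1` (~` K)) => //.
have oI : open (patch c' `&` point_of c' @^-1` (~` K)).
  by apply: open_preimage_patch; apply: closed_openC; exact: compact_closed.
apply: (class_on_ext oI _ (class_on_cst 1 _ (0 : R))) => u [_ /= Ku].
by rewrite K0.
Qed.

(** The bumps are indexed by the points of [M], and [r] lists those of a finite subcover. The
    positive sum is left unnormalised; the division by it is made in Green's formula. *)
Lemma exists_bump_cover : compact [set: M] ->
  exists (J : choiceType) (r : seq J) (c : J -> chart g) (K : J -> set M) (T : J -> M -> R),
    (forall j, bump_at (c j) (K j) (T j)) /\ forall x, 0 < \sum_(j <- r) T j x.
Proof.
move=> cM.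
have H x : exists t : chart g * set M * (M -> R), bump_at t.1.1 t.1.2 t.2 /\ 0 < t.2 x.
  by have [c [K [T ?]]] := exists_bump x; exists (c, K, T).
have [t tP] := choice H.
pose W x := [set z | 0 < (t x).2 z].
have oW x : open (W x).
  have [[T1 _ _ _ _] _] := tP x.
  apply: (@open_comp _ _ (t x).2 [set z : R | 0 < z]); last exact: open_gt.
  by move=> z _; apply: (class_C_continuous T1).
move: cM; rewrite compact_cover => /(_ M setT W (fun x _ => oW x)).
case; first by move=> x _; exists x => //; have [] := tP x.
move=> D _ DW; exists M, (finmap.enum_fset D), (fun x => (t x).1.1), (fun x => (t x).1.2), (fun x => (t x).2).
split => [j|x]; first by have [] := tP j.
have [j jD jx] := DW x I.
rewrite (big_rem j)//=; apply: ltr_pwDl => //.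
by apply: sumr_ge0 => k _; have [[_ ->]] := tP k.
Qed.

End Geometry.

(** * Integrals against a measure with a density *)

Section Density.
Context d (T : measurableType d) (R : realType).
Variables (mu nu : {measure set T -> \bar R}) (rho : T -> R).
Hypotheses (mrho : measurable_fun setT rho) (rho0 : forall x, 0 <= rho x).
Hypothesis nuE : forall S, measurable S -> nu S = (\int[mu]_(x in S) (rho x)%:E)%E.
Import HBNNSimple.

Lemma nnsfun_density (h : {nnsfun T >-> R}) :
  (\int[nu]_x (h x)%:E = \int[mu]_x ((h x)%:E * (rho x)%:E))%E.
Proof.
have mr : measurable_fun setT (EFin \o rho) by exact/measurable_EFinP.
have mi r : measurable (h @^-1` [set r]) by [].
rewrite integralT_nnsfun sintegralE.
transitivity (\int[mu]_x (\sum_(r \in range h) (r%:E * (\1_(h @^-1` [set r]) x * rho x)%:E)))%E.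
  rewrite ge0_integral_fsum//; last 2 first.
  - move=> r; apply: measurable_funeM; apply/measurable_EFinP.
    by apply: measurable_funM => //; exact: measurable_indic.
  - move=> r x _; have [[y _ <-]|hr] := pselect (range h r).
      by rewrite mule_ge0 ?lee_fin ?mulr_ge0.
    rewrite indicE memNset ?mul0r ?mule0// => /= hx; apply: hr.
    by exists x.
  apply: eq_fsbigr => r; rewrite inE => -[y _ <-].
  rewrite ge0_integralZl//; last 3 first.
  - apply/measurable_EFinP; apply: measurable_funM => //; exact: measurable_indic.
  - by move=> x _; rewrite lee_fin mulr_ge0.
  - by rewrite lee_fin.
  congr (_ * _)%E; rewrite nuE// [LHS]integral_mkcond; apply: eq_integral => x _.
  rewrite patchE indicE; case: ifPn => _; [by rewrite mul1r|by rewrite mul0r].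
apply: eq_integral => x _; rewrite -EFinM.
transitivity (\sum_(r \in range h) (r * (\1_(h @^-1` [set r]) x * rho x))%:E)%E.
  by apply: eq_fsbigr => r _; rewrite EFinM.
rewrite fsumEFin//; congr (_%:E); rewrite [in RHS](fimfunE h) !fsbig_finite//= mulr_suml.
by apply: eq_bigr => r _; rewrite mulrA.
Qed.

(** Monotone convergence on both sides, from the case of simple functions. *)
Lemma ge0_integral_density (f : T -> \bar R) : measurable_fun setT f ->
  (forall x, 0 <= f x)%E -> (\int[nu]_x f x = \int[mu]_x (f x * (rho x)%:E))%E.
Proof.
move=> mf f0; pose h := nnsfun_approx measurableT mf.
have hf x : (EFin \o h n) x @[n --> \oo] --> f x.
  by apply: cvg_nnsfun_approx.
have hmon x : {homo (fun n => (h n x)) : a b / (a <= b)%N >-> a <= b}.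
  by move=> a b ab; exact/lefP/nd_nnsfun_approx.
have mh n : measurable_fun setT (fun x => (h n x)%:E) by exact/measurable_EFinP/measurable_funP.
have mr : measurable_fun setT (EFin \o rho) by exact/measurable_EFinP.
transitivity (limn (fun n => \int[nu]_x (h n x)%:E)%E).
  rewrite -monotone_convergence//.
  - by apply: eq_integral => x _; apply/esym/cvg_lim => //; exact: hf.
  - by move=> n x _; rewrite lee_fin.
  - by move=> x _ a b ab; rewrite lee_fin; exact: hmon.
under eq_fun do rewrite nnsfun_density.
rewrite -monotone_convergence//.
- apply: eq_integral => x _; apply/cvg_lim => //.
  by apply: cvgeZr => //; exact: hf.
- by move=> n; exact: emeasurable_funM.
- by move=> n x _; rewrite mule_ge0 ?lee_fin.
- by move=> x _ a b ab; rewrite lee_wpmul2r ?lee_fin//; exact: hmon.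
Qed.

End Density.

(** * Extension by zero of compactly supported functions *)

Section CompactSupport.
Variables (R : realType) (d : nat) (leb : {measure set (borel 'rV[R]_d) -> \bar R}).
Hypothesis hleb : is_lebesgue leb.
Variables (O L : set 'rV[R]_d) (G : 'rV[R]_d -> R).
Hypotheses (oO : open O) (cL : compact L) (LO : L `<=` O).
Hypotheses (G1 : class_on 1 O G) (G0 : forall y, O y -> ~ L y -> G y = 0).

Let Ge (y : 'rV[R]_d) := if pselect (O y) then G y else 0.

Let oL : open (~` L).
Proof. by apply: closed_openC; apply: compact_closed => //; exact: norm_hausdorff. Qed.

Let Ge0 y : ~ L y -> Ge y = 0.
Proof. by move=> Ly; rewrite /Ge; case: pselect => //= Oy; exact: G0. Qed.

Let Ge1 : class_on 1 setT Ge.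
Proof.
apply: class_on_cover => y _; have [Ly|Ly] := pselect (L y).
  exists O; first exact: LO.
  by apply: (class_on_ext oO _ G1) => z Oz; rewrite /Ge; case: pselect.
exists (~` L) => //; apply: (class_on_ext oL _ (class_on_cst 1 _ (0 : R))) => z Lz.
by rewrite Ge0.
Qed.

(** The open sets [O] and the complement of [L] cover the space. On the first the extension is [G],
    on the second it is 0. *)
Lemma derive_extension i y :
  'D_(delta_mx 0 i) Ge y = if pselect (O y) then 'D_(delta_mx 0 i) G y else 0.
Proof.
case: pselect => /= Oy.
  apply: near_eq_derive; apply: filterS (open_nbhs_nbhs (conj oO Oy)) => z Oz.
  by rewrite /Ge; case: pselect.
have Ly : (~` L) y by move=> /LO.
rewrite -(derive_cst (0 : R) y (delta_mx 0 i)); apply: near_eq_derive.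
by apply: filterS (open_nbhs_nbhs (conj oL Ly)) => z Lz; rewrite Ge0.
Qed.

Lemma integral_derive_extension i :
  leb.-integrable setT (fun y : borel 'rV[R]_d => ('D_(delta_mx 0 i) Ge y)%:E) /\
  (\int[leb]_y ('D_(delta_mx 0 i) Ge y)%:E = 0)%E.
Proof.
have [dGe cGe] := Ge1.
have cD : continuous ('D_(delta_mx 0 i) Ge) by move=> y; exact: cGe.
have [r [_ Lr]] := compact_bounded cL.
(* [compact_bounded] bounds [L] by every number above [r], whence a margin of 1. The derivative gets
   a second one, as it vanishes where [Ge] is 0 in a neighbourhood. *)
have rL y : r + 1 <= `|y| -> Ge y = 0.
  move=> ry; apply: Ge0 => /(Lr (r + 2^-1)) H.
  have Hr : r < r + 2^-1 by rewrite ltrDl.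
  by have := H Hr; rewrite /=; lra.
have rD y : r + 2 <= `|y| -> 'D_(delta_mx 0 i) Ge y = 0.
  move=> ry; rewrite -(derive_cst (0 : R) y (delta_mx 0 i)); apply: near_eq_derive.
  have H : \forall x \near `|y|, r + 1 < x by apply: lt_nbhsr; lra.
  have H' : \forall z \near y, r + 1 < `|z| by exact: (@norm_continuous _ _ y _ H).
  by apply: filterS H' => z /ltW /rL.
split; first by apply: (cpt_integrable hleb cD rD).
apply: (integral_derive0 hleb (F := Ge) (r := r + 1) (e := delta_mx 0 i)) => //.
- by move=> y; apply/derivableP/diff_derivable/dGe.
- by move=> y; exact/differentiable_continuous/dGe.
Qed.

End CompactSupport.

Lemma derive1_expR (R : realType) : (expR : R -> R)^`()%classic = expR.
Proof. by apply/funext => t; rewrite derive1E; have [_ ->] := is_derive_expR t. Qed.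

(** * Integration by parts in one chart *)

Section Green.
Variables (R : realType) (d : nat) (M : ptopologicalType).
Hypotheses (hM : hausdorff_space M) (cM : compact [set: M]).
Variable g : riemannian R d M.
Variable vol : {measure set (borel M) -> \bar R}.
Hypothesis hvol : is_volume g vol.
Variable U : M -> R.
Hypothesis hU : class_C g 1 U.
Variable pi : probability (borel M) R.
Hypothesis hpi : forall S : set (borel M), measurable S ->
    pi S = (\int[vol]_(x in S) (expR (- U x))%:E)%E.
Implicit Types (f h : M -> R) (c : chart g) (x : M).

Local Notation coord := (@Defs.coord R d M g).
Local Notation patch := (@Defs.patch R d M g).

(** The density of [pi] with respect to Lebesgue measure in the chart [c]. *)
Definition weight c x := expR (- U x) * dens c x.

Lemma weight_gt0 c x : dom c x -> 0 < weight c x.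
Proof. by move=> cx; rewrite mulr_gt0 ?expR_gt0// dens_gt0. Qed.

Let cU : continuous (fun x => expR (- U x)).
Proof.
move=> x; apply: (@continuous_comp _ _ _ (fun x => - U x) expR); last exact: continuous_expR.
by apply: continuousN; exact: (class_C_continuous hU).
Qed.

Lemma class_on_weight c : class_on 1 (patch c) (weight c \o point_of c).
Proof.
have op := @patch_open _ _ _ g c.
have e1 : class_on 1 (patch c) (expR \o (fun y => - U (point_of c y))).
  apply: (class_on_comp1 op); last exact: (class_onN op (hU c)).
    by move=> y _; apply/derivable1_diffP; exact: derivable_expR.
  rewrite derive1_expR.
  by move=> y _; exact: continuous_expR.
exact: (class_onM op e1 (class_on_dens c)).
Qed.

(** The chart formula is an argument because [is_volume] asserts the existence of a Lebesgue
    measure, and one and the same measure must serve throughout a computation. *)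
Lemma ge0_chart_integral leb c (Q : M -> R) :
  is_lebesgue leb ->
  (forall c (F : borel M -> \bar R), measurable_fun setT F -> (forall x, 0 <= F x)%E ->
   (\int[vol]_(x in (dom c : set (borel M))) F x =
   \int[leb]_(y in (patch c : set (borel 'rV[R]_d)))
     (F (point_of c y) * (dens c (point_of c y))%:E))%E) ->
  continuous Q -> (forall x, 0 <= Q x) -> (forall x, ~ dom c x -> Q x = 0) ->
  (\int[pi]_x (Q x)%:E =
   \int[leb]_(y in (patch c : set (borel 'rV[R]_d))) (Q (point_of c y) * weight c (point_of c y))%:E)%E.
Proof.
move=> hleb hv cQ Q0 Qc.
rewrite (@ge0_integral_density _ _ _ vol pi (fun x => expR (- U x)) _ _ hpi (EFin \o Q)) => //; first last.
- exact: borel_continuousE.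
- exact: borel_continuousR.
under eq_integral do rewrite -EFinM.
transitivity (\int[vol]_(x in (dom c : set (borel M))) (Q x * expR (- U x))%:E)%E.
  rewrite [RHS]integral_mkcond; apply: eq_integral => x _; rewrite patchE; case: ifPn => //.
  by rewrite notin_setE => /Qc ->; rewrite mul0r.
rewrite hv; last 2 first.
- apply: (@borel_continuousE R M (fun x => Q x * expR (- U x))) => x.
  by apply: cvgM; [exact: cQ|exact: cU].
- by move=> x; rewrite lee_fin mulr_ge0// expR_ge0.
by apply: eq_integral => y _; rewrite -EFinM -mulrA.
Qed.

Lemma chart_integral leb c (Q : M -> R) :
  is_lebesgue leb ->
  (forall c (F : borel M -> \bar R), measurable_fun setT F -> (forall x, 0 <= F x)%E ->
   (\int[vol]_(x in (dom c : set (borel M))) F x =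
   \int[leb]_(y in (patch c : set (borel 'rV[R]_d)))
     (F (point_of c y) * (dens c (point_of c y))%:E))%E) ->
  continuous Q -> (forall x, ~ dom c x -> Q x = 0) ->
  (\int[pi]_x (Q x)%:E =
   \int[leb]_(y in (patch c : set (borel 'rV[R]_d))) (Q (point_of c y) * weight c (point_of c y))%:E)%E.
Proof.
move=> hleb hv cQ Qc; rewrite integralE [RHS]integralE.
pose P x := Num.max (Q x) 0; pose N x := Num.max (- Q x) 0.
have cmax (q : M -> R) : continuous q -> continuous (fun x => Num.max (q x) 0).
  by move=> cq x; apply: continuous_max; [exact: cq|exact: cst_continuous].
have cP : continuous P by exact: cmax.
have cN : continuous N by apply: (cmax (fun x => - Q x)) => x; apply: continuousN; exact: cQ.
have eP : (fun x => (Q x)%:E)^\+%E = EFin \o P.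
  by apply/funext => x; rewrite funeposE /P /= EFin_max.
have eN : (fun x => (Q x)%:E)^\-%E = EFin \o N.
  by apply/funext => x; rewrite funenegE /N /= EFin_max.
rewrite eP eN (ge0_chart_integral (c := c) hleb hv cP); last 2 first.
- by move=> x; rewrite le_max lexx orbT.
- by move=> x /Qc; rewrite /P => ->; rewrite maxxx.
rewrite (ge0_chart_integral (c := c) hleb hv cN); last 2 first.
- by move=> x; rewrite le_max lexx orbT.
- by move=> x /Qc; rewrite /N => ->; rewrite oppr0 maxxx.
congr (_ - _)%E; apply: eq_integral => y; rewrite inE => cy.
  by rewrite funeposE -EFin_max /P maxr_pMl ?mul0r// ltW// weight_gt0//; exact: point_of_patch.
by rewrite funenegE -EFin_max /N maxr_pMl ?mul0r ?mulNr// ltW// weight_gt0//; exact: point_of_patch.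
Qed.

(** The operator in divergence form, [e^U div (e^-U grad f)], computed in the chart [c] alone. It is
    thus available for every smooth [f], without a Laplacian common to all charts. *)
Definition chart_generator c f x : R :=
  if pselect (dom c x) then
    (weight c x)^-1 * \sum_i partial c i (fun z => weight c z * grad g f c z 0 i) x
  else 0.

Lemma class_on_flux c f i : class_C g 2 f ->
  class_on 1 (patch c) (fun y => weight c (point_of c y) * grad g f c (point_of c y) 0 i).
Proof.
move=> f2; exact: (class_onM (@patch_open _ _ _ g c) (class_on_weight c) (class_on_grad c i f2)).
Qed.

Lemma chart_generator_continuous c f x : class_C g 2 f -> dom c x ->
  {for x, continuous (chart_generator c f)}.
Proof.
move=> f2 cx; apply: (continuous_pull cx); have op := @patch_open _ _ _ g c.
have H : class_on 0 (patch c) (fun y => (weight c (point_of c y))^-1 *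
    \sum_i 'D_(delta_mx 0 i) (fun y => weight c (point_of c y) * grad g f c (point_of c y) 0 i) y).
  apply: (class_onM op).
    apply: class_onS; apply: (class_on_inv op) (class_on_weight c) => y cy.
    by rewrite /= gt_eqF// weight_gt0//; exact: point_of_patch.
  by apply: (class_on_sum op) => i _; have [_] := class_on_flux c i f2; exact.
have H' : class_on 0 (patch c) (chart_generator c f \o point_of c).
  apply: (class_on_ext op _ H) => y cy /=; rewrite /chart_generator.
  case: pselect => [yc|/(_ (point_of_patch cy))//]; congr (_ * _).
  by apply: eq_bigr => i _; rewrite partial_patch.
exact: (H' _ (patch_coord cx)).
Qed.

(** Multiplied by the weight, the integrand becomes in coordinates the sum over i of the i-th
    derivative of [weight * grad^i f * T], by the product rule. Each term has integral 0, being a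
    derivative of a compactly supported function. *)
Lemma chart_green c K f T : class_C g 2 f -> class_C g 1 T -> compact K -> K `<=` dom c ->
  (forall x, ~ K x -> T x = 0) ->
  (\int[pi]_x (vdot (grad g f) (grad g T) x + chart_generator c f x * T x)%:E = 0)%E.
Proof.
move=> f2 T1 cK Kc T0; have [leb hleb hv] := hvol; have op := @patch_open _ _ _ g c.
have f1 : class_C g 1 f by move=> c'; apply: class_onS; exact: f2.
set Q := fun x => vdot (grad g f) (grad g T) x + chart_generator c f x * T x.
have Q0 x : ~ K x -> Q x = 0.
  move=> Kx; rewrite /Q T0// mulr0 addr0; have [c' cx'] := dom_cover g x.
  rewrite (vdot_gradr (grad_vector_field f1) T1 cx') big1// => i _.
  rewrite (@partial_near _ _ _ _ c' i T (fun=> 0) x cx') ?partial_cst ?mulr0//.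
  have : \forall z \near x, (~` K) z.
    by apply: open_nbhs_nbhs; split => //; apply: closed_openC; exact: compact_closed.
  by apply: filterS => z /T0.
have cQ : continuous Q.
  apply: (vanishing_outside_continuous hM cK Kc Q0) => x cx.
  apply: continuousD; first exact: vdot_grad_continuous.
  by apply: continuousM; [exact: chart_generator_continuous|exact: (class_C_continuous T1)].
rewrite (chart_integral (c := c) hleb hv cQ); last by move=> x cx; apply: Q0 => /Kc.
pose G i y := weight c (point_of c y) * grad g f c (point_of c y) 0 i * T (point_of c y).
have G1 i : class_on 1 (patch c) (G i) by exact: (class_onM op (class_on_flux c i f2) (T1 c)).
have cL : compact (coord c @` K).
  apply: continuous_compact => //; apply: continuous_in_subspaceT => x /set_mem /Kc cx.
  exact: Defs.coord_continuous.
have LO : coord c @` K `<=` patch c by move=> _ [x /Kc cx <-]; exact: patch_coord.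
have G0 i y : patch c y -> ~ (coord c @` K) y -> G i y = 0.
  move=> cy Ky; rewrite /G T0 ?mulr0// => Ky'; apply: Ky.
  by exists (point_of c y) => //; rewrite point_ofK.
have I i := integral_derive_extension hleb op cL LO (G1 i) (G0 i) i.
pose E i y := 'D_(delta_mx 0 i) (fun y => if pselect (patch c y) then G i y else 0) y.
transitivity (\int[leb]_y (\sum_i (E i y)%:E))%E; last first.
  rewrite integral_sum//; last by move=> i; have [] := I i.
  by rewrite big1// => i _; have [] := I i.
rewrite integral_mkcond; apply: eq_integral => y _; rewrite patchE sumEFin.
have EE i : E i y = if pselect (patch c y) then 'D_(delta_mx 0 i) (G i) y else 0.
  exact: derive_extension op cL LO (G0 i) i y.
case: ifPn => [/set_mem cy|]; last first.
  rewrite notin_setE => cy; congr (_%:E); apply/esym/big1 => i _; rewrite EE.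
  by case: pselect.
congr (_%:E); have cx := point_of_patch cy.
rewrite /Q (vdot_gradr (grad_vector_field f1) T1 cx) /chart_generator.
case: pselect => // _ /=; have w0 : weight c (point_of c y) != 0 by rewrite gt_eqF// weight_gt0.
set S := \sum_i _ * partial c i T _; set D := \sum_i partial c i _ _; set w := weight c _ in w0 *.
have -> : (S + w^-1 * D * T (point_of c y)) * w = S * w + D * T (point_of c y) by field.
rewrite !mulr_suml -big_split/=; apply: eq_bigr => i _; rewrite EE; case: pselect => //= _.
have [dw _] := class_on_flux c i f2; have [dT _] := T1 c.
rewrite (deriveM (f := fun y => weight c (point_of c y) * grad g f c (point_of c y) 0 i)
  (g := T \o point_of c))/=; [|exact/diff_derivable/dw|exact/diff_derivable/dT].
by congr (_ + _); [rewrite partial_patch// mulrC mulrA|rewrite partial_patch// mulrC].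
Qed.

End Green.

(** * The space L^2 *)

Section L2Theory.
Variables (R : realType) (M : ptopologicalType) (pi : probability (borel M) R).
Implicit Types (u v w : M -> R).

Lemma ae_mono (P Q : borel M -> Prop) : (forall x, P x -> Q x) ->
  {ae pi, forall x, P x} -> {ae pi, forall x, Q x}.
Proof. by move=> PQ; apply: filterS. Qed.

Lemma ae_and (P Q : borel M -> Prop) : {ae pi, forall x, P x} -> {ae pi, forall x, Q x} ->
  {ae pi, forall x, P x /\ Q x}.
Proof. by move=> aP aQ; apply: filterS2 aP aQ. Qed.

Lemma L2_measurable u : L2 pi u -> measurable_fun [set: borel M] (u : borel M -> R).
Proof. by move=> /sub_Lfun_mfun; rewrite inE. Qed.

Lemma L2_integrableM u v : L2 pi u -> L2 pi v ->
  pi.-integrable setT (EFin \o (fun x : borel M => u x * v x)).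
Proof. by move=> Lu Lv; apply/Lfun1_integrable; exact: Lfun2_mul_Lfun1. Qed.

Lemma L2_scaleD a u v : L2 pi u -> L2 pi v -> L2 pi (fun x => a * u x + v x).
Proof.
have [_ H] := @Lfun_submod_closed _ (borel M) R pi 2%:E (lee1n 2).
by move=> Lu Lv; exact: (H a u v Lu Lv).
Qed.

Lemma L2_cst (a : R) : L2 pi (fun=> a).
Proof. exact: Lfun_cst. Qed.

Lemma L2D u v : L2 pi u -> L2 pi v -> L2 pi (fun x => u x + v x).
Proof.
move=> Lu Lv; rewrite (_ : (fun=> _) = (fun x => 1 * u x + v x)); first exact: L2_scaleD.
by apply/funext => x; rewrite mul1r.
Qed.

Lemma L2Z a u : L2 pi u -> L2 pi (fun x => a * u x).
Proof.
move=> Lu; rewrite (_ : (fun=> _) = (fun x => a * u x + 0)); first exact: (L2_scaleD a Lu (L2_cst 0)).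
by apply/funext => x; rewrite addr0.
Qed.

Lemma L2N u : L2 pi u -> L2 pi (fun x => - u x).
Proof.
move=> /(L2Z (-1)); rewrite (_ : (fun=> _) = (fun x => - u x))//.
by apply/funext => x; rewrite mulN1r.
Qed.

Lemma L2B u v : L2 pi u -> L2 pi v -> L2 pi (fun x => u x - v x).
Proof. by move=> Lu /L2N; exact: L2D. Qed.

Lemma L2_sqr_integrable u : measurable_fun [set: borel M] (u : borel M -> R) ->
  pi.-integrable setT (EFin \o (fun x : borel M => u x ^+ 2)) -> L2 pi u.
Proof.
move=> mu /integrableP[_ iu]; rewrite /L2 inE; apply/andP; split; rewrite inE//=.
rewrite /finite_norm unlock poweR_lty//.
apply: le_lt_trans iu; rewrite le_eqVlt; apply/orP; left; apply/eqP.
apply: eq_integral => x _ /=; congr (_%:E).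
by rewrite powR_mulrn// real_normK ?num_real// ger0_norm ?sqr_ge0.
Qed.

Lemma bounded_integrable u C : measurable_fun [set: borel M] (u : borel M -> R) ->
  (forall x, `|u x| <= C) -> pi.-integrable setT (EFin \o (u : borel M -> R)).
Proof.
move=> mu uC; apply: (@le_integrable _ _ _ pi setT measurableT _ (EFin \o cst C)).
- exact/measurable_EFinP.
- by move=> x _ /=; rewrite lee_fin; apply: le_trans (uC x) _; exact: ler_norm.
- exact: finite_measure_integrable_cst.
Qed.

Lemma L2_bounded u C : measurable_fun [set: borel M] (u : borel M -> R) ->
  (forall x, `|u x| <= C) -> L2 pi u.
Proof.
move=> mu uC; apply: L2_sqr_integrable => //.
apply: (@bounded_integrable _ (C ^+ 2)); first exact: measurable_funX.
move=> x; rewrite normrX ler_pXn2r// ?nnegrE//; exact: le_trans (uC x).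
Qed.

Lemma dotL2C u v : dotL2 pi u v = dotL2 pi v u.
Proof. by apply: eq_Rintegral => x _; rewrite mulrC. Qed.

Lemma dotL2Dl u v w : L2 pi u -> L2 pi v -> L2 pi w ->
  dotL2 pi (fun x => u x + v x) w = dotL2 pi u w + dotL2 pi v w.
Proof.
move=> Lu Lv Lw; rewrite -RintegralD//; [|exact: L2_integrableM|exact: L2_integrableM].
by apply: eq_Rintegral => x _; rewrite mulrDl.
Qed.

Lemma dotL2Zl a u v : L2 pi u -> L2 pi v ->
  dotL2 pi (fun x => a * u x) v = a * dotL2 pi u v.
Proof.
move=> Lu Lv; rewrite -RintegralZl//; last exact: L2_integrableM.
by apply: eq_Rintegral => x _; rewrite mulrA.
Qed.

Lemma dotL2_ge0 u : 0 <= dotL2 pi u u.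
Proof. by apply: Rintegral_ge0 => x _; rewrite -expr2 sqr_ge0. Qed.

Lemma integral_ge0_eq0 u : (forall x, 0 <= u x) ->
  pi.-integrable setT (EFin \o (u : borel M -> R)) -> (\int[pi]_x u x <= 0)%R ->
  {ae pi, forall x, u x = 0}.
Proof.
move=> u0 iu iu0; have mu : measurable_fun setT (EFin \o (u : borel M -> R)) by case/integrableP : iu.
have : (\int[pi]_x `|(EFin \o (u : borel M -> R)) x| = 0)%E.
  transitivity ((\int[pi]_x u x)%:E)%R; last first.
    by congr (_%:E); apply/eqP; rewrite eq_le iu0/=; exact: Rintegral_ge0.
  rewrite /Rintegral fineK; last exact: integrable_fin_num.
  by apply: eq_integral => x _ /=; rewrite ger0_norm.
move=> /(ae_eq_integral_abs pi measurableT mu); apply: filterS => x /(_ I) /= H.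
by apply: EFin_inj.
Qed.

Lemma dotL2_eq0 u : L2 pi u -> dotL2 pi u u <= 0 -> {ae pi, forall x, u x = 0}.
Proof.
move=> Lu uu0; have := @integral_ge0_eq0 (fun x => u x * u x).
move=> /(_ _ (L2_integrableM Lu Lu) uu0) H.
have {}H := H (fun x => sqr_ge0 (u x)).
apply: (@ae_mono (fun x => u x * u x = 0)) H => x /eqP.
by rewrite mulf_eq0 orbb => /eqP.
Qed.

Lemma dotL2Nl u v : L2 pi u -> L2 pi v -> dotL2 pi (fun x => - u x) v = - dotL2 pi u v.
Proof.
move=> Lu Lv; rewrite -mulN1r -dotL2Zl//; apply: eq_Rintegral => x _.
by rewrite mulN1r.
Qed.

Lemma dotL2Bl u v w : L2 pi u -> L2 pi v -> L2 pi w ->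
  dotL2 pi (fun x => u x - v x) w = dotL2 pi u w - dotL2 pi v w.
Proof. by move=> Lu Lv Lw; rewrite dotL2Dl ?dotL2Nl//; exact: L2N. Qed.

Lemma dotL2Zr a u v : L2 pi u -> L2 pi v ->
  dotL2 pi v (fun x => a * u x) = a * dotL2 pi v u.
Proof. by move=> Lu Lv; rewrite dotL2C dotL2Zl// dotL2C. Qed.

Lemma ae_eq_dotL2 u v w : {ae pi, forall x, u x = v x} -> L2 pi u -> L2 pi v -> L2 pi w ->
  dotL2 pi u w = dotL2 pi v w.
Proof.
move=> uv Lu Lv Lw; rewrite /dotL2 /Rintegral; congr fine; apply: ae_eq_integral => //.
- by have /integrableP[] := L2_integrableM Lu Lw.
- by have /integrableP[] := L2_integrableM Lv Lw.
- by apply: (@ae_mono (fun x => u x = v x)) uv => x ->.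
Qed.

End L2Theory.

(** * Green's formula *)

Section CarreDuChamp.
Variables (R : realType) (d : nat) (M : ptopologicalType).
Variable g : riemannian R d M.
Implicit Types (f h : M -> R) (c : chart g) (x : M).

Local Notation coord := (@Defs.coord R d M g).
Local Notation patch := (@Defs.patch R d M g).
Local Notation Gamma f h := (vdot (grad g f) (grad g h)).

(** Differentiability at one point in one chart. Components of gradients depend on the chart, so
    [class_C] is not the right notion for them. *)
Definition pdiff c f x := differentiable (f \o point_of c) (coord c x).

Lemma class_on_pdiff c f x : class_on 1 (patch c) (f \o point_of c) -> dom c x -> pdiff c f x.
Proof. by move=> [df _] cx; apply: df; exact: patch_coord. Qed.

Lemma class_C_pdiff c f x : class_C g 1 f -> dom c x -> pdiff c f x.
Proof. by move=> /(_ c); exact: class_on_pdiff. Qed.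

Lemma partial_scaleD c i a f h x : pdiff c f x -> pdiff c h x ->
  partial c i (fun z => a * f z + h z) x = a * partial c i f x + partial c i h x.
Proof.
move=> df dh; rewrite /partial.
have df' := diff_derivable (v := delta_mx 0 i) df.
have dh' := diff_derivable (v := delta_mx 0 i) dh.
have E1 := @deriveZ R _ _ (f \o point_of c) a (coord c x) (delta_mx 0 i) df'.
have E2 := @deriveD R _ _ (a \*: (f \o point_of c)) (h \o point_of c) _ _ (@derivableZ R _ _ _ a _ _ df') dh'.
by rewrite E1 in E2; exact: E2.
Qed.

Lemma partial_mul c i f h x : pdiff c f x -> pdiff c h x -> dom c x ->
  partial c i (fun z => f z * h z) x = f x * partial c i h x + h x * partial c i f x.
Proof.
move=> df dh cx; rewrite /partial (deriveM (f := f \o point_of c) (g := h \o point_of c))/= ?coordK//;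
  exact: diff_derivable.
Qed.

Lemma partial_post c i (eta : R -> R) f x : pdiff c f x -> dom c x -> differentiable eta (f x) ->
  partial c i (eta \o f) x = eta^`()%classic (f x) * partial c i f x.
Proof.
move=> df cx eta1.
by rewrite /partial -[eta \o f \o _]/(eta \o (f \o point_of c)) derive_comp1/= ?coordK.
Qed.

Lemma grad_scaleD a f h c x : class_C g 1 f -> class_C g 1 h -> dom c x ->
  grad g (fun z => a * f z + h z) c x = a *: grad g f c x + grad g h c x.
Proof.
move=> f1 h1 cx; rewrite /grad scalemxAl -mulmxDl; congr (_ *m _).
by apply/rowP => i; rewrite !mxE partial_scaleD//; [exact: (class_C_pdiff f1 cx)|exact: (class_C_pdiff h1 cx)].
Qed.

Lemma grad_post (eta : R -> R) f c x : class_C g 1 f -> dom c x -> differentiable eta (f x) ->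
  grad g (eta \o f) c x = eta^`()%classic (f x) *: grad g f c x.
Proof.
move=> f1 cx deta; rewrite /grad scalemxAl; congr (_ *m _).
by apply/rowP => i; rewrite !mxE partial_post//; exact: (class_C_pdiff f1 cx).
Qed.

Lemma dom_chart_at x : dom (chart_at g x) x.
Proof. by rewrite /chart_at; case: cid. Qed.

Lemma vdot_grad_post (X : field g) (eta : R -> R) f x : class_C g 1 f -> differentiable eta (f x) ->
  vdot X (grad g (eta \o f)) x = eta^`()%classic (f x) * vdot X (grad g f) x.
Proof.
move=> f1 deta; rewrite /vdot grad_post//; last exact: dom_chart_at.
by rewrite linearZ/= -scalemxAr mxE.
Qed.

Lemma vdot_grad_scaleD (X : field g) a f h x : class_C g 1 f -> class_C g 1 h ->
  vdot X (grad g (fun z => a * f z + h z)) x = a * vdot X (grad g f) x + vdot X (grad g h) x.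
Proof.
move=> f1 h1; rewrite /vdot grad_scaleD//; last exact: dom_chart_at.
by rewrite linearP/= mulmxDr -scalemxAr mxE; congr (_ + _); rewrite mxE.
Qed.

Lemma GammaC f h : class_C g 1 f -> class_C g 1 h -> Gamma f h = Gamma h f.
Proof. by move=> f1 h1; apply: vdotC; exact: grad_vector_field. Qed.

Lemma smooth_scaleD a f h : smooth g f -> smooth g h -> smooth g (fun x => a * f x + h x).
Proof.
by move=> fs hs k; apply: class_CD; [apply: class_CM; [exact: class_C_cst|exact: fs]|exact: hs].
Qed.

Lemma smooth_cst a : smooth g (fun=> a).
Proof. by move=> k; exact: class_C_cst. Qed.

Lemma smoothB f h : smooth g f -> smooth g h -> smooth g (fun x => f x - h x).
Proof. by move=> fs hs k; apply: class_CD; [exact: fs|apply: class_CN; exact: hs]. Qed.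

Lemma smooth_sigmoid f : smooth g f -> smooth g (@sigmoid R \o f).
Proof. by move=> fs k c; exact: (class_on_sigmoid (@patch_open _ _ _ g c) (fs k c)). Qed.

Lemma smooth_continuous f : smooth g f -> continuous f.
Proof. by move=> fs; exact: (class_C_continuous (fs 0)). Qed.

Definition flux c f i z : R := dens c z * grad g f c z 0 i.

Lemma flux_pdiff c f i x : class_C g 2 f -> dom c x -> pdiff c (flux c f i) x.
Proof.
move=> f2 cx; apply: class_on_pdiff => //.
exact: (class_onM (@patch_open _ _ _ g c) (class_on_dens c) (class_on_grad c i f2)).
Qed.

Lemma near_domP c x (P : M -> Prop) : dom c x -> (forall z, dom c z -> P z) -> \forall z \near x, P z.
Proof.
by move=> cx cP; apply: filterS (open_nbhs_nbhs (conj (@dom_open _ _ _ g c) cx)) => z /cP.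
Qed.

Lemma is_laplacian_scaleD a f h Lf Lh : smooth g f -> smooth g h ->
  is_laplacian g f Lf -> is_laplacian g h Lh ->
  is_laplacian g (fun x => a * f x + h x) (fun x => a * Lf x + Lh x).
Proof.
move=> fs hs Lff Lhh c x cx; rewrite (Lff c x cx) (Lhh c x cx) mulrCA -mulrDr; congr (_ * _).
rewrite mulr_sumr -big_split/=; apply: eq_bigr => i _.
rewrite -(@partial_scaleD c i a (flux c f i) (flux c h i)); [|exact: (flux_pdiff i (fs 2) cx)|exact: (flux_pdiff i (hs 2) cx)].
apply: partial_near => //; apply: near_domP cx _ => z cz.
by rewrite (grad_scaleD a (fs 1) (hs 1) cz) [X in _ = _ * X]mxE [X in _ = _ * (X + _)]mxE /flux; ring.
Qed.

(** A Laplacian has to be exhibited for all charts together. The chain rule gives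
    [eta' Lf + eta'' |grad f|^2], which does not refer to a chart, so [eta o f] inherits a Laplacian
    from [f]. *)
Lemma is_laplacian_post (eta eta1 eta2 : R -> R) f Lf :
  (forall s : R, is_derive s (1 : R) eta (eta1 s)) -> (forall s : R, is_derive s (1 : R) eta1 (eta2 s)) ->
  smooth g f -> is_laplacian g f Lf ->
  is_laplacian g (eta \o f) (fun x => eta1 (f x) * Lf x + eta2 (f x) * Gamma f f x).
Proof.
move=> e1 e2 fs Lff c x cx; have f1 := fs 1; have f2 := fs 2.
have deta s : differentiable eta s by apply/derivable1_diffP; have [] := e1 s.
have deta1 s : differentiable eta1 s by apply/derivable1_diffP; have [] := e2 s.
have eE s : eta^`()%classic s = eta1 s by rewrite derive1E; have [_ ->] := e1 s.
have eE1 s : eta1^`()%classic s = eta2 s by rewrite derive1E; have [_ ->] := e2 s.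
rewrite (Lff c x cx) (vdot_gradr (grad_vector_field f1) f1 cx).
have d0 := dens_gt0 cx.
rewrite mulrCA -[X in _ + X](mulKf (lt0r_neq0 d0)) -mulrDr; congr (_ * _).
rewrite !mulr_sumr -big_split/=; apply: eq_bigr => i _.
have -> : partial c i (fun z => dens c z * grad g (eta \o f) c z 0 i) x =
          partial c i (fun z => (eta1 \o f) z * flux c f i z) x.
  apply: partial_near => //; apply: near_domP cx _ => z cz.
  by rewrite grad_post// mxE eE /flux/=; ring.
rewrite (@partial_mul c i (eta1 \o f) (flux c f i) x)//; last 2 first.
- apply: (@differentiable_comp _ _ _ _ (f \o point_of c) eta1); last exact: deta1.
  exact: (class_C_pdiff f1 cx).
- exact: (flux_pdiff i f2 cx).
rewrite (@partial_post c i eta1 f x)//; last exact: (class_C_pdiff f1 cx).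
by rewrite eE1 /flux/=; ring.
Qed.

End CarreDuChamp.

(** * Green's formula on the manifold *)

Section GlobalGreen.
Variables (R : realType) (d : nat) (M : ptopologicalType).
Hypotheses (hM : hausdorff_space M) (cM : compact [set: M]).
Variable g : riemannian R d M.
Variable vol : {measure set (borel M) -> \bar R}.
Hypothesis hvol : is_volume g vol.
Variable U : M -> R.
Hypothesis hU : class_C g 1 U.
Variable pi : probability (borel M) R.
Hypothesis hpi : forall S : set (borel M), measurable S ->
    pi S = (\int[vol]_(x in S) (expR (- U x))%:E)%E.
Implicit Types (f h u w : M -> R) (c : chart g) (x : M).

Local Notation Gamma f h := (vdot (grad g f) (grad g h)).

Lemma continuous_bounded f : continuous f -> exists C, forall x, `|f x| <= C.
Proof.
move=> cf; have /compact_bounded[C [_ fC]] : compact (f @` [set: M]).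
  by apply: continuous_compact => //; exact: continuous_subspaceT.
by exists (C + 1) => x; apply: (fC (C + 1)); [rewrite ltrDl|exists x].
Qed.

Lemma continuous_integrable f : continuous f -> pi.-integrable setT (EFin \o (f : borel M -> R)).
Proof.
move=> cf; have [C fC] := continuous_bounded cf.
by apply: bounded_integrable fC; exact: borel_continuousR.
Qed.

Lemma continuous_L2 f : continuous f -> L2 pi f.
Proof.
move=> cf; have [C fC] := continuous_bounded cf.
by apply: L2_bounded fC; exact: borel_continuousR.
Qed.

Lemma Gamma_continuous f h : smooth g f -> smooth g h -> continuous (Gamma f h).
Proof. by move=> fs hs; apply: vdot_grad_continuous; [exact: fs|exact: hs]. Qed.

(** In the product rule, the derivative of [e^-U] produces the drift term [- grad U . grad f]. *)
Lemma chart_generatorE c f w x : smooth g f -> pre_generator g U f w -> dom c x ->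
  chart_generator U c f x = w x.
Proof.
move=> fs [_ [Lf Lff ->]] cx; have f1 := fs 1; have f2 := fs 2.
rewrite /chart_generator; case: pselect => //= _.
rewrite (Lff c x cx) (vdotC (grad_vector_field hU) (grad_vector_field f1)).
rewrite (vdot_gradr (grad_vector_field f1) hU cx).
have e0 : expR (- U x) != 0 by rewrite gt_eqF// expR_gt0.
have d0 : dens c x != 0 by rewrite gt_eqF// dens_gt0.
have dU : pdiff c (fun z => - U z) x by apply: class_C_pdiff cx; exact: class_CN.
have dexp t : differentiable (expR : R -> R) t by apply/derivable1_diffP; exact: derivable_expR.
have E i : partial c i (fun z => weight U c z * grad g f c z 0 i) x =
   expR (- U x) * partial c i (flux c f i) x - flux c f i x * expR (- U x) * partial c i U x.
  have -> : partial c i (fun z => weight U c z * grad g f c z 0 i) x =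
            partial c i (fun z => (expR \o (fun z => - U z)) z * flux c f i z) x.
    by congr (partial c i _ x); apply/funext => z; rewrite /weight /flux /= mulrA.
  rewrite (@partial_mul _ _ _ _ c i (expR \o (fun z => - U z)) (flux c f i) x)//; last 2 first.
  - exact: (@differentiable_comp _ _ _ _ ((fun z => - U z) \o point_of c) expR _ dU (dexp _)).
  - exact: (flux_pdiff i f2 cx).
  rewrite (@partial_post _ _ _ _ c i expR (fun z => - U z) x)// derive1_expR.
  have -> : partial c i (fun z => - U z) x = - partial c i U x.
    have := @partial_scaleD _ _ _ _ c i (-1) U (fun=> 0) x (class_C_pdiff hU cx)
      (class_C_pdiff (@class_C_cst _ _ _ g 1 0) cx).
    rewrite partial_cst addr0 mulN1r => <-; congr (partial c i _ x).
    by apply/funext => z; rewrite mulN1r addr0.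
  by rewrite /=; ring.
under eq_bigr do rewrite E.
rewrite sumrB mulrBr; congr (_ - _).
  by rewrite -mulr_sumr /weight; field; rewrite e0 d0.
rewrite mulr_sumr; apply: eq_bigr => i _; rewrite /weight /flux; field; by rewrite e0 d0.
Qed.

Lemma Gamma_sumr (I : Type) (r : seq I) (F : I -> M -> R) f x :
  (forall i, class_C g 1 (F i)) ->
  Gamma f (fun z => \sum_(i <- r) F i z) x = \sum_(i <- r) Gamma f (F i) x.
Proof.
move=> F1; elim: r => [|i r IH].
  rewrite big_nil; have -> : (fun z => \sum_(i <- [::]) F i z) = (fun=> 0) :> (M -> R).
    by apply/funext => z; rewrite big_nil.
  have g0 : grad g (fun=> 0) (chart_at g x) x = 0.
    rewrite /grad -[RHS](mul0mx _ (invmx (gram (chart_at g x) x))); congr (_ *m _).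
    by apply/rowP => i; rewrite !mxE partial_cst.
  by rewrite /vdot g0 trmx0 mulmx0 mxE.
rewrite big_cons -IH; have -> : (fun z => \sum_(j <- i :: r) F j z) =
   (fun z => 1 * F i z + \sum_(j <- r) F j z).
  by apply/funext => z; rewrite big_cons mul1r.
rewrite (vdot_grad_scaleD _ 1 x (F1 i) (class_C_sum r F1)); by rewrite mul1r.
Qed.

Lemma continuous_sum (I : Type) (r : seq I) (F : I -> M -> R) :
  (forall i, continuous (F i)) -> continuous (fun x => \sum_(i <- r) F i x).
Proof.
move=> cF; elim: r => [|i r IH].
  rewrite (_ : (fun=> _) = (fun=> 0)); first exact: cst_continuous.
  by apply/funext => x; rewrite big_nil.
rewrite (_ : (fun=> _) = (fun x => F i x + \sum_(j <- r) F j x)); last first.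
  by apply/funext => x; rewrite big_cons.
by move=> x; apply: continuousD; [exact: cF|exact: IH].
Qed.

Lemma Rintegral_sum_eq0 (I : Type) (r : seq I) (F : I -> M -> R) :
  (forall i, continuous (F i)) -> (forall i, \int[pi]_x F i x = 0)%R ->
  (\int[pi]_x (\sum_(i <- r) F i x) = 0)%R.
Proof.
move=> cF F0; elim: r => [|i r IH].
  transitivity (\int[pi]_(x in [set: borel M]) (0 : R))%R.
    by apply: eq_Rintegral => x _; rewrite big_nil.
  by rewrite Rintegral_cst ?mul0r.
transitivity (\int[pi]_x (F i x + \sum_(j <- r) F j x))%R.
  by apply: eq_Rintegral => x _; rewrite big_cons.
rewrite RintegralD//; first by rewrite F0 IH addr0.
- exact: continuous_integrable.
- by apply: continuous_integrable; exact: continuous_sum.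
Qed.

(** [w] glues the chart expressions of the operator with the normalised bumps, which makes sense for
    every smooth [f]. If [f] is in the domain of [pre_generator], all chart expressions agree with
    its image [w0]; since the bumps add up to 1, so does [w]. *)
Lemma green f : smooth g f -> exists w, [/\ continuous w,
  (forall h, smooth g h -> energy g pi f h = - dotL2 pi w h) &
  (forall w0, pre_generator g U f w0 -> w0 = w)].
Proof.
move=> fs; have f2 := fs 2.
have [J [r [c [K [T [bT T0]]]]]] := exists_bump_cover g hM cM.
pose S x := \sum_(j <- r) T j x.
have S1 : class_C g 1 S.
  by apply: class_C_sum => j; have [Tj1 _ _ _ _] := bT j.
have Sn0 x : S x != 0 by rewrite gt_eqF// T0.
have Si1 := class_C_inv Sn0 S1.
pose w x := \sum_(j <- r) chart_generator U (c j) f x * (T j x * (S x)^-1).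
have cterm h j : class_C g 1 h -> continuous (fun x => chart_generator U (c j) f x * (T j x * h x)).
  move=> h1; have [Tj1 _ cK Kc Tj0] := bT j.
  apply: (vanishing_outside_continuous hM cK Kc) => [x Kx|x cx]; first by rewrite Tj0// mul0r mulr0.
  apply: (@continuousM _ _ (chart_generator U (c j) f) (fun x => T j x * h x)).
    exact: chart_generator_continuous.
  exact: (class_C_continuous (class_CM Tj1 h1)).
have cw : continuous w by apply: continuous_sum => j; exact: cterm.
exists w; split => // [h hs|w0 fw0].
  (* The functions [T j * h'] add up to [h], and each vanishes outside a compact subset of one chart
     domain, so that [chart_green] applies to it. *)
  pose h' x := h x * (S x)^-1.
  have h'1 : class_C g 1 h' by exact: (class_CM (hs 1) Si1).
  have Th1 j : class_C g 1 (fun x => T j x * h' x).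
    by have [Tj1 _ _ _ _] := bT j; exact: (class_CM Tj1 h'1).
  pose q j x := Gamma f (fun x => T j x * h' x) x + chart_generator U (c j) f x * (T j x * h' x).
  have cq j : continuous (q j).
    move=> x; apply: (@continuousD _ _ _ (Gamma f (fun x => T j x * h' x))).
      exact: (vdot_grad_continuous f2 (Th1 j)).
    exact: (cterm h' j h'1 x).
  have q0 j : (\int[pi]_x q j x = 0)%R.
    have [_ _ cK Kc Tj0] := bT j.
    rewrite /Rintegral (chart_green hM hvol hU hpi f2 (Th1 j) cK Kc)// => x Kx.
    by rewrite Tj0// mul0r.
  have Eh : h = fun x => \sum_(j <- r) T j x * h' x.
    by apply/funext => x; rewrite -mulr_suml -/(S x) /h' mulrCA divff ?mulr1// Sn0.
  have cwh : continuous (fun x : M => w x * h x).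
    by move=> x; apply: cvgM; [exact: cw|exact: (smooth_continuous hs)].
  apply/eqP; rewrite -addr_eq0; apply/eqP.
  rewrite /energy /dotL2 -RintegralD//; last 2 first.
  - by apply: continuous_integrable; exact: Gamma_continuous.
  - exact: (continuous_integrable cwh).
  rewrite -(Rintegral_sum_eq0 r cq q0); apply: eq_Rintegral => x _.
  rewrite [in LHS]Eh (Gamma_sumr r f x Th1) /q big_split/=; congr (_ + _).
  rewrite /w mulr_suml; apply: eq_bigr => j _.
  by rewrite -mulr_suml -/(S x) /h'; field; exact: Sn0.
apply/funext => x; rewrite /w (eq_bigr (fun j => w0 x * (T j x * (S x)^-1))).
  by rewrite -mulr_sumr -mulr_suml -/(S x) divff ?mulr1.
move=> j _; have [_ _ _ Kc Tj0] := bT j.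
have [cx|cx] := pselect (dom (c j) x); first by rewrite (chart_generatorE fs fw0 cx).
by rewrite Tj0 ?mul0r ?mulr0// => /Kc.
Qed.

End GlobalGreen.

(** * Closable forms *)

Section SemiInnerProduct.
Variables (R : realType) (X : Type) (P : (X -> R) -> Prop) (B : (X -> R) -> (X -> R) -> R).
Hypothesis P_scaleD : forall a f h, P f -> P h -> P (fun x => a * f x + h x).
Hypothesis B_sym : forall f h, P f -> P h -> B f h = B h f.
Hypothesis B_scaleDr : forall a f h k, P f -> P h -> P k ->
  B k (fun x => a * f x + h x) = a * B k f + B k h.
Hypothesis B_ge0 : forall f, P f -> 0 <= B f f.

(** Functions are not identified almost everywhere, so a predicate [P] closed under [a f + h] takes
    the place of a vector space. The instances are [dotL2] on [L2], [energy] on smooth functions,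
    and the closed form on the closure of the latter. *)
Definition seminorm f := Num.sqrt (B f f).

Let subE (f h : X -> R) : (fun x => f x - h x) = (fun x => -1 * h x + f x).
Proof. by apply/funext => x; rewrite mulN1r addrC. Qed.

Lemma sip_P_sub f h : P f -> P h -> P (fun x => f x - h x).
Proof. by move=> Pf Ph; rewrite subE; exact: P_scaleD. Qed.

Lemma sip_subr f h k : P f -> P h -> P k -> B k (fun x => f x - h x) = B k f - B k h.
Proof. by move=> Pf Ph Pk; rewrite subE B_scaleDr// mulN1r addrC. Qed.

Lemma sip_subl f h k : P f -> P h -> P k -> B (fun x => f x - h x) k = B f k - B h k.
Proof.
by move=> Pf Ph Pk; rewrite B_sym ?sip_subr// ?(B_sym Pk)//; exact: sip_P_sub.
Qed.

Lemma sip_scaleDl a f h k : P f -> P h -> P k ->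
  B (fun x => a * f x + h x) k = a * B f k + B h k.
Proof.
by move=> Pf Ph Pk; rewrite B_sym ?B_scaleDr// ?(B_sym Pk)//; exact: P_scaleD.
Qed.

Lemma seminorm_ge0 f : 0 <= seminorm f.
Proof. exact: sqrtr_ge0. Qed.

Lemma sqr_seminorm f : P f -> seminorm f ^+ 2 = B f f.
Proof. by move=> Pf; rewrite sqr_sqrtr// B_ge0. Qed.

Lemma sip_cauchy_schwarz f h : P f -> P h -> `|B f h| <= seminorm f * seminorm h.
Proof.
move=> Pf Ph; set a := B f f; set b := B f h; set c := B h h.
have H t : 0 <= t ^+ 2 * c + 2 * t * b + a.
  have -> : t ^+ 2 * c + 2 * t * b + a = B (fun x => t * h x + f x) (fun x => t * h x + f x).
    have Pt := P_scaleD t Ph Pf.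
    by rewrite B_scaleDr// !sip_scaleDl// (B_sym Ph Pf) /a /b /c; ring.
  by apply: B_ge0; exact: P_scaleD.
have a0 : 0 <= a by exact: B_ge0.
have c0 : 0 <= c by exact: B_ge0.
rewrite -sqrtrM// -/a -/c -sqrtr_sqr ler_wsqrtr//.
have [c_eq0|cn0] := eqVneq c 0.
  have [->|bn0] := eqVneq b 0; first by rewrite expr0n/= mulr_ge0.
  (* For [c = 0] the quadratic is affine in [t], and it takes the value -1 at this point. *)
  have := H (- (a + 1) / (2 * b)); rewrite c_eq0 mulr0 add0r.
  have -> : 2 * (- (a + 1) / (2 * b)) * b = - (a + 1) by field.
  lra.
(* The minimiser of the quadratic. *)
have := H (- b / c); have cp : 0 < c by rewrite lt_def cn0.
have -> : (- b / c) ^+ 2 * c + 2 * (- b / c) * b + a = (a * c - b ^+ 2) / c by field.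
by rewrite pmulr_lge0 ?invr_gt0// subr_ge0.
Qed.

Lemma seminorm_triangle f h : P f -> P h -> seminorm f <= seminorm (fun x => f x - h x) + seminorm h.
Proof.
move=> Pf Ph; have Pk := sip_P_sub Pf Ph; set k := fun x => f x - h x.
have s0 := seminorm_ge0; rewrite -ler_sqr ?nnegrE ?addr_ge0//.
have E : B f f = B k k + 2 * B k h + B h h.
  have -> : B k k = B f f - 2 * B f h + B h h.
    by rewrite {2}/k sip_subr// !sip_subl// (B_sym Ph Pf); ring.
  by rewrite /k sip_subl//; ring.
rewrite sqrrD !sqr_seminorm// E.
have := le_trans (ler_norm _) (sip_cauchy_schwarz Pk Ph).
by rewrite -/k; lra.
Qed.

Lemma seminorm_subC f h : P f -> P h -> seminorm (fun x => f x - h x) = seminorm (fun x => h x - f x).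
Proof.
move=> Pf Ph; rewrite /seminorm; congr Num.sqrt.
have P1 := sip_P_sub Pf Ph; have P2 := sip_P_sub Ph Pf.
by rewrite !sip_subr// !sip_subl//; ring.
Qed.

Lemma seminorm_triangle_sub f h k : P f -> P h -> P k ->
  seminorm (fun x => f x - h x) <= seminorm (fun x => f x - k x) + seminorm (fun x => k x - h x).
Proof.
move=> Pf Ph Pk.
have := seminorm_triangle (sip_P_sub Pf Ph) (sip_P_sub Pk Ph).
by under [X in seminorm X + _]eq_fun do rewrite opprB addrA subrK.
Qed.

Lemma seminorm_le_sqr f e : P f -> 0 <= e -> (seminorm f <= e) = (B f f <= e ^+ 2).
Proof. by move=> Pf e0; rewrite -ler_sqr ?nnegrE ?seminorm_ge0// sqr_seminorm. Qed.

Lemma sip_P0 k : P k -> P (fun=> 0).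
Proof.
move=> Pk; rewrite (_ : (fun=> 0) = (fun x => -1 * k x + k x)); first exact: P_scaleD.
by apply/funext => x; rewrite mulN1r addNr.
Qed.

Lemma sip_0r k : P k -> B k (fun=> 0) = 0.
Proof.
move=> Pk; rewrite (_ : (fun=> 0) = (fun x => -1 * k x + k x)); last first.
  by apply/funext => x; rewrite mulN1r addNr.
by rewrite B_scaleDr// mulN1r addNr.
Qed.

Lemma sip_P_sum (I : Type) (r : seq I) (a : I -> R) (F : I -> X -> R) k :
  P k -> (forall i, P (F i)) -> P (fun x => \sum_(i <- r) a i * F i x).
Proof.
move=> Pk PF; elim: r => [|i r IH].
  by rewrite (_ : (fun=> _) = (fun=> 0)); [exact: sip_P0 Pk|apply/funext => x; rewrite big_nil].
rewrite (_ : (fun=> _) = (fun x => a i * F i x + \sum_(j <- r) a j * F j x)); first exact: P_scaleD.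
by apply/funext => x; rewrite big_cons.
Qed.

Lemma sip_sumr (I : Type) (r : seq I) (a : I -> R) (F : I -> X -> R) k :
  P k -> (forall i, P (F i)) ->
  B k (fun x => \sum_(i <- r) a i * F i x) = \sum_(i <- r) a i * B k (F i).
Proof.
move=> Pk PF; elim: r => [|i r IH].
  rewrite [RHS]big_nil -[RHS](sip_0r Pk); congr (B k _).
  by apply/funext => x; rewrite big_nil.
rewrite big_cons -IH -B_scaleDr//; last exact: sip_P_sum Pk _.
by congr (B k _); apply/funext => x; rewrite big_cons.
Qed.

End SemiInnerProduct.

Lemma cvgn_leP (R : realType) (u : nat -> R) (l : R) :
  (u @ \oo --> l) <-> (forall e, 0 < e -> exists N, forall n, (N <= n)%N -> `|u n - l| <= e).
Proof.
split.
  move=> /cvgrPdist_le H e /H [N _ HN]; exists N => n Nn.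
  by rewrite distrC; exact: HN.
move=> H; apply/cvgrPdist_le => e /H[N HN]; exists N => // n Nn.
by rewrite distrC; exact: HN.
Qed.

Lemma cauchy_cvgn (R : realType) (u : nat -> R) :
  (forall e, 0 < e -> exists N, forall n m, (N <= n)%N -> (N <= m)%N -> `|u n - u m| <= e) ->
  exists l : R, u @ \oo --> l.
Proof.
move=> H; suff /cvg_ex[l ul] : cvg (u @ \oo) by exists l.
apply/cauchy_cvgP/cauchy_exP => e e0; have e2 : 0 < e / 2 by rewrite divr_gt0.
have [N HN] := H _ e2; exists (u N); exists N => // n Nn /=.
rewrite -ball_normE/=; apply: le_lt_trans (HN _ _ (leqnn N) Nn) _.
by rewrite ltr_pdivrMr// mulr2n mulrDr mulr1 ltrDl.
Qed.

(** * The L^2 seminorm *)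

Section L2Sip.
Variables (R : realType) (M : ptopologicalType) (pi : probability (borel M) R).
Implicit Types (u v w : M -> R) (f : nat -> M -> R).

Local Notation nL := (seminorm (dotL2 pi)).

Let Lsc : forall a u v, L2 pi u -> L2 pi v -> L2 pi (fun x => a * u x + v x).
Proof. by move=> a u v; exact: L2_scaleD. Qed.

Let dsym : forall u v, L2 pi u -> L2 pi v -> dotL2 pi u v = dotL2 pi v u.
Proof. by move=> u v _ _; exact: dotL2C. Qed.

Lemma dotL2_scaleDr a u v w : L2 pi u -> L2 pi v -> L2 pi w ->
  dotL2 pi w (fun x => a * u x + v x) = a * dotL2 pi w u + dotL2 pi w v.
Proof.
move=> Lu Lv Lw; rewrite dotL2C dotL2Dl//; last exact: L2Z.
by rewrite dotL2Zl// !(dotL2C pi w).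
Qed.

Let dge0 : forall u, L2 pi u -> 0 <= dotL2 pi u u.
Proof. by move=> u _; exact: dotL2_ge0. Qed.

Definition nL_triangle := seminorm_triangle Lsc dsym dotL2_scaleDr dge0.
Definition nL_subC := seminorm_subC Lsc dsym dotL2_scaleDr.
Definition nL_triangle_sub := seminorm_triangle_sub Lsc dsym dotL2_scaleDr dge0.
Definition nL_le_sqr := seminorm_le_sqr dge0.
Definition sqr_nL := sqr_seminorm dge0.

Lemma cvgL2P f u : cvgL2 pi f u <-> [/\ forall n, L2 pi (f n), L2 pi u &
  forall e, 0 < e -> exists N, forall n, (N <= n)%N -> nL (fun x => f n x - u x) <= e].
Proof.
split => -[Lf Lu H]; split => //.
  move=> e e0; have e20 : 0 < e ^+ 2 by rewrite exprn_gt0.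
  have [N HN] := (cvgn_leP _ _).1 H _ e20; exists N => n /HN.
  rewrite subr0 ger0_norm ?dotL2_ge0// => h.
  by rewrite nL_le_sqr ?(ltW e0)//; exact: L2B.
apply/cvgn_leP => e e0; have se0 : 0 < Num.sqrt e by rewrite sqrtr_gt0.
have [N HN] := H _ se0; exists N => n /HN.
rewrite subr0 ger0_norm ?dotL2_ge0//.
by rewrite nL_le_sqr ?sqrtr_ge0// ?sqr_sqrtr ?(ltW e0)//; exact: L2B.
Qed.

Lemma nL_eq0 u : L2 pi u -> (forall e, 0 < e -> nL u <= e) -> {ae pi, forall x, u x = 0}.
Proof.
move=> Lu H; apply: dotL2_eq0 => //; rewrite -sqr_nL//.
have -> : nL u = 0.
  apply/eqP; rewrite eq_le sqrtr_ge0 andbT; apply/ler_addgt0Pl => e e0.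
  by rewrite addr0; exact: H.
by rewrite expr0n.
Qed.

Lemma nL_le u v C : L2 pi u -> L2 pi v -> 0 <= C -> (forall x, `|u x| <= C * `|v x|) ->
  nL u <= C * nL v.
Proof.
move=> Lu Lv C0 uv; rewrite nL_le_sqr ?mulr_ge0 ?sqrtr_ge0// exprMn sqr_nL//.
rewrite -RintegralZl//; last exact: L2_integrableM.
apply: le_Rintegral => //; first exact: L2_integrableM.
  have := L2_integrableM (L2Z (C ^+ 2) Lv) Lv; apply: eq_integrable => // x _ /=.
  by rewrite mulrA.
move=> x _; rewrite -!expr2 -[u x ^+ 2]ger0_norm ?sqr_ge0// normrX.
rewrite -[v x ^+ 2]ger0_norm ?sqr_ge0// normrX -exprMn.
by rewrite ler_pXn2r// nnegrE ?mulr_ge0.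
Qed.

End L2Sip.

Lemma cvgn_le_lim (R : realType) (f : nat -> R) (l c : R) (N : nat) :
  f @ \oo --> l -> (forall n, (N <= n)%N -> c <= f n) -> c <= l.
Proof.
move=> /cvgn_leP fl cf; apply/ler_addgt0Pl => e e0; have [N' HN] := fl e e0.
have := cf _ (leq_maxl N N'); have := HN _ (leq_maxr N N').
by rewrite ler_norml => /andP[_]; lra.
Qed.

Lemma cvgn_lim_le (R : realType) (f : nat -> R) (l c : R) (N : nat) :
  f @ \oo --> l -> (forall n, (N <= n)%N -> f n <= c) -> l <= c.
Proof.
move=> fl cf; rewrite -lerN2; apply: (cvgn_le_lim (cvgN fl) (N := N)) => n Nn /=.
by rewrite lerN2 cf.
Qed.

(** * Closure of a form and Friedrichs extension, in the abstract *)

Section ClosableForm.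
Variables (R : realType) (X : Type).
Implicit Types (a e l : R) (h k u v w y z : X -> R) (f : nat -> X -> R).
(** [L] and [D] stand for L^2 with its inner product, [Sm] and [E] for the smooth functions with the
    energy. Green's formula appears twice among the hypotheses: [green_ex] for all of [Sm], which
    makes the form closable, and [gen_green] for the operator, which ties the form to it. *)
Variables (L Sm : (X -> R) -> Prop) (D E : (X -> R) -> (X -> R) -> R).
Variable gen : (X -> R) -> (X -> R) -> Prop.
Hypothesis Lsc : forall a h k, L h -> L k -> L (fun x => a * h x + k x).
Hypothesis Dsym : forall h k, L h -> L k -> D h k = D k h.
Hypothesis Dsc : forall a h k z, L h -> L k -> L z ->
  D z (fun x => a * h x + k x) = a * D z h + D z k.
Hypothesis Dge0 : forall h, L h -> 0 <= D h h.
Hypothesis Ssc : forall a h k, Sm h -> Sm k -> Sm (fun x => a * h x + k x).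
Hypothesis Esym : forall h k, Sm h -> Sm k -> E h k = E k h.
Hypothesis Esc : forall a h k z, Sm h -> Sm k -> Sm z ->
  E z (fun x => a * h x + k x) = a * E z h + E z k.
Hypothesis Ege0 : forall h, Sm h -> 0 <= E h h.
Hypothesis SL : forall h, Sm h -> L h.
Hypothesis green_ex : forall h, Sm h -> exists2 w, L w & forall k, Sm k -> E h k = - D w k.
Hypothesis gen_green : forall h w, gen h w ->
  [/\ Sm h, L w & forall k, Sm k -> E h k = - D w k].
Hypothesis gen_sc : forall a h k w z, gen h w -> gen k z ->
  exists y, gen (fun x => a * h x + k x) y.

Local Notation nD := (seminorm D).
Local Notation nE := (seminorm E).

Let D_cs := sip_cauchy_schwarz Lsc Dsym Dsc Dge0.
Let nD_tri_sub := seminorm_triangle_sub Lsc Dsym Dsc Dge0.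
Let E_cs := sip_cauchy_schwarz Ssc Esym Esc Ege0.
Let nE_tri := seminorm_triangle Ssc Esym Esc Ege0.
Let nE_subC := seminorm_subC Ssc Esym Esc.
Let Lsub h k (Lh : L h) (Lk : L k) := sip_P_sub Lsc Lh Lk.
Let Ssub h k (Sh : Sm h) (Sk : Sm k) := sip_P_sub Ssc Sh Sk.

(** In the abstract setting [L] may be empty, and then nothing is known of [D] at 0. *)
Let nD0 : nD (fun=> 0) = 0 \/ forall h, ~ L h.
Proof.
have [[h Lh]|H] := pselect (exists h, L h); last by right => h Lh; apply: H; exists h.
by left; rewrite /seminorm (sip_0r Dsc (sip_P0 Lsc Lh)) sqrtr0.
Qed.

Definition strong_cvg f u := [/\ forall n, L (f n), L u &
  forall e, 0 < e -> exists N, forall n, (N <= n)%N -> nD (fun x => f n x - u x) <= e].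

Definition form_closure f u := [/\ forall n, Sm (f n), strong_cvg f u &
  forall e, 0 < e -> exists N, forall n m, (N <= n)%N -> (N <= m)%N ->
    nE (fun x => f n x - f m x) <= e].

(** Written in the shape of [dotH1], which becomes an instance of it. *)
Definition closed_form u v : R :=
  xget 0 [set r | exists f (h : nat -> X -> R), [/\ form_closure f u, form_closure h v &
     (fun n => E (f n) (h n)) @ \oo --> r]].

Local Notation Q := closed_form.

Lemma seminorm_scaleD (B : (X -> R) -> (X -> R) -> R) (P : (X -> R) -> Prop)
   (Psc : forall a h k, P h -> P k -> P (fun x => a * h x + k x))
   (Bsym : forall h k, P h -> P k -> B h k = B k h)
   (Bsc : forall a h k z, P h -> P k -> P z -> B z (fun x => a * h x + k x) = a * B z h + B z k)
   (Bge0 : forall h, P h -> 0 <= B h h) a h k : P h -> P k ->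
  seminorm B (fun x => a * h x + k x) <= `|a| * seminorm B h + seminorm B k.
Proof.
move=> Ph Pk; have Pak := Psc a _ _ Ph Pk.
apply: le_trans (seminorm_triangle Psc Bsym Bsc Bge0 Pak Pk) _.
rewrite lerD2r (_ : (fun x => _ - k x) = (fun x => a * h x + 0)); last first.
  by apply/funext => x; rewrite addrK addr0.
have P0 := sip_P0 Psc Ph; have Pa := Psc a _ _ Ph P0.
rewrite (seminorm_le_sqr Bge0) ?mulr_ge0 ?seminorm_ge0// exprMn (sqr_seminorm Bge0 Ph).
rewrite Bsc// (sip_0r Bsc Pa) addr0 Bsym// Bsc// (sip_0r Bsc Ph) addr0 mulrA -expr2.
by rewrite real_normK ?num_real.
Qed.

Lemma strong_cvg_scaleD a f (h : nat -> X -> R) u v : strong_cvg f u -> strong_cvg h v ->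
  strong_cvg (fun n x => a * f n x + h n x) (fun x => a * u x + v x).
Proof.
move=> [Lf Lu fu] [Lh Lv hv]; split; [by move=> n; exact: Lsc|exact: Lsc|].
move=> e e0; have e1 : 0 < e / 2 / (`|a| + 1) by rewrite !divr_gt0// ltr_wpDl.
have e2 : 0 < e / 2 by rewrite divr_gt0.
have [N1 H1] := fu _ e1; have [N2 H2] := hv _ e2.
exists (maxn N1 N2) => n; rewrite geq_max => /andP[n1 n2].
have -> : (fun x => a * f n x + h n x - (a * u x + v x)) =
  (fun x => a * (f n x - u x) + (h n x - v x)) by apply/funext => x; ring.
apply: le_trans (seminorm_scaleD Lsc Dsym Dsc Dge0 a (Lsub (Lf n) Lu) (Lsub (Lh n) Lv)) _.
have h1 := H1 n n1; rewrite ler_pdivlMr ?ltr_wpDl// mulrDr mulr1 in h1.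
have h2 := H2 n n2; have h3 := seminorm_ge0 D (fun x => f n x - u x).
rewrite mulrC; move: h1 h2 h3; move: (nD _) (nD _) (_ * _) => p q b; lra.
Qed.

Lemma form_closure_scaleD a f (h : nat -> X -> R) u v : form_closure f u -> form_closure h v ->
  form_closure (fun n x => a * f n x + h n x) (fun x => a * u x + v x).
Proof.
move=> [Sf fu Ef] [Sh hv Eh]; split; [by move=> n; exact: Ssc|exact: strong_cvg_scaleD|].
move=> e e0; have e1 : 0 < e / 2 / (`|a| + 1) by rewrite !divr_gt0// ltr_wpDl.
have e2 : 0 < e / 2 by rewrite divr_gt0.
have [N1 H1] := Ef _ e1; have [N2 H2] := Eh _ e2.
exists (maxn N1 N2) => n m; rewrite !geq_max => /andP[n1 n2] /andP[m1 m2].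
have -> : (fun x => a * f n x + h n x - (a * f m x + h m x)) =
  (fun x => a * (f n x - f m x) + (h n x - h m x)) by apply/funext => x; ring.
apply: le_trans (seminorm_scaleD Ssc Esym Esc Ege0 a (Ssub (Sf n) (Sf m)) (Ssub (Sh n) (Sh m))) _.
have h1 := H1 n m n1 m1; rewrite ler_pdivlMr ?ltr_wpDl// mulrDr mulr1 in h1.
have h2 := H2 n m n2 m2; have h3 := seminorm_ge0 E (fun x => f n x - f m x).
rewrite mulrC; move: h1 h2 h3; move: (nE _) (nE _) (_ * _) => p q b; lra.
Qed.

Lemma strong_cvg_cst h : L h -> strong_cvg (fun=> h) h.
Proof.
move=> Lh; split => // e e0; exists 0%N => n _.
rewrite (_ : (fun x => _) = (fun=> 0)); last by apply/funext => x; rewrite subrr.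
by case: nD0 => [->|/(_ _ Lh)//]; exact: ltW.
Qed.

Lemma form_closure_cst h : Sm h -> form_closure (fun=> h) h.
Proof.
move=> Sh; split => //; first exact/strong_cvg_cst/SL.
move=> e e0; exists 0%N => n m _ _.
rewrite (_ : (fun x => _) = (fun=> 0)); last by apply/funext => x; rewrite subrr.
by rewrite /seminorm (sip_0r Esc (sip_P0 Ssc Sh)) sqrtr0 ltW.
Qed.

Lemma form_closure_bounded f u : form_closure f u ->
  exists2 C, 0 < C & exists N, forall n, (N <= n)%N -> nE (f n) <= C.
Proof.
move=> [fs _ H]; have [N HN] := H 1 ltr01.
exists (nE (f N) + 1); first by rewrite ltr_wpDl ?seminorm_ge0.
exists N => n Nn; have := nE_tri (fs n) (fs N); have := HN n N Nn (leqnn N).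
move: (nE _) (nE _) (nE _) => p q r; lra.
Qed.

(* E(f_n, f_n) = E(f_n, f_n - f_N) + E(f_N, f_n), and by Green's formula the last term tends
   to 0 with f_n in L^2. *)
Lemma form_closable0 f : form_closure f (fun=> 0) ->
  forall e, 0 < e -> exists N, forall n, (N <= n)%N -> nE (f n) <= e.
Proof.
move=> fc; have [C C0 [N1 HC]] := form_closure_bounded fc.
have [Sf [Lf L0 f0] Ef] := fc => e e0.
have e1 : 0 < e ^+ 2 / (2 * C) by rewrite divr_gt0 ?exprn_gt0// mulr_gt0.
have [N2 H2] := Ef _ e1; pose N := maxn N1 N2.
have [w Lw Ew] := green_ex (Sf N).
have w0 : 0 < nD w + 1 by rewrite ltr_wpDl ?seminorm_ge0.
have e2 : 0 < e ^+ 2 / (2 * (nD w + 1)) by rewrite divr_gt0 ?exprn_gt0// mulr_gt0.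
have [N3 H3] := f0 _ e2.
exists (maxn N N3) => n; rewrite !geq_max => /andP[/andP[n1 n2] n3].
rewrite (seminorm_le_sqr Ege0) ?(ltW e0)//.
have -> : E (f n) (f n) = E (f n) (fun x => f n x - f N x) + E (f N) (f n).
  by rewrite (sip_subr Esc)// (Esym (Sf N))//; ring.
have b1 := E_cs (Sf n) (Ssub (Sf n) (Sf N)).
have b2 := H2 n N n2 (leq_maxr _ _); have b3 := HC n n1.
have b4 := D_cs Lw (Lf n); have b5 := H3 n n3.
rewrite (_ : (fun x => f n x - 0) = f n) in b5; last by apply/funext => x; rewrite subr0.
rewrite (Ew _ (Sf n)).
have p1 := seminorm_ge0 E (f n); have p2 := seminorm_ge0 E (fun x => f n x - f N x).
have p3 := seminorm_ge0 D w; have p4 := seminorm_ge0 D (f n).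
have q1 := ler_norm (E (f n) (fun x => f n x - f N x)).
have q2 := ler_norm (- D w (f n)); rewrite normrN in q2.
have c1 : nE (f n) * nE (fun x => f n x - f N x) <= e ^+ 2 / 2.
  apply: le_trans (ler_pM p1 p2 b3 b2) _; rewrite le_eqVlt; apply/orP; left; apply/eqP.
  by field; rewrite gt_eqF.
have c2 : nD w * nD (f n) <= e ^+ 2 / 2.
  have w1 : nD w <= nD w + 1 by rewrite lerDl.
  apply: le_trans (ler_pM p3 p4 w1 b5) _; rewrite le_eqVlt; apply/orP; left; apply/eqP.
  by field; rewrite gt_eqF.
apply: le_trans (lerD (le_trans q1 (le_trans b1 c1)) (le_trans q2 (le_trans b4 c2))) _.
by rewrite -splitr.
Qed.

Lemma form_closable f (h : nat -> X -> R) u : form_closure f u -> form_closure h u ->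
  forall e, 0 < e -> exists N, forall n, (N <= n)%N -> nE (fun x => f n x - h n x) <= e.
Proof.
move=> fu hu; have := form_closure_scaleD (-1) hu fu.
have -> : (fun x => -1 * u x + u x) = (fun=> 0) by apply/funext => x; ring.
move=> /form_closable0 H e /H[N HN]; exists N => n /HN.
by rewrite (_ : (fun x => -1 * h n x + f n x) = (fun x => f n x - h n x))//; apply/funext => x; ring.
Qed.

Lemma form_diff_le h k h' k' : Sm h -> Sm k -> Sm h' -> Sm k' ->
  `|E h k - E h' k'| <= nE (fun x => h x - h' x) * nE k + nE h' * nE (fun x => k x - k' x).
Proof.
move=> Sh Sk Sh' Sk'.
have -> : E h k - E h' k' = E (fun x => h x - h' x) k + E h' (fun x => k x - k' x).
  by rewrite (sip_subr Esc)// (sip_subl Ssc Esym Esc)//; ring.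
apply: le_trans (ler_normD _ _) _; apply: lerD; apply: E_cs => //; exact: Ssub.
Qed.

(** The limit exists since the values form a Cauchy sequence, and by closability it is the same for
    all approximating sequences. Hence it is the value picked by [xget]. *)
Lemma closed_form_lim f (h : nat -> X -> R) u v : form_closure f u -> form_closure h v ->
  (fun n => E (f n) (h n)) @ \oo --> Q u v.
Proof.
move=> fu hv; have [Cf Cf0 [N1 HCf]] := form_closure_bounded fu.
have [Ch Ch0 [N2 HCh]] := form_closure_bounded hv.
have [Sf _ Ef] := fu; have [Sh _ Eh] := hv.
(* Used with the same sequences at two indices for the Cauchy property, and with two pairs of
   sequences at one index for independence of the choice. [Cf + 1] leaves room for a term of [f'] at
   distance at most 1 from that of [f]. *)
have small (f' h' : nat -> X -> R) n m e : 0 < e -> (forall n, Sm (f' n)) -> (forall n, Sm (h' n)) ->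
   (N2 <= n)%N -> nE (f' m) <= Cf + 1 -> nE (fun x => f n x - f' m x) <= e / (2 * Ch) ->
   nE (fun x => h n x - h' m x) <= e / (2 * (Cf + 1)) -> `|E (f n) (h n) - E (f' m) (h' m)| <= e.
  move=> e0 Sf' Sh' n2 b1 b2 b3.
  apply: le_trans (form_diff_le (Sf n) (Sh n) (Sf' m) (Sh' m)) _.
  have Cf1 : 0 < Cf + 1 by rewrite addr_gt0.
  have c1 := ler_pM (seminorm_ge0 _ _) (seminorm_ge0 _ _) b2 (HCh n n2).
  have c2 := ler_pM (seminorm_ge0 _ _) (seminorm_ge0 _ _) b1 b3.
  have d1 : e / (2 * Ch) * Ch = e / 2 by field; rewrite gt_eqF.
  have d2 : (Cf + 1) * (e / (2 * (Cf + 1))) = e / 2 by field; rewrite gt_eqF.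
  rewrite d1 in c1; rewrite d2 in c2; move: c1 c2.
  by move: (nE _ * nE _) (nE _ * nE _) => p q; lra.
have Cf1 : 0 < Cf + 1 by rewrite addr_gt0.
have pos1 e : 0 < e -> 0 < e / (2 * Ch) by move=> e0; rewrite divr_gt0// mulr_gt0.
have pos2 e : 0 < e -> 0 < e / (2 * (Cf + 1)) by move=> e0; rewrite divr_gt0// mulr_gt0.
have [l El] : exists l, (fun n => E (f n) (h n)) @ \oo --> l.
  apply: cauchy_cvgn => e e0.
  have [A1 HA1] := Ef _ (pos1 _ e0); have [A2 HA2] := Eh _ (pos2 _ e0).
  exists (maxn (maxn A1 A2) (maxn N1 N2)) => n m.
  rewrite !geq_max => /andP[/andP[n1 n2] /andP[n3 n4]] /andP[/andP[m1 m2] /andP[m3 m4]].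
  apply: small => //; [|exact: HA1|exact: HA2].
  by apply: le_trans (HCf m m3) _; rewrite lerDl.
suff -> : Q u v = l by [].
rewrite /closed_form; case: xgetP => [r _ [f' [h' [fu' hv' El']]]|/(_ l)]; last first.
  by case; exists f, h.
have [Sf' _ _] := fu'; have [Sh' _ _] := hv'.
apply/eqP; rewrite -subr_eq0 -normr_le0; apply/ler_addgt0Pl => e e0; rewrite addr0.
have e3 : 0 < e / 3 by rewrite divr_gt0.
have [A1 HA1] := (cvgn_leP _ _).1 El _ e3; have [A2 HA2] := (cvgn_leP _ _).1 El' _ e3.
have [A3 HA3] := form_closable fu fu' (pos1 _ e3).
have [A4 HA4] := form_closable hv hv' (pos2 _ e3).
have [A5 HA5] := form_closable fu fu' ltr01.
pose n := maxn (maxn (maxn A1 A2) (maxn A3 A4)) (maxn A5 (maxn N1 N2)).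
have : (n <= n)%N by [].
rewrite {1}/n !geq_max => /andP[/andP[/andP[n1 n2] /andP[n3 n4]] /andP[n5 /andP[n6 n7]]].
have b : nE (f' n) <= Cf + 1.
  have := nE_tri (Sf' n) (Sf n); rewrite nE_subC//.
  have := HA5 n n5; have := HCf n n6.
  by move: (nE _) (nE _) (nE _) => p q s; lra.
have := small f' h' n n _ e3 Sf' Sh' n7 b (HA3 n n3) (HA4 n n4).
have := HA1 n n1; have := HA2 n n2.
rewrite !ler_norml; move: (E _ _) (E _ _) => p q.
by move=> /andP[? ?] /andP[? ?] /andP[? ?]; apply/andP; split; lra.
Qed.

Definition in_closure u := exists f, form_closure f u.

Lemma closed_form_unique f (h : nat -> X -> R) u v l : form_closure f u -> form_closure h v ->
  (fun n => E (f n) (h n)) @ \oo --> l -> Q u v = l.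
Proof.
move=> fu hv Hl; have H := closed_form_lim fu hv.
exact: (cvg_unique (@Rhausdorff R) H Hl).
Qed.

Lemma in_closure_scaleD a u v : in_closure u -> in_closure v -> in_closure (fun x => a * u x + v x).
Proof. by move=> [f fu] [h hv]; eexists; exact: form_closure_scaleD fu hv. Qed.

Lemma closed_form_sym u v : in_closure u -> in_closure v -> Q u v = Q v u.
Proof.
move=> [f fu] [h hv]; apply: (closed_form_unique fu hv).
have [Sf _ _] := fu; have [Sh _ _] := hv.
rewrite (_ : (fun n => E (f n) (h n)) = (fun n => E (h n) (f n))); first exact: closed_form_lim.
by apply/funext => n; exact: Esym.
Qed.

Lemma closed_form_scaleDr a u v z : in_closure u -> in_closure v -> in_closure z ->
  Q z (fun x => a * u x + v x) = a * Q z u + Q z v.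
Proof.
move=> [f fu] [h hv] [k kz]; apply: (closed_form_unique kz (form_closure_scaleD a fu hv)).
have [Sf _ _] := fu; have [Sh _ _] := hv; have [Sk _ _] := kz.
rewrite (_ : (fun n => _) = (fun n => a * E (k n) (f n) + E (k n) (h n))); last first.
  by apply/funext => n; exact: Esc.
have c1 := closed_form_lim kz fu; have c2 := closed_form_lim kz hv.
by apply: cvgD c2; apply: cvgM c1; exact: cvg_cst.
Qed.

Lemma closed_form_ge0 u : in_closure u -> 0 <= Q u u.
Proof.
move=> [f fu]; have [Sf _ _] := fu; have c := closed_form_lim fu fu.
by apply: (cvgn_le_lim c (N := 0%N)) => n _; exact: Ege0.
Qed.

Local Notation nQ := (seminorm Q).
Let nQ_tri_sub := seminorm_triangle_sub in_closure_scaleD closed_form_sym closed_form_scaleDr closed_form_ge0.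

Lemma closed_form_smooth h k : Sm h -> Sm k -> Q h k = E h k.
Proof.
move=> Sh Sk; apply: (closed_form_unique (form_closure_cst Sh) (form_closure_cst Sk)).
exact: cvg_cst.
Qed.

(** For fixed [n], the sequence [f n - f m] approximates [f n - u] as m grows, so the Cauchy bound
    passes to the limit in [m]. *)
Lemma form_closure_nQ f u : form_closure f u -> forall e, 0 < e ->
  exists N, forall n, (N <= n)%N -> nQ (fun x => f n x - u x) <= e.
Proof.
move=> fu e e0; have [Sf _ Ef] := fu; have [N HN] := Ef _ e0; exists N => n Nn.
have fnu : form_closure (fun m x => -1 * f m x + f n x) (fun x => -1 * u x + f n x).
  exact: form_closure_scaleD fu (form_closure_cst (Sf n)).
have Eu : (fun x => f n x - u x) = (fun x => -1 * u x + f n x) by apply/funext => x; ring.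
rewrite Eu (seminorm_le_sqr closed_form_ge0) ?(ltW e0)//; last by eexists; exact: fnu.
have c := closed_form_lim fnu fnu.
apply: (cvgn_lim_le c (N := N)) => m Nm.
rewrite (_ : (fun x => -1 * f m x + f n x) = (fun x => f n x - f m x)); last by apply/funext => x; ring.
by rewrite -(seminorm_le_sqr Ege0) ?(ltW e0)//; [exact: HN|exact: Ssub].
Qed.

(* The approximating functions are in the domain of [gen], which a priori is smaller than [Sm]. *)
Definition form_domain u := exists f, (forall n, exists w, gen (f n) w) /\ form_closure f u.

Lemma form_domain_closure u : form_domain u -> in_closure u.
Proof. by move=> [f [_ fu]]; exists f. Qed.

Lemma form_domain_L u : form_domain u -> L u.
Proof. by move=> [f [_ [_ []]]]. Qed.

Lemma form_domain_scaleD a u v : form_domain u -> form_domain v -> form_domain (fun x => a * u x + v x).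
Proof.
move=> [f [gf fu]] [h [gh hv]]; exists (fun n x => a * f n x + h n x); split.
  by move=> n; have [w fw] := gf n; have [z hz] := gh n; exact: gen_sc fw hz.
exact: form_closure_scaleD.
Qed.

Lemma form_domain_approx u e : form_domain u -> 0 < e -> exists h,
  [/\ exists w, gen h w, nD (fun x => h x - u x) <= e & nQ (fun x => h x - u x) <= e].
Proof.
move=> [f [gf fu]] e0; have [_ [_ _ H] _] := fu.
have [N1 H1] := H _ e0; have [N2 H2] := form_closure_nQ fu e0.
by exists (f (maxn N1 N2)); split; [exact: gf|apply: H1; exact: leq_maxl|apply: H2; exact: leq_maxr].
Qed.

(** A diagonal choice: [s n] is replaced by a function in the domain of [gen] at distance at most
    [1 / (n + 1)] from it in both seminorms. Convergence and the Cauchy property carry over by the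
    triangle inequality. *)
Lemma form_domain_closed (s : nat -> X -> R) u : (forall n, form_domain (s n)) -> strong_cvg s u ->
  (forall e, 0 < e -> exists N, forall n m, (N <= n)%N -> (N <= m)%N -> nQ (fun x => s n x - s m x) <= e) ->
  form_domain u.
Proof.
move=> sd [Ls Lu su] sC; pose ep n : R := n.+1%:R^-1.
have ep0 n : 0 < ep n by rewrite invr_gt0.
have [f fP] := choice (fun n => form_domain_approx (sd n) (ep0 n)).
have gf n : exists w, gen (f n) w by have [] := fP n.
have Sf n : Sm (f n) by have [w /gen_green[]] := gf n.
have epN e : 0 < e -> exists N, forall n, (N <= n)%N -> ep n <= e.
  move=> e0; have [N HN] := (cvgn_leP _ _).1 (@cvg_harmonic R) _ e0; exists N => n /HN.
  by rewrite subr0 ger0_norm// ltW// ep0.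
have fcl n : in_closure (f n) by exists (fun=> f n); exact: form_closure_cst.
have scl n : in_closure (s n) by exact: form_domain_closure.
have Qsub := sip_P_sub in_closure_scaleD.
exists f; split => //; split => //.
  split; [by move=> n; exact: SL|by []|move=> e e0].
  have e2 : 0 < e / 2 by rewrite divr_gt0.
  have [N1 H1] := su _ e2; have [N2 H2] := epN _ e2.
  exists (maxn N1 N2) => n; rewrite geq_max => /andP[n1 n2].
  have [_ b1 _] := fP n; have b2 := H1 n n1; have b3 := H2 n n2.
  have := nD_tri_sub (SL (Sf n)) Lu (Ls n).
  rewrite [X in _ -> _ <= X]splitr => /le_trans; apply; apply: lerD => //.
  exact: le_trans b1 b3.
move=> e e0; have e3 : 0 < e / 3 by rewrite divr_gt0.
have [N1 H1] := sC _ e3; have [N2 H2] := epN _ e3.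
exists (maxn N1 N2) => n m; rewrite !geq_max => /andP[n1 n2] /andP[m1 m2].
have -> : nE (fun x => f n x - f m x) = nQ (fun x => f n x - f m x).
  by rewrite /seminorm closed_form_smooth//; exact: Ssub.
have [_ _ b1] := fP n; have [_ _ b2] := fP m.
have t1 := nQ_tri_sub (fcl n) (fcl m) (scl n).
have t2 := nQ_tri_sub (scl n) (fcl m) (scl m).
have t3 : nQ (fun x => s m x - f m x) = nQ (fun x => f m x - s m x).
  exact: (seminorm_subC in_closure_scaleD closed_form_sym closed_form_scaleDr).
have b3 := H1 n m n1 m1; have b4 := H2 n n2; have b5 := H2 m m2.
rewrite t3 in t2.
move: t1 t2 b1 b2 b3 b4 b5.
by move: (nQ _) (nQ _) (nQ _) (nQ _) (nQ _) (ep n) (ep m) => ? ? ? ? ? ? ?; lra.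
Qed.

(* The graph of the Friedrichs extension of [gen]. *)
Definition weak_gen u v := [/\ L v, form_domain u &
  forall f (w : nat -> X -> R) (h : nat -> X -> R) y, (forall n, gen (f n) (w n)) -> form_closure f u ->
    (forall n, exists z, gen (h n) z) -> form_closure h y ->
    (fun n => D (w n) (h n)) @ \oo --> D v y].

(** Green's formula along two approximating sequences in the domain of [gen], in the limit. *)
Lemma weak_gen_form u v y : weak_gen u v -> form_domain y -> Q u y = - D v y.
Proof.
move=> [Lv [f [gf fu]] H] [h [gh hy]]; have [w fw] := choice gf.
apply: (closed_form_unique fu hy).
rewrite (_ : (fun n => _) = (fun n => - D (w n) (h n))); last first.
  apply/funext => n; have [_ _ ->//] := gen_green (fw n).
  by have [] := hy.
by apply: cvgN; apply: H fw fu gh hy.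
Qed.

(** * Eigenfunction expansions and the form domain *)

Section Spectrum.
Variables (lam : nat -> R) (phi : nat -> X -> R).
Hypothesis lam0 : forall k : nat, 0 <= lam k.
Hypothesis phiA : forall k : nat, weak_gen (phi k) (fun x => - lam k * phi k x).
Hypothesis orth : forall j k : nat, D (phi j) (phi k) = (j == k)%:R.

Let phid (k : nat) : form_domain (phi k).
Proof. by have [] := phiA k. Qed.

Let phiL (k : nat) : L (phi k).
Proof. exact: form_domain_L. Qed.

Lemma eigen_form (k : nat) y : form_domain y -> Q (phi k) y = lam k * D (phi k) y.
Proof.
move=> yd; rewrite (weak_gen_form (phiA k) yd).
have L0 := sip_P0 Lsc (phiL k); have Ly := form_domain_L yd.
have := sip_scaleDl Lsc Dsym Dsc (- lam k) (phiL k) L0 Ly.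
rewrite (Dsym L0 Ly) (sip_0r Dsc Ly) addr0.
have -> : (fun x => - lam k * phi k x + 0) = (fun x => - lam k * phi k x).
  by apply/funext => x; rewrite addr0.
by move=> ->; rewrite mulNr opprK.
Qed.

Lemma eigen_sum_domain (r : seq nat) (a : nat -> R) :
  form_domain (fun x => \sum_(k <- r) a k * phi k x).
Proof. exact: (sip_P_sum form_domain_scaleD r a (phid 0) phid). Qed.

Lemma eigen_sum_form (r : seq nat) (a : nat -> R) y : form_domain y ->
  Q y (fun x => \sum_(k <- r) a k * phi k x) = \sum_(k <- r) a k * (lam k * D y (phi k)).
Proof.
move=> yd; have yc := form_domain_closure yd.
rewrite (sip_sumr in_closure_scaleD closed_form_scaleDr)//; last by move=> k; exact: form_domain_closure.
apply: eq_bigr => k _; congr (_ * _).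
rewrite closed_form_sym ?eigen_form//; last exact: form_domain_closure.
by rewrite Dsym//; exact: form_domain_L.
Qed.

Lemma eigen_sum_coef (r : seq nat) (a : nat -> R) j : uniq r -> j \in r ->
  D (fun x => \sum_(k <- r) a k * phi k x) (phi j) = a j.
Proof.
move=> ur jr; have Ls := form_domain_L (eigen_sum_domain r a).
rewrite (Dsym Ls (phiL j)) (sip_sumr Lsc Dsc)// (bigD1_seq j)//= orth eqxx mulr1 big1 ?addr0// => k kj.
by rewrite orth eq_sym (negPf kj) mulr0.
Qed.

Lemma eigen_sum_energy (r : seq nat) (a : nat -> R) : uniq r ->
  Q (fun x => \sum_(k <- r) a k * phi k x) (fun x => \sum_(k <- r) a k * phi k x) =
  \sum_(k <- r) a k ^+ 2 * lam k.
Proof.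
move=> ur; rewrite eigen_sum_form; last exact: eigen_sum_domain.
rewrite big_seq [RHS]big_seq; apply: eq_bigr => k kr.
by rewrite eigen_sum_coef//; ring.
Qed.

(** Bessel's inequality for the form: with [s] the partial sum of [y], both [Q y s] and [Q s s]
    equal the left side, and [Q] is nonnegative at [y - s]. *)
Lemma form_domain_bessel y n : form_domain y ->
  \sum_(0 <= k < n) D y (phi k) ^+ 2 * lam k <= Q y y.
Proof.
move=> yd; pose r := index_iota 0 n; pose a (k : nat) := D y (phi k).
have sd := eigen_sum_domain r a; set s := (fun x => _) in sd.
have yc := form_domain_closure yd; have sc := form_domain_closure sd.
have ysc := sip_P_sub in_closure_scaleD yc sc.
have := closed_form_ge0 ysc.
rewrite (sip_subr closed_form_scaleDr)// !(sip_subl in_closure_scaleD closed_form_sym closed_form_scaleDr)//.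
rewrite (closed_form_sym sc yc) /s eigen_sum_form// eigen_sum_energy ?iota_uniq//.
have -> : \sum_(k <- r) a k * (lam k * D y (phi k)) = \sum_(k <- r) a k ^+ 2 * lam k.
  by apply: eq_bigr => k _; rewrite /a; ring.
by rewrite subrr subr0 subr_ge0.
Qed.

(** The energies of the partial sums increase and are bounded, hence converge. By orthogonality the
    partial sums are then Cauchy in the form, and the form domain is closed. *)
Lemma form_domain_series (a : nat -> R) u C :
  strong_cvg (fun n x => \sum_(0 <= k < n) a k * phi k x) u ->
  (forall n, \sum_(0 <= k < n) a k ^+ 2 * lam k <= C) -> form_domain u.
Proof.
move=> au aC; apply: (form_domain_closed _ au) => [n|]; first exact: eigen_sum_domain.
pose T n := \sum_(0 <= k < n) a k ^+ 2 * lam k.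
have T_nd : {homo T : m n / (m <= n)%N >-> m <= n}.
  move=> m n mn; rewrite /T (big_cat_nat (leq0n m) mn)//= lerDl.
  by apply: sumr_ge0 => k _; rewrite mulr_ge0// sqr_ge0.
have [l Tl] : exists l : R, T @ \oo --> l.
  suff /cvg_ex[l Tl] : cvgn T by exists l.
  apply: nondecreasing_is_cvgn => //; exists C => _ [n _ <-]; exact: aC.
(* Two partial energies within [e^2 / 2] of their limit differ by at most [e^2], and their
   difference is the squared seminorm of the block in between. *)
move=> e e0; have e2 : 0 < e ^+ 2 / 2 by rewrite divr_gt0 ?exprn_gt0.
have [N HN] := (cvgn_leP _ _).1 Tl _ e2; exists N.
have main n m : (N <= m)%N -> (m <= n)%N -> nQ (fun x => \sum_(0 <= k < n) a k * phi k x -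
     \sum_(0 <= k < m) a k * phi k x) <= e.
  move=> Nm mn; have Nn := leq_trans Nm mn.
  have -> : (fun x => \sum_(0 <= k < n) a k * phi k x - \sum_(0 <= k < m) a k * phi k x) =
      (fun x => \sum_(k <- index_iota m n) a k * phi k x).
    by apply/funext => x; rewrite (big_cat_nat (leq0n m) mn)//= addrAC subrr add0r.
  rewrite (seminorm_le_sqr closed_form_ge0) ?(ltW e0)//; last first.
    exact/form_domain_closure/eigen_sum_domain.
  rewrite eigen_sum_energy ?iota_uniq//.
  have : T n = T m + \sum_(m <= k < n) a k ^+ 2 * lam k by rewrite /T (big_cat_nat (leq0n m) mn).
  have := HN n Nn; have := HN m Nm; rewrite !ler_norml.
  move: (T n) (T m) (\sum_(m <= k < n) _) (e ^+ 2) => p q s c.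
  by move=> /andP[? ?] /andP[? ?]; lra.
move=> n m Nn Nm; have [mn|nm] := leqP m n; first exact: main.
rewrite (seminorm_subC in_closure_scaleD closed_form_sym closed_form_scaleDr).
- by apply: main => //; exact: ltnW.
- exact/form_domain_closure/eigen_sum_domain.
- exact/form_domain_closure/eigen_sum_domain.
Qed.

End Spectrum.

End ClosableForm.

(** * The energy form *)

Section DiffusionForm.
Variables (R : realType) (d : nat) (M : ptopologicalType).
Hypotheses (hM : hausdorff_space M) (cM : compact [set: M]).
Variable g : riemannian R d M.
Variable vol : {measure set (borel M) -> \bar R}.
Hypothesis hvol : is_volume g vol.
Variable U : M -> R.
Hypothesis hU : class_C g 1 U.
Variable pi : probability (borel M) R.
Hypothesis hpi : forall S : set (borel M), measurable S ->
    pi S = (\int[vol]_(x in S) (expR (- U x))%:E)%E.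
Implicit Types (a e l : R) (h k u v w y z : M -> R) (f : nat -> M -> R).

Local Notation D := (dotL2 pi).
Local Notation E := (energy g pi).
Local Notation nE := (seminorm (energy g pi)).
Local Notation nL := (seminorm (dotL2 pi)).
Local Notation A0 := (pre_generator g U).
Local Notation Gamma h k := (vdot (grad g h) (grad g k)).
Local Notation form_closure := (form_closure (L2 pi) (smooth g) (dotL2 pi) (energy g pi)).
Local Notation Q := (closed_form (L2 pi) (smooth g) (dotL2 pi) (energy g pi)).
Local Notation form_domain := (form_domain (L2 pi) (smooth g) (dotL2 pi) (energy g pi) (pre_generator g U)).
Local Notation weak_gen := (weak_gen (L2 pi) (smooth g) (dotL2 pi) (energy g pi) (pre_generator g U)).

Let Lsc : forall a h k, L2 pi h -> L2 pi k -> L2 pi (fun x => a * h x + k x).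
Proof. by move=> a h k; exact: L2_scaleD. Qed.

Let Dsym : forall h k, L2 pi h -> L2 pi k -> D h k = D k h.
Proof. by move=> h k _ _; exact: dotL2C. Qed.

Let Dsc : forall a h k z, L2 pi h -> L2 pi k -> L2 pi z ->
  D z (fun x => a * h x + k x) = a * D z h + D z k.
Proof. exact: dotL2_scaleDr. Qed.

Let Dge0 : forall h, L2 pi h -> 0 <= D h h.
Proof. by move=> h _; exact: dotL2_ge0. Qed.

Let Ssc : forall a h k, smooth g h -> smooth g k -> smooth g (fun x => a * h x + k x).
Proof. by move=> a h k; exact: smooth_scaleD. Qed.

Lemma energyC h k : smooth g h -> smooth g k -> E h k = E k h.
Proof. by move=> hs ks; rewrite /energy (GammaC (hs 1) (ks 1)). Qed.

Lemma Gamma_integrable h k : smooth g h -> smooth g k ->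
  pi.-integrable setT (EFin \o (Gamma h k : borel M -> R)).
Proof. by move=> hs ks; apply: (continuous_integrable cM); exact: Gamma_continuous. Qed.

Lemma energy_scaleDr a h k z : smooth g h -> smooth g k -> smooth g z ->
  E z (fun x => a * h x + k x) = a * E z h + E z k.
Proof.
move=> hs ks zs; have i1 := Gamma_integrable zs hs; have i2 := Gamma_integrable zs ks.
have i3 : pi.-integrable setT (EFin \o ((fun x => a * Gamma z h x) : borel M -> R)).
  by have := integrableZl measurableT a i1; apply: eq_integrable.
rewrite -[a * E z h](RintegralZl a measurableT i1) -(RintegralD measurableT i3 i2).
by apply: eq_Rintegral => x _; exact: (vdot_grad_scaleD _ _ _ (hs 1) (ks 1)).
Qed.

Lemma energy_ge0 h : 0 <= E h h.
Proof. by apply: Rintegral_ge0 => x _; exact: vdot_ge0. Qed.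

Lemma smooth_L2 h : smooth g h -> L2 pi h.
Proof. by move=> hs; apply: (continuous_L2 cM); exact: smooth_continuous hs. Qed.

Lemma energy_green h : smooth g h -> exists2 w, L2 pi w & forall k, smooth g k -> E h k = - D w k.
Proof.
move=> hs; have [w [cw Ew _]] := green hM cM hvol hU hpi hs.
by exists w => //; exact: (continuous_L2 cM).
Qed.

Lemma pre_generator_green h w : A0 h w ->
  [/\ smooth g h, L2 pi w & forall k, smooth g k -> E h k = - D w k].
Proof.
move=> hw; have [hs _] := hw; have [w' [cw Ew' /(_ w hw) ww']] := green hM cM hvol hU hpi hs.
by rewrite ww'; split => //; exact: (continuous_L2 cM).
Qed.

Lemma pre_generator_scaleD a h k w z : A0 h w -> A0 k z ->
  exists y, A0 (fun x => a * h x + k x) y.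
Proof.
move=> [hs [Lh Lhh _]] [ks [Lk Lkk _]]; eexists; split; first exact: smooth_scaleD.
by eexists; [exact: is_laplacian_scaleD Lhh Lkk|reflexivity].
Qed.

Let Esym := energyC.
Let Esc := energy_scaleDr.
Let Ege0 : forall h, smooth g h -> 0 <= E h h.
Proof. by move=> h _; exact: energy_ge0. Qed.
Let SL := smooth_L2.
Let green_ex := energy_green.
Let gen_green := pre_generator_green.
Let gen_sc := pre_generator_scaleD.

Lemma cvgL2_strong f u : cvgL2 pi f u <-> strong_cvg (L2 pi) (dotL2 pi) f u.
Proof. exact: cvgL2P. Qed.

Lemma vanishing_seminorm f : (forall n, smooth g (f n)) ->
  vanishing (fun n m => E (f n \- f m) (f n \- f m)) <->
  forall e, 0 < e -> exists N, forall n m, (N <= n)%N -> (N <= m)%N ->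
    nE (fun x => f n x - f m x) <= e.
Proof.
move=> fs; have nE_le_sqr := seminorm_le_sqr Ege0; split => H e e0.
  have e20 : 0 < e ^+ 2 by rewrite exprn_gt0.
  have [N HN] := H _ e20; exists N => n m Nn Nm; have := HN n m Nn Nm.
  have sB := smoothB (fs n) (fs m).
  by rewrite ger0_norm ?Ege0// nE_le_sqr ?(ltW e0).
have se0 : 0 < Num.sqrt e by rewrite sqrtr_gt0.
have [N HN] := H _ se0; exists N => n m Nn Nm; have := HN n m Nn Nm.
have sB := smoothB (fs n) (fs m).
by rewrite ger0_norm ?Ege0// nE_le_sqr ?sqrtr_ge0// sqr_sqrtr ?(ltW e0).
Qed.

Lemma cvgH1P f u : cvgH1 g pi f u <-> form_closure f u.
Proof.
split => -[fs /cvgL2_strong fu H]; split => //; first exact/vanishing_seminorm.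
exact/vanishing_seminorm.
Qed.

Lemma dotH1E u v : dotH1 g pi u v = Q u v.
Proof.
congr xget; apply/seteqP; split => r [f [h [fu hv c]]]; exists f, h; split => //; exact/cvgH1P.
Qed.

(** [form_cvg] expresses the Cauchy property through the images [w n]; by Green's formula that
    quantity is minus the energy of [f n - f m]. *)
Lemma form_cvgP f (w : nat -> M -> R) u :
  form_cvg pi A0 f w u <-> (forall n, A0 (f n) (w n)) /\ form_closure f u.
Proof.
have K : (forall n, A0 (f n) (w n)) -> forall n m,
    D (w n \- w m) (f n \- f m) = - E (f n \- f m) (f n \- f m).
  move=> fw n m; have [fn Ln En] := gen_green (fw n); have [fm Lm Em] := gen_green (fw m).
  have sB := smoothB fn fm.
  rewrite (sip_subl Ssc Esym Esc fn fm sB) En// Em//.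
  by rewrite dotL2Bl//; [ring|exact: SL].
split=> [[fw fu H]|[fw /cvgH1P[fs fu H]]]; split => //.
  apply/cvgH1P; split => // [n|e e0]; first by have [] := fw n.
  by have [N HN] := H e e0; exists N => n m Nn Nm; have := HN n m Nn Nm; rewrite K// normrN.
by move=> e e0; have [N HN] := H e e0; exists N => n m Nn Nm; rewrite K// normrN; exact: HN.
Qed.

Lemma generator_weak u v : generator g U pi u v -> weak_gen u v.
Proof.
move=> [_ Lv [f [w /form_cvgP[fw fu]]] H]; split => //.
  by exists f; split => // n; exists (w n).
move=> f' w' h y fw' fu' /choice[z hz] hy.
exact: (H _ _ _ z _ ((form_cvgP _ _ _).2 (conj fw' fu')) ((form_cvgP _ _ _).2 (conj hz hy))).
Qed.

Lemma resolvent_form l v w y : L2 pi v -> is_resolvent g U pi l v w -> form_domain y ->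
  Q w y = - (D v y + l * D w y).
Proof.
move=> Lv vw yd; have Lw : L2 pi w by have [] := vw.
have wg := generator_weak vw.
rewrite (weak_gen_form Lsc Dsym Dsc Dge0 Ssc Esym Esc Ege0 green_ex gen_green wg yd).
have Ly := form_domain_L yd.
have Lz : L2 pi (fun x => l * w x) by exact: L2Z.
by congr (- _); rewrite -(dotL2Zl _ Lw Ly) -(dotL2Dl Lv Lz Ly).
Qed.

Section SpectralDomain.
Variables (lambda : nat -> R) (phi : nat -> M -> R).
Hypothesis hspec : discrete_spectrum pi (generator g U pi) lambda phi.

Let lam0 (k : nat) : 0 <= lambda k.
Proof.
have [[l0 _ lS _] _ _ _ _] := hspec.
by elim: k => [|k IH]; [rewrite l0|exact: le_trans IH (lS k)].
Qed.

Let phiA (k : nat) : weak_gen (phi k) (fun x => - lambda k * phi k x).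
Proof. by have [_ H _ _ _] := hspec; exact: generator_weak. Qed.

(** Finiteness of the weighted series bounds the energies of the partial sums; conversely, Bessel's
    inequality for the form bounds the series. Fourier coefficients say little about [eta o u],
    whereas approximating smooth functions can be composed with [eta]. *)
Lemma H1_form_domain u : H1 pi lambda phi u <-> form_domain u.
Proof.
have [_ _ orth complete _] := hspec; split.
  move=> [a au aS].
  pose s := (\sum_(0 <= k <oo) (a k ^+ 2 * lambda k)%:E)%E.
  have t0 (k : nat) : (0 <= (a k ^+ 2 * lambda k)%:E)%E by rewrite lee_fin mulr_ge0 ?sqr_ge0.
  have sfin : s \is a fin_num.
    rewrite ge0_fin_numE; last by apply: nneseries_ge0.
    by move: aS; under eq_eseriesr do rewrite expr1.
  have aC n : \sum_(0 <= k < n) a k ^+ 2 * lambda k <= fine s.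
    rewrite -lee_fin fineK// -sumEFin.
    exact: (nneseries_lim_ge (P := xpredT)).
  apply: (form_domain_series Lsc Dsym Dsc Dge0 Ssc Esym Esc Ege0 SL green_ex gen_green gen_sc
    lam0 phiA orth _ aC).
  exact/cvgL2_strong.
move=> ud; exists (fun k : nat => D u (phi k)); first by apply: complete; exact: (form_domain_L ud).
have B (n : nat) := form_domain_bessel Lsc Dsym Dsc Dge0 Ssc Esym Esc Ege0 green_ex gen_green
    gen_sc phiA orth n ud.
apply: (@le_lt_trans _ _ (Q u u)%:E); last exact: ltry.
apply: lime_le => [|].
  by apply: is_cvg_nneseries => k _ _; rewrite lee_fin expr1 mulr_ge0 ?sqr_ge0.
apply: nearW => n; rewrite sumEFin lee_fin.
by under eq_bigr do rewrite expr1; exact: B.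
Qed.

End SpectralDomain.

End DiffusionForm.

(** * Nonlinear test functions *)

Section GammaQuadratic.
Variables (R : realType) (d : nat) (M : ptopologicalType) (g : riemannian R d M).
Implicit Types (a e : R) (h k : M -> R).

Local Notation Gamma h k := (vdot (grad g h) (grad g k)).

Lemma Gamma_scaleD a h k x : smooth g h -> smooth g k ->
  Gamma (fun x => a * h x + k x) (fun x => a * h x + k x) x =
  a ^+ 2 * Gamma h h x + 2 * a * Gamma h k x + Gamma k k x.
Proof.
move=> hs ks; have Fs := smooth_scaleD a hs ks; set F := (fun x => _) in Fs *.
have aux (FF Fh hF Fk kF hh hk kh kk : R) : FF = a * Fh + Fk -> Fh = hF -> hF = a * hh + hk ->
    Fk = kF -> kF = a * kh + kk -> kh = hk -> FF = a ^+ 2 * hh + 2 * a * hk + kk.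
  by move=> -> -> -> -> -> ->; ring.
apply: (aux _ _ _ _ _ _ _ _ _ (vdot_grad_scaleD (grad g F) a x (hs 1) (ks 1)) _
  (vdot_grad_scaleD (grad g h) a x (hs 1) (ks 1)) _
  (vdot_grad_scaleD (grad g k) a x (hs 1) (ks 1)) _).
- exact: (congr1 (fun G => G x) (GammaC (Fs 1) (hs 1))).
- exact: (congr1 (fun G => G x) (GammaC (Fs 1) (ks 1))).
- exact: (congr1 (fun G => G x) (GammaC (ks 1) (hs 1))).
Qed.

(** This is [|a grad h + e grad k|^2]. The expansion at hand has a coefficient on one function only,
    so [e^2] is factored out and [e = 0] is treated apart. *)
Lemma Gamma_quad a e h k x : smooth g h -> smooth g k ->
  0 <= a ^+ 2 * Gamma h h x + 2 * a * e * Gamma h k x + e ^+ 2 * Gamma k k x.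
Proof.
move=> hs ks.
have aux (hh hk kk q : R) : 0 <= hh -> (e != 0 -> q = (a / e) ^+ 2 * hh + 2 * (a / e) * hk + kk) ->
    0 <= q -> 0 <= a ^+ 2 * hh + 2 * a * e * hk + e ^+ 2 * kk.
  move=> hh0; have [-> _ _|en0 /(_ isT) -> q0] := eqVneq e 0.
    by rewrite mulr0 mul0r expr0n/= mul0r !addr0 mulr_ge0 ?sqr_ge0.
  have := mulr_ge0 (sqr_ge0 e) q0; rewrite le_eqVlt => /orP[/eqP ->|/ltW]; last move=> H.
    by rewrite le_eqVlt; apply/orP; left; apply/eqP; field.
  by apply: le_trans H _; rewrite le_eqVlt; apply/orP; left; apply/eqP; field.
exact: (aux _ _ _ _ (vdot_ge0 _ x) (fun=> Gamma_scaleD (a / e) x hs ks) (vdot_ge0 _ x)).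
Qed.

Lemma Gamma_sub h k x : smooth g h -> smooth g k ->
  Gamma (fun x => h x - k x) (fun x => h x - k x) x =
  Gamma h h x - 2 * Gamma h k x + Gamma k k x.
Proof.
move=> hs ks.
have sE : (fun x => h x - k x) = (fun x => -1 * k x + h x) by apply/funext => z; ring.
apply: etrans (congr1 (fun F => Gamma F F x) sE) _; apply: etrans (Gamma_scaleD (-1) x ks hs) _.
have aux (hh hk kh kk : R) : kh = hk -> (-1) ^+ 2 * kk + 2 * -1 * kh + hh = hh - 2 * hk + kk.
  by move=> ->; ring.
by apply: aux; exact: (congr1 (fun G => G x) (GammaC (ks 1) (hs 1))).
Qed.

End GammaQuadratic.

(** The algebra of [Gamma_post_sub]: [a], [b] stand for [eta'] at [h], [k], then [r] for [h - k],
    and [hk] for [grad h . grad k], and so on. The two quadratic hypotheses are the squares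
    [|a grad h + (b - 2 a) grad k|^2] and [|grad k - 2 grad j|^2], which are the defects in the two
    uses of [|X + Y|^2 <= 2 |X|^2 + 2 |Y|^2]. *)
Lemma post_sub_bound (R : realType) (K a b r C eta_sub HH HK KK subhk subkj hh hk kk kj jj : R) :
  0 <= K -> 0 <= a -> a <= K -> 0 <= b -> b <= K -> `|a - b| <= K * `|r| -> jj <= C -> 0 <= jj ->
  eta_sub = HH - 2 * HK + KK -> HH = a * a * hh -> HK = a * b * hk -> KK = b * b * kk ->
  subhk = hh - 2 * hk + kk -> subkj = kk - 2 * kj + jj -> 0 <= subhk -> 0 <= subkj ->
  0 <= a ^+ 2 * hh + 2 * a * (b - 2 * a) * hk + (b - 2 * a) ^+ 2 * kk ->
  0 <= 1 ^+ 2 * kk + 2 * 1 * (-2) * kj + (-2) ^+ 2 * jj ->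
  eta_sub <= 2 * K ^+ 2 * subhk + 4 * K ^+ 2 * subkj + 4 * K ^+ 2 * C * (r * r).
Proof.
move=> K0 a0 aK b0 bK abr jC jj0 -> -> -> -> G1E G2E G1_ge0 G2_ge0 q1 q2.
have C0 : 0 <= C := le_trans jj0 jC.
have a2 : a ^+ 2 <= K ^+ 2 by rewrite ler_sqr ?nnegrE.
have ab2 : (a - b) ^+ 2 <= K ^+ 2.
  rewrite -[X in X <= _]real_normK ?num_real// ler_sqr ?nnegrE// ler_norml.
  by apply/andP; split; lra.
have abr2 : (a - b) ^+ 2 <= K ^+ 2 * (r * r).
  rewrite -expr2 -[X in X <= _]real_normK ?num_real// -[X in _ <= _ * X]real_normK ?num_real//.
  by rewrite -exprMn ler_sqr ?nnegrE// mulr_ge0.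
have s1 : a * a * hh - 2 * (a * b * hk) + b * b * kk <= 2 * a ^+ 2 * subhk + 2 * (a - b) ^+ 2 * kk.
  rewrite -subr_ge0; apply: le_trans q1 _; rewrite le_eqVlt; apply/orP; left; apply/eqP.
  by rewrite G1E; ring.
have s2 : kk <= 2 * subkj + 2 * C by move: q2 jC; rewrite G2E; lra.
(* The factor [(a - b)^2] is bounded by [K^2] in front of [subkj], and by [K^2 r^2] in front of
   [C]. *)
have s3 : (a - b) ^+ 2 * kk <= 2 * K ^+ 2 * subkj + 2 * K ^+ 2 * (r * r) * C.
  apply: le_trans (ler_wpM2l (sqr_ge0 _) s2) _.
  have := ler_wpM2r G2_ge0 ab2; have := ler_wpM2r C0 abr2.
  by move: ((a - b) ^+ 2) => c; lra.
have s4 := ler_wpM2r G1_ge0 a2.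
by apply: le_trans s1 _; move: s3 s4; lra.
Qed.

(** * Composition with a smooth function of one variable *)

Section PostComposition.
Variables (R : realType) (d : nat) (M : ptopologicalType).
Variables (g : riemannian R d M) (U : M -> R) (pi : probability (borel M) R).
Implicit Types (a e l : R) (h k u v w y z : M -> R) (f : nat -> M -> R).

Local Notation nL := (seminorm (dotL2 pi)).
Local Notation A0 := (pre_generator g U).
Local Notation Gamma h k := (vdot (grad g h) (grad g k)).

Variables (eta eta1 eta2 : R -> R) (K : R).
Hypothesis eta_derive : forall s : R, is_derive s (1 : R) eta (eta1 s).
Hypothesis eta1_derive : forall s : R, is_derive s (1 : R) eta1 (eta2 s).
Hypothesis eta_smooth : forall h, smooth g h -> smooth g (eta \o h).
Hypothesis eta1_ge0 : forall s : R, 0 <= eta1 s.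
Hypothesis eta1_le : forall s : R, eta1 s <= K.
Hypothesis eta_lip : forall s t : R, `|eta s - eta t| <= K * `|s - t|.
Hypothesis eta1_lip : forall s t : R, `|eta1 s - eta1 t| <= K * `|s - t|.

Let K0 : 0 <= K.
Proof. exact: le_trans (eta1_ge0 0) (eta1_le 0). Qed.

Lemma vdot_post (X : field g) h x : smooth g h ->
  vdot X (grad g (eta \o h)) x = eta1 (h x) * vdot X (grad g h) x.
Proof.
move=> hs; have [d1 e1] := eta_derive (h x).
rewrite (vdot_grad_post _ (hs 1)); last by apply/derivable1_diffP.
by rewrite derive1E e1.
Qed.

Lemma pre_generator_post h w : A0 h w -> exists z, A0 (eta \o h) z.
Proof.
move=> [hs [Lh Lhh _]]; eexists; split; first exact: eta_smooth.
by eexists; [exact: (is_laplacian_post eta_derive eta1_derive hs Lhh)|reflexivity].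
Qed.

(** [eta] may be nonzero at 0: [eta o u - eta 0] is dominated by [K |u|], and constants are in L^2
    of a probability measure. *)
Lemma L2_post u : L2 pi u -> L2 pi (eta \o u).
Proof.
move=> Lu; have mu := L2_measurable Lu.
have ce : continuous eta.
  by move=> s; have [d1 _] := eta_derive s; apply/differentiable_continuous/derivable1_diffP.
have me : measurable_fun [set: borel M] (eta \o u : borel M -> R).
  by apply: measurableT_comp mu; exact: continuous_measurable_fun.
have bnd x : `|eta (u x) - eta 0| <= `|K * u x|.
  by rewrite normrM (ger0_norm K0); have := eta_lip (u x) 0; rewrite subr0.
have L0 : L2 pi (fun x => eta (u x) - eta 0).
  have m0 : measurable_fun [set: borel M] ((fun x => eta (u x) - eta 0) : borel M -> R).
    by apply: measurable_funB => //; exact: measurable_cst.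
  apply: L2_sqr_integrable => //.
  apply: (le_integrable measurableT _ _ (L2_integrableM (L2Z K Lu) (L2Z K Lu))).
    by apply/measurable_EFinP; exact: measurable_funX.
  move=> x _ /=; rewrite lee_fin normrX -expr2 normrX.
  by rewrite ler_pXn2r// nnegrE.
have := L2D L0 (L2_cst pi (eta 0)).
by rewrite (_ : (fun x => _) = (eta \o u))//; apply/funext => x; rewrite subrK.
Qed.

Lemma strong_cvg_post f u : strong_cvg (L2 pi) (dotL2 pi) f u ->
  strong_cvg (L2 pi) (dotL2 pi) (fun n => eta \o f n) (eta \o u).
Proof.
move=> [Lf Lu H]; split; [by move=> n; exact: L2_post|exact: L2_post|].
move=> e e0; have K1 : 0 < K + 1 by rewrite ltr_wpDl.
have e1 : 0 < e / (K + 1) by rewrite divr_gt0.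
have [N HN] := H _ e1; exists N => n /HN Hn.
have b : nL (fun x => eta (f n x) - eta (u x)) <= K * nL (fun x => f n x - u x).
  apply: nL_le => //; [exact: (L2B (L2_post (Lf n)) (L2_post Lu))|exact: L2B].
apply: le_trans b _; rewrite ler_pdivlMr// mulrDr mulr1 mulrC in Hn.
have := seminorm_ge0 (dotL2 pi) (fun x => f n x - u x); move: Hn.
by move=> h1 h2; apply: le_trans h1; rewrite lerDl.
Qed.

Lemma Gamma_post h k x : smooth g h -> smooth g k ->
  Gamma (eta \o h) (eta \o k) x = eta1 (h x) * eta1 (k x) * Gamma h k x.
Proof.
move=> hs ks; have eh1 := eta_smooth hs 1.
have aux (p q r s t c c' : R) : p = c * q -> q = r -> r = c' * s -> s = t -> p = c' * c * t.
  by move=> -> -> -> ->; ring.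
apply: aux (vdot_post (grad g (eta \o h)) x ks) _ (vdot_post (grad g k) x hs) _.
  exact: (congr1 (fun F => F x) (GammaC eh1 (ks 1))).
exact: (congr1 (fun F => F x) (GammaC (ks 1) (hs 1))).
Qed.

(* [grad (eta h - eta k) = eta' h grad (h - k) + (eta' h - eta' k) grad k], and the
   gradient of [k] is compared with the gradient of a fixed [j], which is bounded. *)
Lemma Gamma_post_sub h k j (C : R) x : smooth g h -> smooth g k -> smooth g j ->
  Gamma j j x <= C ->
  Gamma (fun x => eta (h x) - eta (k x)) (fun x => eta (h x) - eta (k x)) x <=
  2 * K ^+ 2 * Gamma (fun x => h x - k x) (fun x => h x - k x) x +
  4 * K ^+ 2 * Gamma (fun x => k x - j x) (fun x => k x - j x) x +
  4 * K ^+ 2 * C * ((h x - k x) * (h x - k x)).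
Proof.
move=> hs ks js jC; have ehs := eta_smooth hs; have eks := eta_smooth ks.
apply: (post_sub_bound K0 (eta1_ge0 (h x)) (eta1_le (h x)) (eta1_ge0 (k x)) (eta1_le (k x))
  (eta1_lip (h x) (k x)) jC (vdot_ge0 _ x) (Gamma_sub x ehs eks) (Gamma_post x hs hs)
  (Gamma_post x hs ks) (Gamma_post x ks ks) (Gamma_sub x hs ks) (Gamma_sub x ks js)
  (vdot_ge0 _ x) (vdot_ge0 _ x)).
- exact: (Gamma_quad (eta1 (h x)) (eta1 (k x) - 2 * eta1 (h x)) x hs ks).
- exact: (Gamma_quad 1 (-2) x ks js).
Qed.

End PostComposition.

(** * The test functions *)

Section ShiftedSigmoid.
Variables (R : realType) (m a c : R).
Hypothesis m1 : 1 <= m.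
Implicit Types s t : R.

Let m0 : 0 <= m. Proof. exact: le_trans ler01 m1. Qed.

(** The values [a = c = 0] serve for [p <= 0], and [a = - l^-1], [c = 1] for [l p >= - 1]. *)
Definition shifted_sigmoid s : R := sigmoid (m * (s - a)) - c.
(** The first derivative. The second one, defined next, enters the Laplacian of the composition. *)
Definition shifted_sigmoid1 s : R := m * (sigmoid (m * (s - a)) * (1 - sigmoid (m * (s - a)))).
Definition shifted_sigmoid2 s : R := m * (m * (sigmoid (m * (s - a)) * (1 - sigmoid (m * (s - a))) *
  (1 - 2 * sigmoid (m * (s - a))))).

Let is_derive_affine s : is_derive s (1 : R) (fun t => m * (t - a)) m.
Proof. by apply: is_derive_eq; rewrite /GRing.scale/= subr0 !mulr1 ?mulr0 ?addr0 ?add0r. Qed.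

Let is_derive_sig s : is_derive s (1 : R) (fun t => sigmoid (m * (t - a))) (shifted_sigmoid1 s).
Proof.
have := @is_derive1_comp _ (@sigmoid R) (fun t => m * (t - a)) s _ _ (is_derive_sigmoid (m * (s - a))) (is_derive_affine s).
by rewrite mulrC.
Qed.

Lemma is_derive_shifted_sigmoid s : is_derive s (1 : R) shifted_sigmoid (shifted_sigmoid1 s).
Proof.
have H := is_derive_sig s.
have := is_deriveB H (is_derive_cst c s 1); rewrite subr0; exact.
Qed.

Lemma is_derive_shifted_sigmoid1 s : is_derive s (1 : R) shifted_sigmoid1 (shifted_sigmoid2 s).
Proof.
have H := is_derive_sig s.
have H1 := is_deriveB (is_derive_cst (1 : R) s 1) H.
have H2 := is_deriveZ m (is_deriveM H H1).
rewrite (_ : shifted_sigmoid1 = m \*: ((fun t => sigmoid (m * (t - a))) *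
  (cst 1 - (fun t => sigmoid (m * (t - a)))))); last by apply/funext.
apply: (is_derive_eq H2).
rewrite -[(cst 1 - _) s]/(1 - sigmoid (m * (s - a))) /GRing.scale/=.
by rewrite /shifted_sigmoid1 /shifted_sigmoid2; ring.
Qed.

Lemma shifted_sigmoid1_ge0 s : 0 <= shifted_sigmoid1 s.
Proof.
rewrite /shifted_sigmoid1; move: (m * (s - a)) => t.
by rewrite mulr_ge0// mulr_ge0// ?subr_ge0 ltW// ?sigmoid_gt0 ?sigmoid_lt1.
Qed.

(** One constant [K] has to bound the derivative and both Lipschitz constants; for [1 <= m] the
    choice [m^2] does. *)
Let mm : m <= m ^+ 2.
Proof. by rewrite expr2 ler_peMl. Qed.

Lemma shifted_sigmoid1_le s : shifted_sigmoid1 s <= m ^+ 2.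
Proof.
rewrite /shifted_sigmoid1; move: (m * (s - a)) => t; apply: le_trans mm; rewrite ler_piMr//.
by have := sigmoid_gt0 t; have := sigmoid_lt1 t => ? ?; rewrite mulr_ile1//; lra.
Qed.

Let affine_lip s t : `|m * (s - a) - m * (t - a)| = m * `|s - t|.
Proof. by rewrite -mulrBr opprB addrA subrK normrM ger0_norm. Qed.

Lemma shifted_sigmoid_lip s t : `|shifted_sigmoid s - shifted_sigmoid t| <= m ^+ 2 * `|s - t|.
Proof.
rewrite /shifted_sigmoid opprB addrA subrK; apply: le_trans (sigmoid_lip _ _) _.
by rewrite affine_lip ler_wpM2r.
Qed.

Lemma shifted_sigmoid1_lip s t : `|shifted_sigmoid1 s - shifted_sigmoid1 t| <= m ^+ 2 * `|s - t|.
Proof.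
rewrite /shifted_sigmoid1 -mulrBr normrM ger0_norm// expr2 -mulrA ler_wpM2l// -affine_lip.
apply: le_trans (sigmoid_lip _ _).
move: (m * (s - a)) (m * (t - a)) => x y.
have -> : sigmoid x * (1 - sigmoid x) - sigmoid y * (1 - sigmoid y) =
  (sigmoid x - sigmoid y) * (1 - (sigmoid x + sigmoid y)) by ring.
rewrite normrM ler_piMr// ler_norml.
have := sigmoid_gt0 x; have := sigmoid_lt1 x; have := sigmoid_gt0 y; have := sigmoid_lt1 y.
by move=> ? ? ? ?; apply/andP; split; lra.
Qed.

End ShiftedSigmoid.

Lemma smooth_shifted_sigmoid (R : realType) (d : nat) (M : ptopologicalType)
  (g : riemannian R d M) (m a c : R) (h : M -> R) :
  smooth g h -> smooth g (shifted_sigmoid m a c \o h).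
Proof.
move=> hs; have h1 := smooth_scaleD m hs (@smooth_cst R d M g (- (m * a))).
have h2 := smoothB (smooth_sigmoid h1) (@smooth_cst R d M g c).
rewrite (_ : _ \o h = (fun x => (@sigmoid R \o (fun x => m * h x - m * a)) x - c))//.
by apply/funext => x; rewrite /shifted_sigmoid/= mulrBr.
Qed.

(** * Sign of a function from sigmoid tests *)

Section NonpositiveTest.
Variables (R : realType) (M : ptopologicalType) (pi : probability (borel M) R).
Implicit Types (q t u v : M -> R).

Lemma ae_le_Rintegral u v :
  pi.-integrable setT (EFin \o (u : borel M -> R)) -> pi.-integrable setT (EFin \o (v : borel M -> R)) ->
  {ae pi, forall x, u x <= v x} -> (\int[pi]_x u x <= \int[pi]_x v x)%R.
Proof.
move=> iu iv uv; rewrite -subr_ge0 -RintegralB//.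
have iB : pi.-integrable setT (EFin \o ((fun x => v x - u x) : borel M -> R)).
  by have := integrableB measurableT iv iu; apply: eq_integrable.
have [mB _] := integrableP _ _ _ iB; have mB' := (measurable_EFinP _ _).1 mB.
have -> : (\int[pi]_x (v x - u x) = \int[pi]_x `|v x - u x|)%R; last exact: Rintegral_ge0.
congr fine; apply: ae_eq_integral => //.
  by apply/measurable_EFinP; exact: measurableT_comp.
by apply: (@ae_mono _ _ pi (fun x => u x <= v x) _ _ uv) => x uvx _ /=; rewrite ger0_norm// subr_ge0.
Qed.

(** For [s >= 0] the sigmoid is at least 1/2; for [s <= 0] the tail bound gives
    [l s sigmoid (m s) >= - l / m]. The term with [t] is nonnegative. *)
Lemma sigmoid_test_ge (l m s t : R) : 0 < l -> 0 <= t -> 1 <= m ->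
  l / 2 * Num.max s 0 <= (l * s + t) * sigmoid (m * s) + l / m.
Proof.
move=> l0 t0 m1; have m0 : 0 < m by exact: lt_le_trans m1.
have sg := sigmoid_gt0 (m * s); rewrite mulrDl.
have ts : 0 <= t * sigmoid (m * s) by rewrite mulr_ge0// ltW.
have lm : 0 < l / m by rewrite divr_gt0.
have [s0|/ltW s0] := leP 0 s.
  have /sigmoid_ge H : 0 <= m * s by rewrite mulr_ge0// ltW.
  have := ler_wpM2l (mulr_ge0 (ltW l0) s0) H.
  by rewrite (_ : l * s / 2 = l / 2 * s); [lra|ring].
have /sigmoid_tail H : m * s <= 0 by rewrite pmulr_rle0.
have := ler_wpM2l (ltW lm) H; rewrite mulr1.
rewrite (_ : l / m * (- (m * s) * sigmoid (m * s)) = - (l * s * sigmoid (m * s))); last by field; rewrite gt_eqF.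
by rewrite mulr0; lra.
Qed.

Lemma L2_sigmoid (m : R) q : L2 pi q -> L2 pi (fun x => sigmoid (m * q x)).
Proof.
move=> /(L2Z m)/L2_measurable mq; apply: (@L2_bounded _ _ _ _ 1).
  apply: (measurableT_comp (f := @sigmoid R)) mq.
  apply: continuous_measurable_fun => s; have [d1 _] := is_derive_sigmoid s.
  exact/differentiable_continuous/derivable1_diffP.
move=> x; rewrite ger0_norm ltW// ?sigmoid_lt1//; exact: sigmoid_gt0.
Qed.

(** Integrating the pointwise bound yields [l / 2] times the integral of the positive part of [q] at
    most [l / m], for every [m >= 1]. The integral is therefore 0. *)
Lemma ae_le0_of_sigmoid (l : R) q t : 0 < l -> L2 pi q -> L2 pi t -> {ae pi, forall x, 0 <= t x} ->
  (forall m, 1 <= m -> dotL2 pi (fun x => l * q x + t x) (fun x => sigmoid (m * q x)) <= 0) ->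
  {ae pi, forall x, q x <= 0}.
Proof.
move=> l0 Lq Lt t0 H; pose r x := Num.max (q x) 0.
have mr : measurable_fun [set: borel M] (r : borel M -> R).
  apply: (@measurable_maxr _ (borel M) R setT q (cst 0)); [exact: L2_measurable Lq|exact: measurable_cst].
have r0 x : 0 <= r x by rewrite /r le_max lexx orbT.
have ir : pi.-integrable setT (EFin \o (r : borel M -> R)).
  have := L2_integrableM Lq (L2_cst pi 1); apply: le_integrable => //; first exact/measurable_EFinP.
  move=> x _ /=; rewrite lee_fin mulr1 (ger0_norm (r0 x)) /r ge_max normr_ge0 andbT.
  exact: ler_norm.
have ilr : pi.-integrable setT (EFin \o ((fun x => l / 2 * r x) : borel M -> R)).
  by have := integrableZl measurableT (l / 2) ir; apply: eq_integrable.
have intr : (\int[pi]_x r x <= 0)%R.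
  apply/ler_addgt0Pl => e e0; rewrite addr0.
  (* After division by [l / 2] the bound is [2 / m], which must not exceed [e]. *)
  pose m : R := Num.max 1 (2 / e); have m1 : 1 <= m by rewrite /m le_max lexx.
  have m0 : 0 < m by exact: lt_le_trans m1.
  have me : 2 / m <= e.
    rewrite ler_pdivrMr// mulrC -ler_pdivrMr//; by rewrite /m le_max lexx orbT.
  have Ls := L2_sigmoid m Lq; have Lqt := L2D (L2Z l Lq) Lt.
  have i1 := L2_integrableM Lqt Ls.
  have i2 : pi.-integrable setT (EFin \o ((fun=> l / m) : borel M -> R)).
    apply: (bounded_integrable pi (C := `|l / m|)) => //; exact: measurable_cst.
  have i3 : pi.-integrable setT
      (EFin \o ((fun x => (l * q x + t x) * sigmoid (m * q x) + l / m) : borel M -> R)).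
    by have := integrableD measurableT i1 i2; apply: eq_integrable.
  have := ae_le_Rintegral ilr i3 _.
  rewrite (RintegralZl (l / 2) measurableT ir) (RintegralD measurableT i1 i2).
  have -> : (\int[pi]_(_ in [set: borel M]) (l / m) = l / m)%R.
    rewrite Rintegral_cst//; apply: etrans (congr1 (fun c => l / m * fine c) (probability_setT pi)) _.
    by rewrite mulr1.
  move=> /(_ (ae_mono (fun x tx => sigmoid_test_ge (q x) l0 tx m1) t0)) K.
  have {}K : l / 2 * (\int[pi]_x r x)%R <= l / m.
    apply: le_trans K _; rewrite -[leRHS]add0r lerD2r; exact: H.
  rewrite -(ler_pM2l (x := l / 2)); last by rewrite divr_gt0.
  apply: le_trans K _; rewrite (_ : l / m = l / 2 * (2 / m)); last by field; rewrite gt_eqF.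
  by rewrite ler_wpM2l// ltW// divr_gt0.
apply: (ae_mono _ (integral_ge0_eq0 r0 ir intr)) => x rx.
by rewrite -rx /r le_max lexx.
Qed.

End NonpositiveTest.

(** * Nonlinear test functions in the form domain and in the kernel *)

Section Contraction.
Variables (R : realType) (d : nat) (M : ptopologicalType).
Hypotheses (hM : hausdorff_space M) (cM : compact [set: M]).
Variable g : riemannian R d M.
Variable vol : {measure set (borel M) -> \bar R}.
Hypothesis hvol : is_volume g vol.
Variable U : M -> R.
Hypothesis hU : class_C g 1 U.
Variable pi : probability (borel M) R.
Hypothesis hpi : forall S : set (borel M), measurable S ->
    pi S = (\int[vol]_(x in S) (expR (- U x))%:E)%E.
Implicit Types (a e l : R) (h k u v w y z : M -> R) (f : nat -> M -> R).

Local Notation D := (dotL2 pi).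
Local Notation E := (energy g pi).
Local Notation nL := (seminorm (dotL2 pi)).
Local Notation Gamma h k := (vdot (grad g h) (grad g k)).
Local Notation form_closure := (form_closure (L2 pi) (smooth g) (dotL2 pi) (energy g pi)).
Local Notation in_closure := (in_closure (L2 pi) (smooth g) (dotL2 pi) (energy g pi)).
Local Notation Q := (closed_form (L2 pi) (smooth g) (dotL2 pi) (energy g pi)).
Local Notation form_domain := (form_domain (L2 pi) (smooth g) (dotL2 pi) (energy g pi) (pre_generator g U)).

Let Lsc : forall a h k, L2 pi h -> L2 pi k -> L2 pi (fun x => a * h x + k x).
Proof. by move=> a h k; exact: L2_scaleD. Qed.

Let Dsym : forall h k, L2 pi h -> L2 pi k -> D h k = D k h.
Proof. by move=> h k _ _; exact: dotL2C. Qed.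

Let Dsc : forall a h k z, L2 pi h -> L2 pi k -> L2 pi z ->
  D z (fun x => a * h x + k x) = a * D z h + D z k.
Proof. exact: dotL2_scaleDr. Qed.

Let Dge0 : forall h, L2 pi h -> 0 <= D h h.
Proof. by move=> h _; exact: dotL2_ge0. Qed.

Let Ssc : forall a h k, smooth g h -> smooth g k -> smooth g (fun x => a * h x + k x).
Proof. by move=> a h k; exact: smooth_scaleD. Qed.

Let Esym := @energyC R d M g pi.
Let Esc := @energy_scaleDr R d M cM g pi.
Let Ege0 : forall h, smooth g h -> 0 <= E h h.
Proof. by move=> h _; exact: energy_ge0. Qed.
Let green_ex := energy_green hM cM hvol hU hpi.

Let Q_lim := closed_form_lim Lsc Dsym Dsc Dge0 Ssc Esym Esc Ege0 green_ex.

Section PostForm.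
Variables (eta eta1 eta2 : R -> R) (K : R).
Hypothesis eta_derive : forall s : R, is_derive s (1 : R) eta (eta1 s).
Hypothesis eta1_derive : forall s : R, is_derive s (1 : R) eta1 (eta2 s).
Hypothesis eta_smooth : forall h, smooth g h -> smooth g (eta \o h).
Hypothesis eta1_ge0 : forall s : R, 0 <= eta1 s.
Hypothesis eta1_le : forall s : R, eta1 s <= K.
Hypothesis eta_lip : forall s t : R, `|eta s - eta t| <= K * `|s - t|.
Hypothesis eta1_lip : forall s t : R, `|eta1 s - eta1 t| <= K * `|s - t|.

Let K0 : 0 <= K.
Proof. exact: le_trans (eta1_ge0 0) (eta1_le 0). Qed.

Lemma energy_post_sub h k j (C : R) : smooth g h -> smooth g k -> smooth g j ->
  (forall x, Gamma j j x <= C) ->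
  E (fun x => eta (h x) - eta (k x)) (fun x => eta (h x) - eta (k x)) <=
  2 * K ^+ 2 * E (fun x => h x - k x) (fun x => h x - k x) +
  4 * K ^+ 2 * E (fun x => k x - j x) (fun x => k x - j x) +
  4 * K ^+ 2 * C * D (fun x => h x - k x) (fun x => h x - k x).
Proof.
move=> hs ks js jC; have s1 := smoothB hs ks; have s2 := smoothB ks js.
have s0 := smoothB (eta_smooth hs) (eta_smooth ks).
have i0 := Gamma_integrable cM pi s0 s0; have i1 := Gamma_integrable cM pi s1 s1.
have i2 := Gamma_integrable cM pi s2 s2.
have L1 := smooth_L2 cM pi s1; have i3 := L2_integrableM L1 L1.
have Z c (F : borel M -> R) : pi.-integrable setT (EFin \o F) ->
    pi.-integrable setT (EFin \o (fun x => c * F x)).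
  by move=> iF; have := integrableZl measurableT c iF; apply: eq_integrable.
have P (F G : borel M -> R) : pi.-integrable setT (EFin \o F) -> pi.-integrable setT (EFin \o G) ->
    pi.-integrable setT (EFin \o (fun x => F x + G x)).
  by move=> iF iG; have := integrableD measurableT iF iG; apply: eq_integrable.
rewrite -[_ * E _ _](RintegralZl (2 * K ^+ 2) measurableT i1).
rewrite -[_ * E _ _](RintegralZl (4 * K ^+ 2) measurableT i2).
rewrite -[_ * D _ _](RintegralZl (4 * K ^+ 2 * C) measurableT i3).
rewrite -(RintegralD measurableT (Z _ _ i1) (Z _ _ i2)).
rewrite -(RintegralD measurableT (P _ _ (Z _ _ i1) (Z _ _ i2)) (Z _ _ i3)).
apply: (le_Rintegral measurableT i0 (P _ _ (P _ _ (Z _ _ i1) (Z _ _ i2)) (Z _ _ i3))) => x _.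
exact: (Gamma_post_sub eta_derive eta_smooth eta1_ge0 eta1_le eta1_lip hs ks js (jC x)).
Qed.

(** The order of the choices matters. First [N1] makes the energies of differences small; the
    gradient of [f N1] is bounded by some [C] as [M] is compact; then [N2] makes the L^2 distances
    small relative to [C]. *)
Lemma form_closure_post f u : form_closure f u -> form_closure (fun n => eta \o f n) (eta \o u).
Proof.
move=> [Sf fu Ef]; split; first by move=> n; exact: eta_smooth.
  exact: (strong_cvg_post eta_derive eta1_ge0 eta1_le eta_lip fu).
have [Lf Lu H] := fu => e e0.
have K1 : 0 < K + 1 by rewrite ltr_wpDl.
have e1 : 0 < e / (4 * (K + 1)) by rewrite divr_gt0// mulr_gt0.
have [N1 H1] := Ef _ e1.
have [C0 HC] := continuous_bounded cM (Gamma_continuous (Sf N1) (Sf N1)).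
pose C := `|C0|; have CP : 0 <= C by exact: normr_ge0.
have zC x : Gamma (f N1) (f N1) x <= C.
  exact: le_trans (ler_norm _) (le_trans (HC x) (ler_norm _)).
have C1 : 0 < C + 1 by rewrite ltr_wpDl.
(* 8 is twice 4, because two terms of the sequence are compared through [u]. *)
have e2 : 0 < e / (8 * (K + 1) * (C + 1)) by rewrite divr_gt0// !mulr_gt0.
have [N2 H2] := H _ e2.
exists (maxn N1 N2) => n m; rewrite !geq_max => /andP[n1 n2] /andP[m1 m2].
have Sd := smoothB (eta_smooth (Sf n)) (eta_smooth (Sf m)).
rewrite (seminorm_le_sqr Ege0 Sd (ltW e0)).
apply: le_trans (energy_post_sub (Sf n) (Sf m) (Sf N1) zC) _.
rewrite -(sqr_seminorm Ege0 (smoothB (Sf n) (Sf m))) -(sqr_seminorm Ege0 (smoothB (Sf m) (Sf N1))).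
rewrite -(sqr_nL (L2B (Lf n) (Lf m))).
have b3 : nL (fun x => f n x - f m x) <= e / (4 * (K + 1) * (C + 1)).
  apply: le_trans (nL_triangle_sub (Lf n) (Lf m) Lu) _.
  rewrite (nL_subC Lu (Lf m)).
  have -> : e / (4 * (K + 1) * (C + 1)) = e / (8 * (K + 1) * (C + 1)) + e / (8 * (K + 1) * (C + 1)).
    by field; rewrite !gt_eqF.
  by apply: lerD; exact: H2.
(* Each of [(K p)^2], [(K q)^2] and [C (K r)^2] is at most [(e / 4)^2], and 2 + 4 + 4 <= 16. *)
have aux (p q r : R) : 0 <= p -> 0 <= q -> 0 <= r -> p <= e / (4 * (K + 1)) -> q <= e / (4 * (K + 1)) ->
    r <= e / (4 * (K + 1) * (C + 1)) ->
    2 * K ^+ 2 * p ^+ 2 + 4 * K ^+ 2 * q ^+ 2 + 4 * K ^+ 2 * C * r ^+ 2 <= e ^+ 2.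
  move=> p0 q0 r0 pe qe re.
  have lin t : 0 <= t -> t <= e / (4 * (K + 1)) -> (K * t) ^+ 2 <= (e / 4) ^+ 2.
    move=> t0 te; rewrite ler_sqr ?nnegrE ?mulr_ge0 ?divr_ge0 ?(ltW e0)//.
    rewrite ler_pdivlMr ?mulr_gt0// in te; rewrite ler_pdivlMr//; lra.
  have kp := lin _ p0 pe; have kq := lin _ q0 qe.
  have kr : (K * ((C + 1) * r)) ^+ 2 <= (e / 4) ^+ 2.
    apply: lin; first by rewrite mulr_ge0// ltW.
    move: re; rewrite !ler_pdivlMr ?mulr_gt0// => re; apply: le_trans re.
    by rewrite le_eqVlt; apply/orP; left; apply/eqP; ring.
  have kc : C * (K * r) ^+ 2 <= (K * ((C + 1) * r)) ^+ 2.
    have -> : (K * ((C + 1) * r)) ^+ 2 = (C + 1) ^+ 2 * (K * r) ^+ 2 by ring.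
    apply: ler_wpM2r; first exact: sqr_ge0.
    by have := sqr_ge0 C; rewrite sqrrD; lra.
  have e20 := sqr_ge0 e; rewrite !exprMn in kp kq kr kc *; lra.
apply: aux b3; rewrite ?seminorm_ge0//; first exact: H1.
by apply: H1.
Qed.

Lemma form_domain_post u : form_domain u -> form_domain (eta \o u).
Proof.
move=> [f [gf fu]]; exists (fun n => eta \o f n); split; last exact: form_closure_post.
by move=> n; have [w fw] := gf n; exact: (pre_generator_post eta_derive eta1_derive eta_smooth fw).
Qed.

(** On the approximating smooth functions the integrand is [eta' (f) |grad f|^2], and the sign
    survives the limit. *)
Lemma form_post_ge0 u : in_closure u -> 0 <= Q u (eta \o u).
Proof.
move=> [f fu]; have [Sf _ _] := fu.
apply: (cvgn_le_lim (Q_lim fu (form_closure_post fu)) (N := 0%N)) => n _.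
apply: Rintegral_ge0 => x _; have e := vdot_post eta_derive (grad g (f n)) x (Sf n).
by rewrite e mulr_ge0 ?vdot_ge0.
Qed.

Section Kernel.
Variables (lambda : nat -> R) (phi : nat -> M -> R).
Hypothesis hspec : discrete_spectrum pi (generator g U pi) lambda phi.
Variables (b : field g) (B : (M -> R) -> M -> R).
Hypothesis hB : extends_transport pi lambda phi b B.

Let H1P u := H1_form_domain hM cM hvol hU hpi hspec u.

(** Along approximating smooth functions, [b . grad (eta o f_n)] is dominated by [K |b . grad f_n|],
    whose L^2 norm tends to that of [K B u], which is 0. A bound on [eta' (f_n)] thus replaces its
    convergence. *)
Lemma kerB_post u : kerB pi lambda phi B u -> kerB pi lambda phi B (eta \o u).
Proof.
move=> [uH Bu0]; have ud := (H1P u).1 uH; have eud := form_domain_post ud.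
have euH := (H1P _).2 eud; split => //.
have [f [_ fu]] := ud; have efu := form_closure_post fu; have [Sf _ _] := fu.
have [LB HB] := hB uH; have [LeB HeB] := hB euH.
have /cvgL2_strong[Ly _ cy] := HB _ ((cvgH1P _ _ _ _).2 fu).
have /cvgL2_strong[Lx _ cx] := HeB _ ((cvgH1P _ _ _ _).2 efu).
have LB0 : nL (B u) = 0.
  rewrite /seminorm (ae_eq_dotL2 (v := fun=> 0) Bu0 LB (L2_cst pi 0) LB).
  have := dotL2Zl 0 LB LB; rewrite mul0r => H.
  rewrite (_ : D (fun=> 0) (B u) = 0) ?sqrtr0// -H.
  by congr (D _ _); apply/funext => x; rewrite mul0r.
have K1 : 0 < K + 1 by rewrite ltr_wpDl.
apply: nL_eq0 => // e e0; have e2 : 0 < e / 2 by rewrite divr_gt0.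
have e3 : 0 < e / 2 / (K + 1) by rewrite divr_gt0.
have [N1 H1] := cx _ e2; have [N2 H2] := cy _ e3.
pose n := maxn N1 N2; have h1 := H1 n (leq_maxl _ _); have h2 := H2 n (leq_maxr _ _).
have t1 := nL_triangle LeB (Lx n); rewrite (nL_subC LeB (Lx n)) in t1.
have t2 := nL_triangle (Ly n) LB; rewrite LB0 addr0 in t2.
have t3 : nL (vdot b (grad g (eta \o f n))) <= K * nL (vdot b (grad g (f n))).
  apply: nL_le => // x; rewrite (vdot_post eta_derive b x (Sf n)) normrM ger0_norm//.
  by rewrite ler_wpM2r.
have t4 := le_trans t2 h2; rewrite ler_pdivlMr// in t4.
have p0 := seminorm_ge0 D (vdot b (grad g (f n))).
have aux (p q r s : R) : p <= q + r -> q <= e / 2 -> r <= K * s -> s * (K + 1) <= e / 2 -> 0 <= s -> p <= e.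
  move=> pq qe rs se s0; apply: le_trans pq _; rewrite [leRHS]splitr; apply: lerD => //.
  by apply: le_trans rs (le_trans _ se); rewrite mulrDr mulr1 mulrC lerDl.
exact: aux t1 h1 t3 t4 p0.
Qed.

End Kernel.

End PostForm.

(** * The projected resolvent *)

Section Resolvent.
Variables (lambda : nat -> R) (phi : nat -> M -> R).
Hypothesis hspec : discrete_spectrum pi (generator g U pi) lambda phi.
Variables (b : field g) (B : (M -> R) -> M -> R).
Hypothesis hB : extends_transport pi lambda phi b B.
Variables (l : R) (v w p : M -> R).
Hypotheses (l0 : 0 < l) (Lv : L2 pi v).
Hypothesis wres : is_resolvent g U pi l v w.
Hypothesis wp : is_proj g pi lambda phi B l w p.

Let kerB_domain u (ku : kerB pi lambda phi B u) : form_domain u.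
Proof. by case: ku => /(H1_form_domain hM cM hvol hU hpi hspec). Qed.

Let kp : kerB pi lambda phi B p.
Proof. by case: wp. Qed.

Let Lp : L2 pi p.
Proof. exact: form_domain_L (kerB_domain kp). Qed.

(** [w - p] is orthogonal to [y] for the form shifted by [l], so [p] may replace [w] in the weak
    resolvent equation tested with [y]. *)
Lemma proj_resolvent_form y : kerB pi lambda phi B y ->
  Q p y + l * D p y = - D v y.
Proof.
move=> ky; have yd := kerB_domain ky; have pd := kerB_domain kp.
have [_ wd _] := generator_weak hM cM hvol hU hpi wres.
have Lw := form_domain_L wd; have Ly := form_domain_L yd.
have Qsub := sip_subl (in_closure_scaleD Lsc Dsym Dsc Dge0 Ssc Esym Esc Ege0)
  (closed_form_sym Lsc Dsym Dsc Dge0 Ssc Esym Esc Ege0 green_ex)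
  (closed_form_scaleDr Lsc Dsym Dsc Dge0 Ssc Esym Esc Ege0 green_ex)
  (form_domain_closure wd) (form_domain_closure pd) (form_domain_closure yd).
have Qw := resolvent_form hM cM hvol hU hpi Lv wres yd.
have [_ /(_ y ky)] := wp; rewrite /dot1 dotH1E.
rewrite (_ : Q (w \- p) y = Q w y - Q p y); last exact: Qsub.
rewrite (_ : D (w \- p) y = D w y - D p y); last exact: dotL2Bl Lw Lp Ly.
rewrite Qw; move: (Q p y) (D v y) (D w y) (D p y) => q r s t H.
apply/eqP; rewrite -subr_eq0 -oppr_eq0 -H; apply/eqP; ring.
Qed.

(** Expand the squared norm of [l p + v], which is nonnegative, and insert
    [D v p = - Q p p - l D p p]. What results is the claim with the term [2 l Q p p] to spare. *)
Lemma proj_resolvent_contraction : D (fun x => l * p x) (fun x => l * p x) <= D v v.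
Proof.
have Llp := L2Z l Lp.
have Qp := proj_resolvent_form kp.
have Qp0 : 0 <= Q p p.
  exact: (closed_form_ge0 Lsc Dsym Dsc Dge0 Ssc Esym Esc Ege0 green_ex
    (form_domain_closure (kerB_domain kp))).
have := Dge0 (L2D Llp Lv).
rewrite (dotL2Dl Llp Lv (L2D Llp Lv)) (dotL2C pi (fun x => l * p x) (fun x => _ + _)).
rewrite (dotL2C pi v (fun x => _ + _)) (dotL2Dl Llp Lv Llp) (dotL2Dl Llp Lv Lv).
rewrite (dotL2C pi v (fun x => l * p x)) (dotL2Zl l Lp Lv) (dotL2Zl l Lp Llp) (dotL2Zr l Lp Lp).
rewrite (dotL2C pi p v).
move: (Q p p) (D v p) (D p p) (D v v) Qp Qp0 => q r s t Qp Qp0.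
have rE : r = - q - l * s by rewrite -[r]opprK -Qp; ring.
have lq := mulr_ge0 (ltW l0) Qp0; rewrite rE.
rewrite (_ : l * (- q - l * s) = - (l * q) - l * (l * s)); last by ring.
by move: lq; move: (l * q) (l * (l * s)) => ? ?; lra.
Qed.

Lemma proj_resolvent_test (m a c : R) : 1 <= m ->
  D (fun x => l * p x + v x) (fun x => sigmoid (m * (p x - a)) - c) <= 0.
Proof.
move=> m1; pose eta := shifted_sigmoid m a c.
have e1 := is_derive_shifted_sigmoid m a c.
have e2 := is_derive_shifted_sigmoid1 m a.
have es := smooth_shifted_sigmoid m a c (g := g).
have ep := shifted_sigmoid1_ge0 a m1; have el := shifted_sigmoid1_le a m1.
have l1 := shifted_sigmoid_lip a c m1; have l2 := shifted_sigmoid1_lip a m1.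
have ky : kerB pi lambda phi B (eta \o p) := kerB_post e1 e2 es ep el l1 l2 hspec hB kp.
have Ly := form_domain_L (kerB_domain ky).
have Qy : 0 <= Q p (eta \o p) := form_post_ge0 e1 es ep el l1 l2 (form_domain_closure (kerB_domain kp)).
have H := proj_resolvent_form ky.
rewrite -[X in D _ X <= _]/(eta \o p) (dotL2Dl (L2Z l Lp) Lv Ly) (dotL2Zl l Lp Ly).
move: (Q _ _) (D v _) (D p _) H Qy => q r s H Qy.
by rewrite -[r]opprK -H; lra.
Qed.

Lemma proj_resolvent_markov : {ae pi, forall x, 0 <= v x <= 1} ->
  {ae pi, forall x, 0 <= l * - p x <= 1}.
Proof.
move=> v01.
have v0 : {ae pi, forall x, 0 <= v x} by apply: (ae_mono _ v01) => x /andP[].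
have v1 : {ae pi, forall x, 0 <= 1 - v x}.
  by apply: (ae_mono _ v01) => x /andP[_]; rewrite subr_ge0.
have p0 : {ae pi, forall x, p x <= 0}.
  apply: (ae_le0_of_sigmoid l0 Lp Lv v0) => m m1.
  have := proj_resolvent_test 0 0 m1; congr (D _ _ <= _).
  by apply/funext => x; rewrite !subr0.
(* The upper bound is the lower one reflected: [l q + (1 - v) = - (l p + v)] and [sigmoid (m q) = 1
   - sigmoid (m (p + 1 / l))], so the two sign changes cancel in the product. *)
pose q x := - p x - l^-1; have Lq : L2 pi q := L2B (L2N Lp) (L2_cst pi l^-1).
have Lv1 : L2 pi (fun x => 1 - v x) := L2B (L2_cst pi 1) Lv.
have q0 : {ae pi, forall x, q x <= 0}.
  apply: (ae_le0_of_sigmoid l0 Lq Lv1 v1) => m m1.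
  have := proj_resolvent_test (- l^-1) 1 m1; congr (_ <= _); apply: eq_Rintegral => x _.
  have -> : m * (p x - - l^-1) = - (m * q x) by rewrite /q; ring.
  rewrite sigmoidN; have -> : l * q x + (1 - v x) = - (l * p x + v x).
    by rewrite /q; field; rewrite gt_eqF.
  by ring.
apply: (ae_mono _ (ae_and p0 q0)) => x [px qx]; apply/andP; split.
  by rewrite mulr_ge0 ?(ltW l0)// oppr_ge0.
by rewrite -ler_pdivlMl// mulr1 -subr_le0.
Qed.

End Resolvent.

End Contraction.

(** The first alternative is the default value of [xget], for which both inequalities are
    immediate. *)
Lemma Rstar_spec (R : realType) (d : nat) (M : ptopologicalType) (g : riemannian R d M)
  (U : M -> R) (pi : probability (borel M) R) (lambda : nat -> R) (phi : nat -> M -> R)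
  (B : (M -> R) -> M -> R) (l : R) (v : M -> R) :
  Rstar g U pi lambda phi B l v = (fun=> 0) \/
  exists w p, [/\ is_resolvent g U pi l v w, is_proj g pi lambda phi B l w p &
    Rstar g U pi lambda phi B l v = \- p].
Proof.
rewrite /Rstar; case: xgetP => [u _ [w [p [res proj uE]]]|_]; last by left.
by right; exists w, p; split.
Qed.

Theorem corollary2 (R : realType) (d : nat) (M : ptopologicalType)
  (hM : hausdorff_space M) (cM : compact [set: M])
  (g : riemannian R d M)
  (vol : {measure set (borel M) -> \bar R}) (hvol : is_volume g vol)
  (U : M -> R) (hU : class_C g 1 U)
  (pi : probability (borel M) R)
  (hpi : forall S : set (borel M), measurable S ->
    pi S = (\int[vol]_(x in S) (expR (- U x))%:E)%E)
  (lambda : nat -> R) (phi : nat -> M -> R)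
  (hspec : discrete_spectrum pi (generator g U pi) lambda phi)
  (b : field g) (hb : field_C 1 b)
  (hdiv : is_div (scale_field (fun x => expR (- U x)) b) (fun=> 0))
  (hdom : forall u, H1 pi lambda phi u -> dom_transport pi b u)
  (B : (M -> R) -> M -> R)
  (hB : extends_transport pi lambda phi b B) :
  let Rs := Rstar g U pi lambda phi B in
  (forall (l : R) (f : M -> R), 0 < l -> L2 pi f ->
     dotL2 pi (l \*o Rs l f) (l \*o Rs l f) <= dotL2 pi f f) /\
  (forall (l : R) (f : M -> R), 0 < l -> L2 pi f ->
     {ae pi, forall x, 0 <= f x <= 1} ->
     {ae pi, forall x, 0 <= l * Rs l f x <= 1}).
Proof.
split=> l f l0 Lf.
  have [->|[w [p [res proj ->]]]] := Rstar_spec g U pi lambda phi B l f.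
    rewrite (_ : l \*o (fun=> 0) = (fun=> 0)); last by apply/funext => x; rewrite /= mulr0.
    rewrite (_ : dotL2 pi _ _ = \int[pi]_(x in [set: borel M]) 0)%R.
      by rewrite Rintegral_cst// mul0r dotL2_ge0.
    by apply: eq_Rintegral => x _; rewrite mul0r.
  apply: le_trans (proj_resolvent_contraction hM cM hvol hU hpi hspec l0 Lf res proj).
  rewrite le_eqVlt; apply/orP; left; apply/eqP; apply: eq_Rintegral => x _ /=.
  by rewrite mulrN mulrNN.
move=> f01; have [->|[w [p [res proj ->]]]] := Rstar_spec g U pi lambda phi B l f.
  by apply: (ae_mono _ f01) => x _; rewrite mulr0 lexx ler01.
exact: (proj_resolvent_markov hM cM hvol hU hpi hspec hB l0 Lf res proj f01).
Qed.
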